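(* Let $\mathcal A_\varepsilon(M,\widetilde B,\mathrm{inv})$ be a root of unity quantum cluster algebra satisfying condition (Coprime), where $\varepsilon^{1/2}$ is a primitive $\ell$-th root of unity, and let $\Theta$ be a collection of its seeds which is a nerve. (1) If $\mathcal A_\varepsilon(\Theta,\mathrm{inv})$ is a free $\mathcal C_\varepsilon(\Theta,\mathrm{inv})$-module, then it is a free module of finite rank $\ell^N$, and its discriminant with respect to the regular trace satisfies $$d\big(\mathcal A_\varepsilon(\Theta,\mathrm{inv})/\mathcal C_\varepsilon(\Theta,\mathrm{inv})\big)=_{\mathcal C_\varepsilon(\Theta,\mathrm{inv})^\times}\ell^{N\ell^N}\prod_{i\in[1,N]\setminus(\mathrm{ex}\sqcup\mathrm{inv})}M(e_i)^{\ell a_i}$$ for some $a_i\in\mathbb N$. (2) If $\mathcal A_\varepsilon(\Theta,\mathrm{inv})$ is a free $\mathcal C(\Theta,\mathrm{inv})$-module, then it is a free module of finite rank $\ell^N\varphi(\ell)$, and its discriminant with respect to the regular trace satisfies $$d\big(\mathcal A_\varepsilon(\Theta,\mathrm{inv})/\mathcal C(\Theta,\mathrm{inv})\big)=_{\mathcal C(\Theta,\mathrm{inv})^\times}\Big(\frac{\ell^{(N+1)\varphi(\ell)}}{\prod_{p\mid\ell}p^{\varphi(\ell)/(p-1)}}\Big)^{\ell^N}\prod_{i\in[1,N]\setminus(\mathrm{ex}\sqcup\mathrm{inv})}M(e_i)^{\ell c_i}$$ for some $c_i\in\mathbb N$, where $\varphi$ is Euler's function and the product over $p$ is over primes dividing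 $\ell$.
   Context: Let $\ell$ be a positive integer, $\mathbb Z_\ell=\mathbb Z/\ell\mathbb Z$, $\varepsilon^{1/2}\in\mathbb C$ a primitive $\ell$-th root of unity, $\mathcal A^{1/2}_\varepsilon=\mathbb Z[\varepsilon^{1/2}]$, $\varepsilon^{a/2}=(\varepsilon^{1/2})^a$ for $a\in\mathbb Z_\ell$; $\overline C$ is the reduction mod $\ell$ of an integer matrix $C$; $e_1,\dots,e_N$ is the standard basis of $\mathbb Z^N$; $\mathbb N=\{0,1,\dots\}$. For a skew-symmetric bilinear form $\Lambda:\mathbb Z^N\times\mathbb Z^N\to\mathbb Z_\ell$ with matrix $(\lambda_{ij})$, $\mathcal T_\varepsilon(\Lambda)$ is the $\mathcal A^{1/2}_\varepsilon$-algebra with basis $\{X^f\}_{f\in\mathbb Z^N}$ and $X^fX^g=\varepsilon^{\Lambda(f,g)/2}X^{f+g}$. A root of unity toric frame of a division algebra $\mathcal F$ over $\mathbb Q(\varepsilon^{1/2})$ is a map $M:\mathbb Z^N\to\mathcal F$ such that for some (unique) skew-symmetric $\Lambda=:\Lambda_M$ there is an injective $\mathcal A^{1/2}_\varepsilon$-algebra map $\phi:\mathcal T_\varepsilon(\Lambda)\to\mathcal F$, $\phi(X^f)=M(f)$, with $\mathcal F$ the skew field of fractions of its image. Fix $\mathrm{ex}\subseteq[1,N]$. An exchange matrix $\widetilde B=(b_{ij})$ is an integer matrix with rows indexed by $[1,N]$, columns by $\mathrm{ex}$, principal part $B$, $k$-th column $b^k$. $(\Lambda,\widetilde B)$ is $\ell$-compatible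 if there is $D=\mathrm{diag}(d_j)_{j\in\mathrm{ex}}$, $d_j\in\mathbb Z_{>0}$, with $DB$ skew-symmetric and $\sum_k\overline b_{kj}\lambda_{ki}=\delta_{ij}\overline d_j$ in $\mathbb Z_\ell$ for all $i,j\in\mathrm{ex}$-appropriate indices ($i\in[1,N]$, $j\in\mathrm{ex}$). A root of unity quantum seed is $(M,\widetilde B)$ with $(\Lambda_M,\widetilde B)$ $\ell$-compatible. Condition (Coprime): $\ell$ is odd and coprime to all $d_k$, $k\in\mathrm{ex}$. For $b\in\mathbb Z^N$, $[b]_\pm$ keeps the entries $b_i$ with $\pm b_i\ge0$ and sets the others to $0$. Mutation in direction $k\in\mathrm{ex}$: $\mu_k(\widetilde B)=(b'_{ij})$, $b'_{ij}=-b_{ij}$ if $i=k$ or $j=k$, otherwise $b'_{ij}=b_{ij}+(|b_{ik}|b_{kj}+b_{ik}|b_{kj}|)/2$; $\mu_k(M)$ is the root of unity toric frame with matrix $\overline E^\top\Lambda_M\overline E$ ($E$: $e_{ij}=\delta_{ij}$ for $j\neq k$, $e_{kk}=-1$, $e_{ik}=\max(0,-b_{ik})$ for $i\ne k$) and $\mu_k(M)(e_j)=M(e_j)$ ($j\ne k$), $\mu_k(M)(e_k)=M(-e_k+[b^k]_+)+M(-e_k-[b^k]_-)$. For $\mathrm{inv}\subseteq[1,N]\setminus\mathrm{ex}$, $\mathcal A_\varepsilon(M,\widetilde B,\mathrm{inv})$ is the $\mathcal A^{1/2}_\varepsilon$-subalgebra of $\mathcal F$ generated by all $M'(e_i)$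 over all seeds $(M',\widetilde B')$ mutation-equivalent to $(M,\widetilde B)$ and by $M(e_j)^{-1}$, $j\in\mathrm{inv}$; the elements $M(e_i)$, $i\notin\mathrm{ex}$, are the frozen variables (common to all seeds). The exchange graph has the mutation-equivalent seeds as vertices and mutations $\mu_k$ as edges labelled $k$. A collection $\Theta$ of seeds is a nerve if the subgraph of the exchange graph induced on $\Theta$ is connected and for each $k\in\mathrm{ex}$ there are at least two seeds in $\Theta$ related by $\mu_k$. $\mathcal A_\varepsilon(\Theta,\mathrm{inv})$ is the $\mathcal A^{1/2}_\varepsilon$-subalgebra generated by $M'(e_j)$, $j\in[1,N]$, and $M'(e_i)^{-1}$, $i\in\mathrm{inv}$, for $(M',\widetilde B')\in\Theta$; $\mathcal C_\varepsilon(\Theta,\mathrm{inv})$ is the $\mathcal A^{1/2}_\varepsilon$-subalgebra generated by $M'(e_j)^\ell$, $j\in[1,N]$, and $M'(e_i)^{-\ell}$, $i\in\mathrm{inv}$, for $(M',\widetilde B')\in\Theta$; $\mathcal C(\Theta,\mathrm{inv})$ is the $\mathbb Z$-subring generated by the same elements. If a ring $R$ is free of finite rank $n$ over a central subring $C$, its regular trace $\mathrm{tr}:R\to C$ is the trace of left multiplication in a $C$-basis, and the discriminant is $d(R/C)=\det(\mathrm{tr}(y_iy_j))_{i,j=1}^n$ for a $C$-basis $y_1,\dots,y_n$, well defined up to multiplication by units of $C$; $x=_{C^\times}y$ means $x=uy$ for a unit $u$ of $C$. *)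

(* Defs.v *)
From HB Require Import structures.
From mathcomp Require Import all_boot all_order all_algebra.
Set Implicit Arguments. Unset Strict Implicit. Unset Printing Implicit Defensive.
Import Order.TTheory GRing.Theory Num.Theory.
Local Open Scope ring_scope.

(*  - F : unitRingType is the ambient skew field (hypothesis [division_ring]),*)
(*    of characteristic 0, and q : F is a central primitive l-th root of      *)
(*    unity; q is the image of eps^{1/2} under Q(eps^{1/2}) -> F, so Z[q] is   *)
(*    the image of A^{1/2}_eps = Z[eps^{1/2}].                                *)
(*  - Forms Z^N x Z^N -> Z_l are given by integer matrices read mod l.        *)
(*  - An exchange matrix (rows [1,N], columns ex) is stored as an N x N       *)
(*    integer matrix; columns outside ex are never used and are left         *)
(*    unchanged by mutation.                                                  *)

Section Defs.
Variable F : unitRingType.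

Definition division_ring := forall x : F, x != 0 -> x \is a GRing.unit.
Definition char0 := forall n : nat, (n.+1)%:R != 0 :> F.
Definition central (x : F) := forall y : F, x * y = y * x.

Variable q : F.
Variable l : nat.
Variable N : nat.

Definition ev (i : 'I_N) : 'rV[int]_N := delta_mx 0 i.

Definition bform (L : 'M[int]_N) (f g : 'rV[int]_N) : int := (f *m L *m g^T) 0 0.

Definition eqmod (a b : int) := (a == b %[mod (l%:Z)])%Z.

Definition skew_mod (L : 'M[int]_N) := forall i j, eqmod (L i j) (- L j i).

Definition in_Zq (x : F) := exists p : seq int, x = \sum_(i < size p) (p`_i)%:~R * q ^+ i.

(* image of the quantum torus under X^f |-> M f *)
Definition in_image (M : 'rV[int]_N -> F) (x : F) :=
  exists s : seq (F * 'rV[int]_N),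
    (forall p, p \in s -> in_Zq p.1) /\ x = \sum_(p <- s) p.1 * M p.2.

(* M is a root of unity toric frame with matrix L (mod l):  there is an injective
   A^{1/2}_eps-algebra map T_eps(L) -> F, X^f |-> M f, and F is the skew field of
   fractions of its image. *)
Definition is_frame (M : 'rV[int]_N -> F) (L : 'M[int]_N) :=
  [/\ skew_mod L,
      M 0 = 1,
      (forall f g, M f * M g = q ^ (bform L f g) * M (f + g)),
      (forall s : seq (F * 'rV[int]_N),
          uniq (map snd s) -> (forall p, p \in s -> in_Zq p.1) ->
          \sum_(p <- s) p.1 * M p.2 = 0 -> forall p, p \in s -> p.1 = 0)
    & (forall x : F, exists a b, [/\ in_image M a, in_image M b, b != 0 & x = a * b^-1])].

Definition seed := (('rV[int]_N -> F) * 'M[int]_N)%type.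

Variable ex : {set 'I_N}.

Definition compatible_with (L B : 'M[int]_N) (d : 'I_N -> nat) :=
  [/\ forall j, j \in ex -> (0 < d j)%N,
      (forall i j, i \in ex -> j \in ex -> (d i)%:Z * B i j = - ((d j)%:Z * B j i))
    & (forall i j, j \in ex ->
         eqmod (\sum_k B k j * L k i) (if i == j then (d j)%:Z else 0))].

Definition compatible (L B : 'M[int]_N) := exists d, compatible_with L B d.

Definition quantum_seed (S : seed) :=
  exists L, is_frame S.1 L /\ compatible L S.2.

Definition coprime_seed (S : seed) :=
  exists L d, [/\ is_frame S.1 L, compatible_with L S.2 d, odd l
              & forall k, k \in ex -> coprime l (d k)].

Definition mutB (k : 'I_N) (B : 'M[int]_N) : 'M[int]_N :=
  \matrix_(i, j)
    if j \notin ex then B i j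
    else if (i == k) || (j == k) then - B i j
    else B i j + ((`|B i k|%:Z * B k j + B i k * `|B k j|%:Z) %/ 2)%Z.

Definition matE (k : 'I_N) (B : 'M[int]_N) : 'M[int]_N :=
  \matrix_(i, j)
    if j != k then (i == j)%:Z
    else if i == k then -1 else Num.max 0 (- B i k).

Definition mutL (k : 'I_N) (B L : 'M[int]_N) : 'M[int]_N :=
  (matE k B)^T *m L *m matE k B.

Definition colv (k : 'I_N) (B : 'M[int]_N) : 'rV[int]_N := \row_i B i k.
Definition posv (b : 'rV[int]_N) : 'rV[int]_N := \row_i (if 0 <= b 0 i then b 0 i else 0).
Definition negv (b : 'rV[int]_N) : 'rV[int]_N := \row_i (if 0 <= - b 0 i then b 0 i else 0).

Definition mutation (k : 'I_N) (S S' : seed) :=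
  [/\ k \in ex,
      S'.2 = mutB k S.2,
      (exists L, is_frame S.1 L /\ is_frame S'.1 (mutL k S.2 L)),
      (forall j, j != k -> S'.1 (ev j) = S.1 (ev j))
    & S'.1 (ev k) = S.1 (- ev k + posv (colv k S.2)) + S.1 (- ev k - negv (colv k S.2))].

Inductive mut_equiv (S0 : seed) : seed -> Prop :=
  | me_refl : mut_equiv S0 S0
  | me_step S S' k : mut_equiv S0 S -> mutation k S S' -> mut_equiv S0 S'.

Inductive path_in (Theta : seed -> Prop) (S0 : seed) : seed -> Prop :=
  | pi_refl : path_in Theta S0 S0
  | pi_step S S' k : path_in Theta S0 S -> Theta S' ->
      mutation k S S' \/ mutation k S' S -> path_in Theta S0 S'.

Definition nerve (S0 : seed) (Theta : seed -> Prop) :=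
  [/\ forall S, Theta S -> mut_equiv S0 S,
      exists S, Theta S,
      (forall S S', Theta S -> Theta S' -> path_in Theta S S')
    & forall k, k \in ex -> exists S S', [/\ Theta S, Theta S' & mutation k S S']].

Inductive subring_gen (G : F -> Prop) : F -> Prop :=
  | sg_base x : G x -> subring_gen G x
  | sg_one : subring_gen G 1
  | sg_opp x : subring_gen G x -> subring_gen G (- x)
  | sg_add x y : subring_gen G x -> subring_gen G y -> subring_gen G (x + y)
  | sg_mul x y : subring_gen G x -> subring_gen G y -> subring_gen G (x * y).

(* A^{1/2}_eps-subalgebra generated by G *)
Definition subalg_gen (G : F -> Prop) := subring_gen (fun x => G x \/ x = q).

Variable inv : {set 'I_N}.

Definition gensA (Theta : seed -> Prop) (x : F) :=
  exists S, Theta S /\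
    ((exists j, x = S.1 (ev j)) \/ (exists i, i \in inv /\ x = (S.1 (ev i))^-1)).

Definition gensC (Theta : seed -> Prop) (x : F) :=
  exists S, Theta S /\
    ((exists j, x = S.1 (ev j) ^+ l) \/ (exists i, i \in inv /\ x = (S.1 (ev i) ^+ l)^-1)).

Definition A_eps Theta := subalg_gen (gensA Theta).
Definition C_eps Theta := subalg_gen (gensC Theta).
Definition C_Z Theta := subring_gen (gensC Theta).

End Defs.

Section Modules.
Variable F : unitRingType.
Variables (C A : F -> Prop).

Definition is_basis (B : F -> Prop) :=
  [/\ forall y, B y -> A y,
      (forall a, A a -> exists s : seq (F * F),
          (forall p, p \in s -> C p.1 /\ B p.2) /\ a = \sum_(p <- s) p.1 * p.2)
    & (forall s : seq (F * F), uniq (map snd s) ->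
          (forall p, p \in s -> C p.1 /\ B p.2) ->
          \sum_(p <- s) p.1 * p.2 = 0 -> forall p, p \in s -> p.1 = 0)].

Definition is_free := exists B, is_basis B.

Definition is_fbasis n (y : 'I_n -> F) :=
  injective y /\ is_basis (fun x => exists i, x = y i).

Definition reg_trace n (y : 'I_n -> F) (r t : F) :=
  exists m : 'I_n -> 'I_n -> F,
    [/\ forall i j, C (m i j),
        (forall j, r * y j = \sum_i m i j * y i)
      & t = \sum_i m i i].

Definition disc n (y : 'I_n -> F) (D : F) :=
  exists T : 'I_n -> 'I_n -> F,
    (forall i j, reg_trace y (y i * y j) (T i j)) /\ D = \det (\matrix_(i, j) T i j).

Definition unit_of (u : F) := C u /\ exists v, C v /\ u * v = 1.

Definition eq_units (x z : F) := exists u, unit_of u /\ x = u * z.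

End Modules.

(* Main.v *)
(* For [l = 1] the field [F] is commutative and all three algebras coincide, so let [l > 1].
   The [l]-th powers [Y_S] of the variables of a seed [S] are central and, by (Coprime), mutate by the
   classical exchange relations.  By invariance of upper bounds the base ring [C] therefore lies in the
   Laurent ring [k0[Y_S^{+-1}]] of every seed [S] of the nerve, with [k0 = Z[q]] or [k0 = Z].  The quantum
   torus of [S] is free over that Laurent ring, and on dual monomial bases its trace form is [l^N] times a
   monomial times the trace form of [Z[q]] over [k0].  The algebra [A] embeds into this torus only up to
   denominators, but these are products of exchange polynomials, hence nonzerodivisors modulo every integer,
   and the trace form shows that they cancel: a [C]-basis of [A] is also a basis of the torus.  So the
   discriminant is [delta c_S Y_S^{f_S}] for every [S], with [delta] independent of [S] and [c_S] a unit of
   [k0].  Along a mutation in direction [k] two such expressions can only agree if [f_S] does not change and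
   vanishes at [k], because the exchange polynomial is not a unit; a nerve meets every direction, so only
   frozen variables survive.  Their exponents are nonnegative because the discriminant lies in [C], whose
   generators are subtraction-free expressions in the variables of any fixed seed. *)
Require Import Defs.
From HB Require Import structures.
From mathcomp Require Import all_boot all_order all_fingroup all_algebra all_field.
From mathcomp Require Import boolp mxtens.
From mathcomp Require Import zify ring.
Set Implicit Arguments. Unset Strict Implicit. Unset Printing Implicit Defensive.
Import Order.TTheory GRing.Theory Num.Theory.
Local Open Scope ring_scope.

(** * Laurent rings *)

(** Both parts are one argument with a parameter [k0], a basis [e] of [Z[q]] over [k0] and its Gram
    matrix [G0]: the identity for [k0 = Z[q]], the cyclotomic trace matrix for [k0 = Z]. Commutative
    computations take place in the center of [F], a field. As [Z[q]] need not have unique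
    factorization, divisibility is read off from gradings instead of gcds: a weight that is zero on
    [b'] and positive on [b] makes [1 + Y^b] a nonzerodivisor modulo [1 + Y^b']. Such weights exist
    because compatibility modulo [l] and (Coprime) make any two exchange columns independent over
    the integers. For the denominators, let [P], [P'] express two dual torus bases in the basis of
    [A], with inverses [Q], [Q'], and let [T] be the trace matrix of that basis. Then
    [P^T T P' = G], the Gram matrix of the torus. Here [T], [P], [P'] are Laurent and [det G]
    divides a positive integer, so by Cramer's rule an integer multiple of [Q] is Laurent. So is a
    multiple of [Q] by a denominator that is regular modulo integers; hence [Q] is Laurent, and
    [det T] is [det G] times a Laurent unit. *)

Section GeneratedSubring.
Variables (R : unitRingType) (G : R -> Prop).

Definition sring : {pred R} := fun x => `[< subring_gen G x >].

Lemma sringP x : reflect (subring_gen G x) (x \in sring).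
Proof. exact: asboolP. Qed.

Lemma sring_gen x : G x -> x \in sring.
Proof. by move=> ?; apply/sringP/sg_base. Qed.

Lemma sring_closed : subring_closed sring.
Proof.
split.
- by apply/sringP/sg_one.
- move=> x y /sringP xG /sringP yG; apply/sringP.
  exact: sg_add xG (sg_opp yG).
- by move=> x y /sringP xG /sringP yG; apply/sringP/sg_mul.
Qed.

HB.instance Definition _ := GRing.isSubringClosed.Build R sring sring_closed.

Lemma sring0 : 0 \in sring. Proof. exact: rpred0. Qed.
Lemma sring1 : 1 \in sring. Proof. exact: rpred1. Qed.
Lemma sringN x : x \in sring -> - x \in sring.
Proof. by move=> xG; rewrite rpredN. Qed.
Lemma sringD x y : x \in sring -> y \in sring -> x + y \in sring.
Proof. exact: rpredD. Qed.
Lemma sringB x y : x \in sring -> y \in sring -> x - y \in sring.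
Proof. exact: rpredB. Qed.
Lemma sringM x y : x \in sring -> y \in sring -> x * y \in sring.
Proof. exact: rpredM. Qed.
Lemma sringX x n : x \in sring -> x ^+ n \in sring.
Proof. exact: rpredX. Qed.
Lemma sring_nat n : n%:R \in sring. Proof. exact: rpred_nat. Qed.
Lemma sring_int (n : int) : n%:~R \in sring. Proof. exact: rpred_int. Qed.
Lemma sring_sum (I : Type) (r : seq I) (P : pred I) (F : I -> R) :
  (forall i, P i -> F i \in sring) -> \sum_(i <- r | P i) F i \in sring.
Proof. exact: rpred_sum. Qed.

Lemma sring_sub (S : subringClosed R) :
  (forall x, G x -> x \in S) -> forall x, x \in sring -> x \in S.
Proof.
move=> GS x /sringP; elim=> {x} [x /GS//||x _|x y _ xS _|x y _ xS _].
- exact: rpred1.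
- by rewrite rpredN.
- by move=> yS; rewrite rpredD.
- by move=> yS; rewrite rpredM.
Qed.

(* Elements that a central denominator in [Q] brings into [S] form a ring. *)
Lemma sring_loc (S : subringClosed R) (Q : R -> Prop) :
  Q 1 -> (forall a b, Q a -> Q b -> Q (a * b)) ->
  (forall a, Q a -> a \in S) -> (forall a x, Q a -> a * x = x * a) ->
  (forall x, G x -> exists2 a, Q a & a * x \in S) ->
  forall x, x \in sring -> exists2 a, Q a & a * x \in S.
Proof.
move=> Q1 QM QS Qc GS x /sringP; elim=> {x} [x /GS//||x _|x y _ + _|x y _ + _].
- by exists 1; rewrite ?mulr1 ?rpred1.
- by case=> a Qa aS; exists a; rewrite // mulrN rpredN.
- move=> [a Qa aS] [b Qb bS]; exists (a * b); first exact: QM.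
  by rewrite mulrDr {1}(Qc a b Qa) -!mulrA rpredD // rpredM // QS.
- move=> [a Qa aS] [b Qb bS]; exists (a * b); first exact: QM.
  by rewrite -mulrA (mulrA b) (Qc b x Qb) -mulrA mulrA rpredM.
Qed.

End GeneratedSubring.

Section Monomials.
Variables (K : fieldType) (N : nat).
Implicit Types (Y : 'I_N -> K) (f g : 'rV[int]_N).

Definition mon Y f : K := \prod_i Y i ^ f 0 i.

Lemma mon0 Y : mon Y 0 = 1.
Proof. by rewrite /mon big1 // => i _; rewrite mxE expr0z. Qed.

Lemma mon_ev Y j : mon Y (ev j) = Y j.
Proof.
rewrite /mon (bigD1 j) //= mxE !eqxx /= expr1z big1 ?mulr1 // => i ij.
by rewrite mxE (negPf ij) /= expr0z.
Qed.

Lemma eq_mon Y Y' f : (forall i, f 0 i = 0 \/ Y i = Y' i) -> mon Y f = mon Y' f.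
Proof.
move=> eqY; apply: eq_bigr => i _.
by case: (eqY i) => [->|->//]; rewrite !expr0z.
Qed.

Variable Y : 'I_N -> K.
Hypothesis Ynz : forall i, Y i != 0.

Lemma monD f g : mon Y (f + g) = mon Y f * mon Y g.
Proof.
rewrite -big_split; apply: eq_bigr => i _.
by rewrite mxE expfzDr.
Qed.

Lemma mon_neq0 f : mon Y f != 0.
Proof. by apply/prodf_neq0 => i _; rewrite expfz_neq0. Qed.

Lemma monN f : mon Y (- f) = (mon Y f)^-1.
Proof.
apply: (mulfI (mon_neq0 f)); rewrite -monD subrr mon0 divff //.
exact: mon_neq0.
Qed.

Lemma monB f g : mon Y (f - g) = mon Y f / mon Y g.
Proof. by rewrite monD monN. Qed.

Lemma monMn f n : mon Y (f *+ n) = mon Y f ^+ n.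
Proof. by elim: n => [|n IHn]; rewrite ?mulr0n ?mon0 // mulrS monD IHn exprS. Qed.

End Monomials.

Section Laurent.
Variables (K : fieldType) (k0 : subringClosed K) (N : nat) (Y : 'I_N -> K).
Implicit Types (f g w : 'rV[int]_N) (s : seq (K * 'rV[int]_N)) (pi : pred 'rV[int]_N).

Definition coef_in s := forall p : K * 'rV[int]_N, p \in s -> p.1 \in k0.

Definition msum s := \sum_(p <- s) p.1 * mon Y p.2.

Definition laurent_gens x := x \in k0 \/ exists i, x = Y i \/ x = (Y i)^-1.

Notation laurent := (sring laurent_gens).

(** Lists may repeat exponents, so independence speaks of the total coefficient at each exponent;
    sums and products of expansions then need no normalization. *)
Definition indep := forall s, coef_in s -> msum s = 0 ->
  forall h : 'rV[int]_N, \sum_(p <- s | p.2 == h) p.1 = 0.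

Lemma laurent_coef x : x \in k0 -> x \in laurent.
Proof. by move=> ?; apply: sring_gen; left. Qed.

Lemma laurent_var i : Y i \in laurent.
Proof. by apply: sring_gen; right; exists i; left. Qed.

Lemma laurent_varV i : (Y i)^-1 \in laurent.
Proof. by apply: sring_gen; right; exists i; right. Qed.

Lemma laurent_mon f : mon Y f \in laurent.
Proof.
apply: rpred_prod => i _; case: (f 0 i) => n.
  by rewrite -exprnP rpredX // laurent_var.
by rewrite NegzE -exprz_inv -exprnP rpredX // laurent_varV.
Qed.

Lemma laurent_msum s : coef_in s -> msum s \in laurent.
Proof.
move=> ks; rewrite /msum big_seq sring_sum // => p /ks pk.
by rewrite sringM ?laurent_mon ?laurent_coef.
Qed.

Lemma msum_by_exponent s pi :
  \sum_(p <- s | pi p.2) p.1 * mon Y p.2 =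
  \sum_(h <- undup (map snd s) | pi h) (\sum_(p <- s | p.2 == h) p.1) * mon Y h.
Proof.
pose U := undup (map snd s).
have sU p : p \in s -> p.2 \in U by move=> ps; rewrite mem_undup map_f.
rewrite big_seq_cond (eq_bigr (fun p => \sum_(h <- U | h == p.2) p.1 * mon Y h)); last first.
  by move=> p /andP[ps _]; rewrite -big_filter filter_pred1_uniq ?undup_uniq ?sU ?big_seq1.
rewrite -big_seq_cond (exchange_big_dep pi) => [|p h pip /eqP->] //.
apply: eq_bigr => h pih; rewrite mulr_suml; apply: eq_bigl => p.
by rewrite eq_sym; case: eqP => [->|]; rewrite ?pih ?andbF.
Qed.

Lemma msum_eq0 s : (forall h : 'rV[int]_N, \sum_(p <- s | p.2 == h) p.1 = 0) -> msum s = 0.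
Proof.
by move=> s0; rewrite /msum (msum_by_exponent s predT) big1 // => h _; rewrite s0 mul0r.
Qed.

Hypothesis Yind : indep.

Lemma indep_neq0 i : Y i != 0.
Proof.
apply/eqP => Yi0.
have /Yind : coef_in [:: (1, ev i)] by move=> p; rewrite inE => /eqP->; apply: rpred1.
rewrite /msum big_seq1 mon_ev /= Yi0 mulr0 => /(_ erefl (ev i)).
by rewrite big_mkcond big_seq1 /= eqxx => /eqP; rewrite oner_eq0.
Qed.
Let Ynz := indep_neq0.

Lemma laurentP t : t \in laurent -> exists2 s, coef_in s & t = msum s.
Proof.
move/sringP; elim=> {t} [x [kx|[i [->|->]]]||x _|x y _ + _|x y _ + _].
- exists [:: (x, 0)] => [p|]; first by rewrite inE => /eqP->.
  by rewrite /msum big_seq1 mon0 mulr1.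
- exists [:: (1, ev i)] => [p|]; first by rewrite inE => /eqP->; apply: rpred1.
  by rewrite /msum big_seq1 mon_ev mul1r.
- exists [:: (1, - ev i)] => [p|]; first by rewrite inE => /eqP->; apply: rpred1.
  by rewrite /msum big_seq1 monN // mon_ev mul1r.
- exists [:: (1, 0)] => [p|]; first by rewrite inE => /eqP->; apply: rpred1.
  by rewrite /msum big_seq1 mon0 mulr1.
- case=> s ks ->; exists [seq (- p.1, p.2) | p <- s] => [p /mapP[r /ks kr ->]|].
    by rewrite rpredN.
  by rewrite /msum big_map -sumrN; apply: eq_bigr => p _; rewrite mulNr.
- move=> [s ks ->] [s' ks' ->]; exists (s ++ s') => [p|].
    by rewrite mem_cat => /orP[/ks|/ks'].
  by rewrite /msum big_cat.
- move=> [s ks ->] [s' ks' ->].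
  exists [seq (p.1 * r.1, p.2 + r.2) | p <- s, r <- s'] => [p|].
    by case/allpairsP => -[a b] /= [/ks ka /ks' kb ->]; rewrite rpredM.
  rewrite /msum big_allpairs_dep mulr_suml; apply: eq_bigr => p _.
  rewrite mulr_sumr; apply: eq_bigr => r _ /=.
  by rewrite monD // mulrACA.
Qed.

Lemma indep_filter s pi : coef_in s -> msum s = 0 ->
  \sum_(p <- s | pi p.2) p.1 * mon Y p.2 = 0.
Proof.
by move=> ks s0; rewrite msum_by_exponent big1 // => h _; rewrite Yind ?mul0r.
Qed.

(** The part of the expansion of [t] with exponents in [pi]. An expansion is chosen, and [comp_msum]
    shows that the choice is immaterial; the value is [0] on elements without an expansion. *)
Definition comp pi t : K :=
  if pselect (exists2 s, coef_in s & t = msum s) is left h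
  then \sum_(p <- s2val (cid2 h) | pi p.2) p.1 * mon Y p.2 else 0.

Lemma comp_msum s pi : coef_in s ->
  comp pi (msum s) = \sum_(p <- s | pi p.2) p.1 * mon Y p.2.
Proof.
move=> ks; rewrite /comp; case: pselect => [h|[]]; last by exists s.
case: (cid2 h) => s' ks' /= ss'; apply/eqP; rewrite -subr_eq0; apply/eqP.
pose n := [seq (- p.1, p.2) | p <- s].
have nE (Q : pred 'rV[int]_N) : \sum_(p <- n | Q p.2) p.1 * mon Y p.2 =
    - \sum_(p <- s | Q p.2) p.1 * mon Y p.2.
  by rewrite big_map -sumrN; apply: eq_bigr => p _; rewrite mulNr.
rewrite -nE -big_cat; apply: indep_filter => [p|].
  rewrite mem_cat => /orP[/ks'//|/mapP[r /ks kr ->]].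
  by rewrite rpredN.
rewrite /msum big_cat (nE predT) /=; apply/eqP; rewrite subr_eq0; apply/eqP.
exact: esym ss'.
Qed.

Lemma comp_laurent pi t : t \in laurent -> comp pi t \in laurent.
Proof.
case/laurentP => s ks ->; rewrite comp_msum // big_seq_cond sring_sum // => p.
by case/andP => /ks pk _; rewrite sringM ?laurent_mon ?laurent_coef.
Qed.

Lemma comp_mon pi c f : c \in k0 ->
  comp pi (c * mon Y f) = if pi f then c * mon Y f else 0.
Proof.
move=> kc; have -> : c * mon Y f = msum [:: (c, f)] by rewrite /msum big_seq1.
rewrite comp_msum; last by move=> p; rewrite inE => /eqP->.
by rewrite big_mkcond big_seq1 /msum big_seq1.
Qed.

Lemma compD pi t u : t \in laurent -> u \in laurent ->
  comp pi (t + u) = comp pi t + comp pi u.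
Proof.
move=> /laurentP[s ks ->] /laurentP[r kr ->].
have -> : msum s + msum r = msum (s ++ r) by rewrite /msum big_cat.
rewrite !comp_msum ?big_cat // => p.
by rewrite mem_cat => /orP[/ks|/kr].
Qed.

Lemma comp0 pi : comp pi 0 = 0.
Proof. by have := @comp_mon pi 0 0 (rpred0 _); rewrite mul0r if_same. Qed.

Lemma comp_comp pi pi' t : t \in laurent ->
  comp pi (comp pi' t) = comp (predI pi pi') t.
Proof.
case/laurentP => s ks ->; rewrite !comp_msum // -big_filter.
rewrite -/(msum _) comp_msum; last first.
  by move=> p; rewrite mem_filter => /andP[_ /ks].
by rewrite big_filter_cond; apply: eq_bigl => p; rewrite andbC.
Qed.

Definition deg w f : int := \sum_i w 0 i * f 0 i.

Lemma degD w f g : deg w (f + g) = deg w f + deg w g.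
Proof. by rewrite -big_split; apply: eq_bigr => i _; rewrite mxE mulrDr. Qed.

Lemma deg0 w : deg w 0 = 0.
Proof. by rewrite /deg big1 // => i _; rewrite mxE mulr0. Qed.

Lemma degN w f : deg (- w) f = - deg w f.
Proof. by rewrite /deg -sumrN; apply: eq_bigr => i _; rewrite mxE mulNr. Qed.

Definition part w (d : int) := comp (fun f => deg w f == d).

Definition homog w d t := t \in laurent /\ part w d t = t.

Lemma part_homog w d t : t \in laurent -> homog w d (part w d t).
Proof.
move=> tL; split; first exact: comp_laurent.
by rewrite /part comp_comp //; congr (comp _ _); apply/funext => f /=; rewrite andbb.
Qed.

Lemma homog_part w d e t : homog w d t -> part w e t = if d == e then t else 0.
Proof.
case=> tL td; case: eqP => [<-//|de].
rewrite -td /part comp_comp //; case/laurentP: tL => s ks ->.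
rewrite comp_msum // big_pred0 // => p /=; apply/negbTE/negP.
by case/andP => /eqP ee /eqP dd; case: de; rewrite -dd -ee.
Qed.

Lemma homog_mon w c f : c \in k0 -> homog w (deg w f) (c * mon Y f).
Proof.
move=> kc; split; last by rewrite /part comp_mon // eqxx.
by rewrite sringM ?laurent_mon ?laurent_coef.
Qed.

Lemma homogP w d t : homog w d t <->
  exists2 s, coef_in s /\ (forall p, p \in s -> deg w p.2 = d) & t = msum s.
Proof.
split=> [[/laurentP[s ks ->] <-]|[s [ks ds] ->]].
  rewrite /part comp_msum // -big_filter.
  exists [seq p <- s | deg w p.2 == d] => //.
  by split=> p; rewrite mem_filter => /andP[/eqP ? /ks].
split; first exact: laurent_msum.
rewrite /part comp_msum // big_seq_cond /msum [RHS]big_seq.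
by apply: eq_bigl => p; case: (boolP (p \in s)) => //= /ds ->; rewrite eqxx.
Qed.

Lemma homogM w d e t u : homog w d t -> homog w e u -> homog w (d + e) (t * u).
Proof.
case/homogP => s [ks ds] ->; case/homogP => r [kr dr] ->; apply/homogP.
exists [seq (p.1 * q.1, p.2 + q.2) | p <- s, q <- r].
  split=> p /allpairsP[[a b] /= [sa rb ->]] /=.
    by rewrite rpredM //; [apply: ks|apply: kr].
  by rewrite degD ds ?dr.
rewrite /msum big_allpairs_dep mulr_suml; apply: eq_bigr => p _.
rewrite mulr_sumr; apply: eq_bigr => q _ /=.
by rewrite monD // mulrACA.
Qed.

Lemma homogD w d t u : homog w d t -> homog w d u -> homog w d (t + u).
Proof.
by move=> [tL td] [uL ud]; split; rewrite ?sringD // /part compD // -/(part _ _ _) td -/(part _ _ _) ud.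
Qed.

Lemma homog0 w d : homog w d 0.
Proof. by split; rewrite ?sring0 // /part comp0. Qed.

Lemma homog_coef w c : c \in k0 -> homog w 0 c.
Proof. by move=> /(homog_mon w 0); rewrite mon0 mulr1 deg0. Qed.

Lemma part_sum w d (I : Type) (r : seq I) (P : pred I) (F : I -> K) :
  (forall i, P i -> F i \in laurent) ->
  part w d (\sum_(i <- r | P i) F i) = \sum_(i <- r | P i) part w d (F i).
Proof.
move=> FL; elim: r => [|a r IHr]; first by rewrite !big_nil [LHS]comp0.
rewrite !big_cons; case: ifP => // Pa.
by rewrite {1}/part compD ?sring_sum ?FL // -!/(part _ _ _) IHr.
Qed.

(** The degrees are shifted by [n], so that sums and inductions over them run over natural
    numbers. *)
Lemma laurent_parts w t : t \in laurent ->
  exists n : nat, (forall d, part w d t != 0 -> (absz d < n)%N) /\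
     t = \sum_(i < n.*2) part w (i%:Z - n%:Z) t.
Proof.
case/laurentP => s ks ->.
have [n sn] : exists n : nat, forall p : K * 'rV[int]_N, p \in s -> (absz (deg w p.2) < n)%N.
  elim: s {ks} => [|a s [n IHn]]; first by exists 0.
  exists (n + (absz (deg w a.2)).+1)%N => p; rewrite inE => /orP[/eqP->|/IHn pn].
    by rewrite addnS ltnS leq_addl.
  exact: leq_trans pn (leq_addr _ _).
have pE d : part w d (msum s) = \sum_(p <- s | deg w p.2 == d) p.1 * mon Y p.2.
  by rewrite /part comp_msum.
exists n; split=> [d|].
  apply: contraNT; rewrite pE => dn; rewrite big_seq_cond big1 // => p.
  by case/andP => /sn pn /eqP pd; rewrite -pd pn in dn.
under eq_bigr do rewrite pE.
rewrite (exchange_big_dep xpredT) //= /msum; apply: eq_big_seq => p /sn pn.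
move: (deg w p.2) pn => d pn.
have lt_i : (absz (d + n%:Z)%R < n.*2)%N by lia.
rewrite (bigD1 (Ordinal lt_i)) /=; last by apply/eqP; lia.
rewrite big1 ?addr0 // => i /andP[/eqP di /eqP ni]; case: ni.
by apply: val_inj => /=; lia.
Qed.

Lemma part_homogM w n r d t : homog w n r -> t \in laurent ->
  part w d (r * t) = r * part w (d - n) t.
Proof.
move=> hr tL; have [m [_ tE]] := laurent_parts w tL.
have rL : r \in laurent by case: hr.
rewrite {1}tE mulr_sumr part_sum; last by move=> i _; rewrite sringM ?comp_laurent.
rewrite {2}tE part_sum; last by move=> i _; rewrite comp_laurent.
rewrite mulr_sumr; apply: eq_bigr => i _.
have hi := part_homog w (i%:Z - m%:Z) tL.
rewrite (homog_part _ (homogM hr hi)) (homog_part _ hi).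
by rewrite [n + _]addrC (can2_eq (addrK _) (subrK _)); case: ifP; rewrite ?mulr0.
Qed.

(* Compare the graded pieces of both sides by induction on the degree, from below. *)
Lemma homog_regular w (n : int) r1 d0 t (z : K) : 0 < n ->
  homog w n r1 -> homog w 0 d0 -> t \in laurent -> z \in laurent ->
  (1 + r1) * t = d0 * z -> exists2 t', t' \in laurent & t = d0 * t'.
Proof.
move=> n0 hr hd tL zL ts.
have rL : r1 \in laurent by case: hr.
have [m [mt tE]] := laurent_parts w tL.
have step d : part w d t = d0 * part w d z - r1 * part w (d - n) t.
  have := congr1 (part w d) ts; rewrite mulrDl mul1r.
  rewrite {1}/part compD ?sringM // -!/(part _ _ _) !(part_homogM _ hr, part_homogM _ hd) //.
  by rewrite subr0 => <-; rewrite addrK.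
have dvd i : exists2 u, u \in laurent & part w (i%:Z - m%:Z) t = d0 * u.
  elim/ltn_ind: i => i IHi; rewrite step.
  have [u uL ->] : exists2 u, u \in laurent & part w (i%:Z - m%:Z - n) t = d0 * u.
    have [lt|ge] := ltP (i%:Z - n) 0.
      exists 0; rewrite ?sring0 // mulr0; apply/eqP; apply/negPn/negP => /mt; lia.
    have -> : i%:Z - m%:Z - n = (absz (i%:Z - n))%:Z - m%:Z by lia.
    by apply: IHi; lia.
  exists (part w (i%:Z - m%:Z) z - r1 * u); last by rewrite mulrBr mulrCA.
  by rewrite rpredB ?sringM ?comp_laurent.
have [v vE] := fin_all_exists2 (fun i : 'I_m.*2 => dvd i).
move=> tv; exists (\sum_i v i); first by rewrite sring_sum.
by rewrite mulr_sumr tE; apply: eq_bigr => i _; rewrite tv.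
Qed.

Lemma homog_only w d t : t \in laurent -> (forall e, e != d -> part w e t = 0) ->
  homog w d t.
Proof.
move=> tL t0; have [n [_ tE]] := laurent_parts w tL.
rewrite tE; apply: (big_ind (homog w d)) => [|x y|i _].
- exact: homog0.
- exact: homogD.
- have [<-|/t0->] := eqVneq (i%:Z - n%:Z) d; first exact: part_homog.
  exact: homog0.
Qed.

Definition low w d t := part w d t != 0 /\ forall e, e < d -> part w e t = 0.

Lemma lowP w t : t \in laurent -> t != 0 -> exists d, low w d t.
Proof.
move=> tL t0; have [m [mt tE]] := laurent_parts w tL.
have [i ti] : exists i : nat, part w (i%:Z - m%:Z) t != 0.
  apply: contrapT => nt; case/eqP: t0; rewrite tE big1 // => i _.
  by apply/eqP/negPn/negP => ti; apply: nt; exists i.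
have exP : exists i : nat, part w (i%:Z - m%:Z) t != 0 by exists i.
exists ((ex_minn exP)%:Z - m%:Z); case: ex_minnP => j tj jmin; split=> // e ej.
apply/eqP/negPn/negP => te; have := mt _ te => em.
have /jmin : part w ((absz (e + m%:Z))%:Z - m%:Z) t != 0.
  by have -> : (absz (e + m%:Z))%:Z - m%:Z = e by lia.
lia.
Qed.

(** Only the two lowest parts contribute in degree [d + e], and their product is nonzero in a
    field. *)
Lemma lowM w d e t u : t \in laurent -> u \in laurent ->
  low w d t -> low w e u -> part w (d + e) (t * u) != 0.
Proof.
move=> tL uL [td tlow] [ue ulow]; have [m [mu uE]] := laurent_parts w uL.
rewrite {1}uE mulr_sumr part_sum; last by move=> i _; rewrite sringM ?comp_laurent.
have lt_i : (absz (e + m%:Z)%R < m.*2)%N by have := mu _ ue; lia.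
rewrite (bigD1 (Ordinal lt_i)) //= big1 => [|i /eqP ni].
  have -> : (absz (e + m%:Z))%:Z - m%:Z = e by have := mu _ ue; lia.
  by rewrite addr0 mulrC (part_homogM _ (part_homog w e uL)) // addrK mulf_neq0.
rewrite mulrC (part_homogM _ (part_homog w _ uL)) //.
case: (ltgtP (i%:Z - m%:Z) e) => [/ulow->|ie|ie].
- by rewrite mul0r.
- by rewrite tlow ?mulr0 //; lia.
- by case: ni; apply: val_inj => /=; lia.
Qed.

Lemma part_opp w d t : part (- w) d t = part w (- d) t.
Proof.
rewrite /part; congr (comp _ _); apply/funext => f.
by rewrite degN eqr_oppLR.
Qed.

(** The lowest degrees of [u] and [v] add up to [0], and so do the highest ones, which are the
    lowest ones for [- w]. Since lowest degrees do not exceed highest ones, they coincide. *)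
Lemma laurent_unit_homog w u v : u \in laurent -> v \in laurent -> u * v = 1 ->
  exists d, homog w d u.
Proof.
move=> uL vL uv.
have u0 : u != 0 by apply/eqP => u0; move/eqP: uv; rewrite u0 mul0r eq_sym oner_eq0.
have v0 : v != 0 by apply/eqP => v0; move/eqP: uv; rewrite v0 mulr0 eq_sym oner_eq0.
have [a ua] := lowP w uL u0; have [b vb] := lowP w vL v0.
have [a' ua'] := lowP (- w) uL u0; have [b' vb'] := lowP (- w) vL v0.
have part1 w' d : part w' d 1 != 0 -> d = 0.
  rewrite (homog_part _ (homog_coef _ (rpred1 _))).
  by case: (eqVneq 0 d) => [|_]; rewrite ?eqxx.
have ab : a + b = 0 by apply: (part1 w); rewrite -uv lowM.
have ab' : a' + b' = 0 by apply: (part1 (- w)); rewrite -uv lowM.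
have le_a : a <= - a'.
  by case: ua ua' => _ ua [+ _]; rewrite part_opp leNgt; apply: contra => /ua->.
have le_b : b <= - b'.
  by case: vb vb' => _ vb [+ _]; rewrite part_opp leNgt; apply: contra => /vb->.
exists a; apply: homog_only => // e; case: ltgtP => // [ea|ae] _.
  by case: ua => _; apply.
have [_ /(_ (- e))] := ua'; rewrite part_opp opprK; apply; lia.
Qed.

Lemma deg_ev i f : deg (ev i) f = f 0 i.
Proof.
rewrite /deg (bigD1 i) //= mxE !eqxx mul1r big1 ?addr0 // => j ji.
by rewrite mxE (negPf ji) mul0r.
Qed.

(** A unit is homogeneous for every coordinate weight, so only one exponent survives in it. *)
Lemma laurent_unit u v : u \in laurent -> v \in laurent -> u * v = 1 ->
  exists c f, [/\ c \in k0, c != 0 & u = c * mon Y f].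
Proof.
move=> uL vL uv.
have /fin_all_exists[d ud] i : exists d, homog (ev i) d u.
  exact: laurent_unit_homog uv.
have allE (r : seq 'I_N) : comp (fun f => all (fun i => f 0 i == d i) r) u = u.
  elim: r => [|i r IHr].
    by case/laurentP: uL => s ks ->; rewrite comp_msum.
  case: (ud i) => _ udi; rewrite -[RHS]IHr -[in RHS]udi /part comp_comp //.
  congr (comp _ _); apply/funext => f /=; by rewrite deg_ev andbC.
have := allE (enum 'I_N); case/laurentP: uL => s ks uE; rewrite uE comp_msum //.
rewrite (eq_bigl (fun p => p.2 == \row_i d i)) => [su|p]; last first.
  apply/allP/eqP => [pd|-> i _]; last by rewrite mxE.
  by apply/rowP => i; rewrite mxE; apply/eqP/pd; rewrite mem_enum.
pose c := \sum_(p <- s | p.2 == \row_i d i) p.1.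
have cE : msum s = c * mon Y (\row_i d i).
  by rewrite -su mulr_suml; apply: eq_bigr => p /eqP->.
exists c, (\row_i d i); split=> //.
  by rewrite /c big_seq_cond rpred_sum // => p /andP[/ks].
apply/eqP => c0; move/eqP: uv; rewrite uE cE c0 !mul0r eq_sym.
by rewrite oner_eq0.
Qed.

Lemma mon_inj c c' f f' : c \in k0 -> c' \in k0 -> c != 0 ->
  c * mon Y f = c' * mon Y f' -> f = f' /\ c = c'.
Proof.
move=> kc kc' c0 ff'.
have := @Yind [:: (c, f); (- c', f')].
rewrite /msum !big_cons !big_nil /= addr0 mulNr ff' subrr.
move=> /(_ _ erefl) ind.
have /ind {}ind : coef_in [:: (c, f); (- c', f')].
  by move=> p; rewrite !inE => /orP[]/eqP-> //=; rewrite rpredN.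
have := ind f; rewrite big_mkcond !big_cons big_nil /= eqxx addr0.
have [->|_] := eqVneq f' f; first by move/eqP; rewrite subr_eq0 => /eqP.
by rewrite addr0 => /eqP; rewrite (negPf c0).
Qed.

End Laurent.

Notation laurent k0 Y := (sring (laurent_gens k0 Y)).

(** * Exchange matrices *)

Section ExchangeMatrices.
Variables (N : nat) (ex : {set 'I_N}).
Implicit Types (B L : 'M[int]_N) (b : 'rV[int]_N) (i j k : 'I_N).

Lemma posvE b i : posv b 0 i = if 0 <= b 0 i then b 0 i else 0.
Proof. by rewrite mxE. Qed.

Lemma negvE b i : negv b 0 i = if b 0 i <= 0 then b 0 i else 0.
Proof. by rewrite mxE oppr_ge0. Qed.

Lemma posv_sub_negv b : posv b + negv b = b.
Proof. by apply/rowP => i; rewrite mxE posvE negvE; case: (ltgtP (b 0 i) 0) => [||->]; rewrite ?addr0 ?add0r. Qed.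

Lemma posvN b : posv (- b) = - negv b.
Proof. by apply/rowP => i; rewrite !mxE; case: ifP; rewrite ?oppr0. Qed.

Lemma negvN b : negv (- b) = - posv b.
Proof. by apply/rowP => i; rewrite !mxE opprK; case: ifP; rewrite ?oppr0. Qed.

Lemma colvN k B : colv k (- B) = - colv k B.
Proof. by apply/rowP => i; rewrite !mxE. Qed.

Lemma exchange_half (x y : int) : (((absz x)%:Z * y + x * (absz y)%:Z) %/ 2)%Z =
  if (0 <= x) && (0 <= y) then x * y else if (x < 0) && (y < 0) then - (x * y) else 0.
Proof.
have half (z : int) : ((z + z) %/ 2)%Z = z by lia.
have [x0|x0] := leP 0 x; have [y0|y0] := leP 0 y => /=.
- by rewrite !gez0_abs // half.
- by rewrite (ltz0_abs y0) (gez0_abs x0) mulrN subrr div0z.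
- by rewrite (gez0_abs y0) (ltz0_abs x0) mulNr addrC subrr div0z.
- by rewrite !ltz0_abs // mulNr mulrN half.
Qed.

Lemma mutBE k B i j : mutB ex k B i j =
  if j \notin ex then B i j else if (i == k) || (j == k) then - B i j
  else B i j + (if (0 <= B i k) && (0 <= B k j) then B i k * B k j
                else if (B i k < 0) && (B k j < 0) then - (B i k * B k j) else 0).
Proof. by rewrite mxE exchange_half. Qed.

Lemma mutBK k B : k \in ex -> mutB ex k (mutB ex k B) = B.
Proof.
move=> kex; apply/matrixP => i j; rewrite !mutBE kex /= eqxx /= orbT.
case: (boolP (j \in ex)) => //= jex.
case: ((i == k) || (j == k)); first by rewrite opprK.
rewrite mulrNN !oppr_ge0 !oppr_lt0; move: (B i k) (B k j) (B i j) => x y z.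
by case: (ltgtP x 0) => [_|_|->]; case: (ltgtP y 0) => [_|_|->] /=; ring.
Qed.

Lemma mutB_opp k B : mutB ex k (- B) = - mutB ex k B.
Proof.
apply/matrixP => i j; rewrite [RHS]mxE !mutBE ![(- B) _ _]mxE.
case: (boolP (j \in ex)) => //= jex.
case: ((i == k) || (j == k)) => //.
rewrite mulrNN !oppr_ge0 !oppr_lt0; move: (B i k) (B k j) (B i j) => x y z.
by case: (ltgtP x 0) => [_|_|->]; case: (ltgtP y 0) => [_|_|->] /=; ring.
Qed.

Lemma colv_mutB k B : k \in ex -> colv k (mutB ex k B) = - colv k B.
Proof. by move=> kex; apply/rowP => i; rewrite !mxE kex eqxx orbT. Qed.

End ExchangeMatrices.

Section Good.
Variables (N l : nat) (ex : {set 'I_N}).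
Implicit Types (B L : 'M[int]_N) (i j k : 'I_N).

(** The form and the multipliers are existential, so that the commutative theory of exchange
    polynomials refers to the exchange matrix alone. *)
Definition good B := exists L d,
  compatible_with l ex L B d /\ forall k, k \in ex -> coprime l (d k).

Lemma eqmod_intP (a b : int) : reflect (exists c, a = b + c * l%:Z) (eqmod l a b).
Proof.
rewrite /eqmod eqz_mod_dvd; apply: (iffP dvdzP) => -[c]; exists c; lia.
Qed.

Lemma eqmodD (a b c d : int) : eqmod l a b -> eqmod l c d -> eqmod l (a + c) (b + d).
Proof. by move=> /eqmod_intP[u ->] /eqmod_intP[v ->]; apply/eqmod_intP; exists (u + v); ring. Qed.

Lemma eqmodMl (c a b : int) : eqmod l a b -> eqmod l (c * a) (c * b).
Proof. by move=> /eqmod_intP[u ->]; apply/eqmod_intP; exists (c * u); ring. Qed.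

Lemma eqmod_sum (I : Type) (r : seq I) (P : pred I) (f g : I -> int) :
  (forall a, P a -> eqmod l (f a) (g a)) ->
  eqmod l (\sum_(i <- r | P i) f i) (\sum_(i <- r | P i) g i).
Proof.
move=> fg; apply: (big_ind2 (eqmod l)) => //; first exact: eqxx.
by move=> *; apply: eqmodD.
Qed.

Section Consequences.
Variable B : 'M[int]_N.
Hypothesis Bgood : good B.

Lemma good_skew j k : j \in ex -> k \in ex ->
  exists p r : nat, [/\ (0 < p)%N, (0 < r)%N & p%:Z * B j k = - (r%:Z * B k j)].
Proof.
move=> jex kex; have [L [d [[d0 sk _] _]]] := Bgood.
by exists (d j), (d k); split; [exact: d0|exact: d0|exact: sk].
Qed.

Lemma good_diag k : k \in ex -> B k k = 0.
Proof. move=> kex; have [p [r [p0 r0]]] := good_skew kex kex; nia. Qed.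

Lemma good_gt0 j k : j \in ex -> k \in ex -> 0 < B j k -> B k j < 0.
Proof. move=> jex kex; have [p [r [p0 r0]]] := good_skew jex kex; nia. Qed.

Lemma good_eq0 j k : j \in ex -> k \in ex -> B j k = 0 -> B k j = 0.
Proof. move=> jex kex; have [p [r [p0 r0]]] := good_skew jex kex; nia. Qed.

Lemma good_opp : good (- B).
Proof.
have [L [d [[d0 sk cp] co]]] := Bgood; exists (- L), d; split=> //; split=> //.
  by move=> i j iex jex; rewrite !mxE mulrN sk //; ring.
move=> i j jex; have := cp i j jex; congr eqmod; apply: eq_bigr => k _.
by rewrite !mxE mulrNN.
Qed.

Lemma max0E (x : int) : Num.max 0 x = if 0 <= x then x else 0.
Proof. by rewrite maxEle. Qed.

Lemma max0NE (x : int) : Num.max 0 (- x) = if 0 <= x then 0 else - x.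
Proof. by rewrite maxEle oppr_ge0; case: ltgtP => // ->. Qed.

Lemma matE_mul k (v : 'rV[int]_N) i :
  (v *m (matE k B)^T) 0 i = if i == k then - v 0 k else v 0 i + Num.max 0 (- B i k) * v 0 k.
Proof.
rewrite mxE (bigD1 k) //= !mxE eqxx /=; case: eqVneq => [->|ik].
  rewrite big1 ?addr0 ?mulrN1 // => m mk.
  by rewrite !mxE mk eq_sym (negPf mk) mulr0.
rewrite (bigD1 i) //= !mxE ik eqxx mulr1 big1 ?addr0 => [|m /andP[mk mi]].
  by rewrite mulrC addrC.
by rewrite !mxE mk eq_sym (negPf mi) mulr0.
Qed.

(* With [E = matE k B], column [j] of [E B'] is [b^j + max(0, b_kj) b^k]. *)
Lemma good_mut k : k \in ex ->
  (forall L d, compatible_with l ex L B d ->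
     compatible_with l ex (mutL k B L) (mutB ex k B) d) /\ good (mutB ex k B).
Proof.
move=> kex; suff cpt L d : compatible_with l ex L B d ->
     compatible_with l ex (mutL k B L) (mutB ex k B) d.
  by split=> //; have [L [d [cp co]]] := Bgood; exists (mutL k B L), d; split; auto.
case=> d0 sk cp; split=> // [i j iex jex|i j jex].
  rewrite !mutBE iex jex /= orbC (eq_sym j) (eq_sym k).
  case: ifP => _; first by rewrite !mulrN sk.
  have sign m r : m \in ex -> r \in ex ->
      (0 <= B m r) = (B r m <= 0) /\ (B m r < 0) = (0 < B r m).
    move=> mex rex; have := sk m r mex rex; have := d0 m mex; have := d0 r rex.
    move: (B m r) (B r m) (d m) (d r) => x y p r' *; nia.
  (* Skew-symmetrizability applied along [i], [k], [j]: the scaled correction terms at [(i, j)] and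
     [(j, i)] agree up to sign, and the opposite sign comes from the exchanged sign cases. *)
  have key : (d i)%:Z * (B i k * B k j) = (d j)%:Z * (B j k * B k i).
    have := sk i k iex kex; have := sk k j kex jex => e1 e2.
    by rewrite mulrA e2 mulNr -mulrA mulrCA e1; ring.
  have [-> ->] := sign i k iex kex; have [-> ->] := sign k j kex jex.
  have := sk i j iex jex; move: key.
  move: (B i j) (B j i) (B i k) (B k j) (B j k) (B k i) => x y z u v w key xy.
  rewrite !mulrDr xy opprD; congr (_ + _).
  by case: (ltgtP w 0) key => [w0|w0|->]; case: (ltgtP v 0) => [v0|v0|->] key /=;
    rewrite ?(mulr0, mul0r) in key *; rewrite ?mulr0 ?mulrN ?key ?mulr0 ?opprK ?oppr0.
(* The pairing of column [j] of [E B'] with [L], as compatibility of [B] dictates it for the columns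
   [b^j] and [b^k]. *)
pose t m : int := if j == k then - (if m == k then (d k)%:Z else 0)
  else (if m == j then (d j)%:Z else 0) + Num.max 0 (B k j) * (if m == k then (d k)%:Z else 0).
have rowE m : (colv j (mutB ex k B) *m (matE k B)^T) 0 m =
    if j == k then - B m k else B m j + Num.max 0 (B k j) * B m k.
  rewrite matE_mul [colv _ _ _ _]mxE [colv _ _ _ m]mxE !mutBE jex /= eqxx /=.
  case: (eqVneq j k) => [->|jk] /=; rewrite ?orbT ?orbF.
    by rewrite good_diag // oppr0 mulr0 addr0; case: eqVneq => [->|_]; rewrite ?good_diag // oppr0.
  case: eqVneq => [->|mk]; first by rewrite opprK good_diag // mulr0 addr0.
  move: (B m j) (B m k) (B k j) => x y z; rewrite max0NE max0E.
  by have [y0|y0] := leP 0 y; have [z0|z0] := leP 0 z => /=; ring.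
pose b := colv j (mutB ex k B).
have -> : \sum_m mutB ex k B m j * mutL k B L m i = (b *m (matE k B)^T *m L *m matE k B) 0 i.
  rewrite -!mulmxA [in RHS]mxE; apply: eq_bigr => m _.
  by rewrite /mutL -!mulmxA [b _ _]mxE.
have tE : eqmod l ((b *m (matE k B)^T *m L *m matE k B) 0 i) (\sum_m t m * matE k B m i).
  rewrite mxE; apply: eqmod_sum => m _; rewrite mulrC [t m * _]mulrC; apply: eqmodMl.
  rewrite mxE /t; under eq_bigr do rewrite rowE.
  case: (eqVneq j k) => [jk|jk].
    rewrite -mulN1r; under eq_bigr do rewrite -mulN1r -mulrA.
    by rewrite -mulr_sumr; apply/eqmodMl/cp.
  under eq_bigr do rewrite mulrDl -mulrA.
  by rewrite big_split -mulr_sumr; apply: eqmodD; [apply: cp|apply/eqmodMl/cp].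
suff -> : (if i == j then (d j)%:Z else 0) = \sum_m t m * matE k B m i by [].
have sum1 r (c : int) : \sum_m (if m == r then c else 0) * matE k B m i = c * matE k B r i.
  by rewrite (bigD1 r) //= eqxx big1 ?addr0 // => m /negPf->; rewrite mul0r.
rewrite /t; case: (eqVneq j k) => [jk|jk].
  under eq_bigr do rewrite mulNr.
  rewrite sumrN sum1 mxE jk eq_sym; case: eqVneq => [->|ki] /=.
    by rewrite eqxx mulrN1 opprK.
  by rewrite mulr0 oppr0.
under eq_bigr do rewrite mulrDl -mulrA.
rewrite big_split -mulr_sumr !sum1 !mxE.
have [->|ik] := eqVneq i k.
  rewrite eq_sym (negPf jk) /= eqxx mulrN1 max0NE max0E.
  have := sk j k jex kex; have := d0 k kex; have := d0 j jex.
  by move: (B j k) (B k j) (d j) (d k) => x y p r *; case: ifP; case: ifP; nia.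
rewrite /= !mulr0 addr0 (eq_sym j).
by case: eqP; rewrite ?mulr1 ?mulr0.
Qed.

Hypothesis l1 : (1 < l)%N.

(* Pairing a relation between two columns with [L] shows that its coefficients are divisible by [l];
   divide and repeat. *)
Lemma good_col_indep j k (a b : int) : j \in ex -> k \in ex -> j != k ->
  (forall i, a * B i k = b * B i j) -> a = 0.
Proof.
move=> jex kex jk; have [L [d [[d0 _ cp] co]]] := Bgood.
have dvdl (e : int) (r : 'I_N) : r \in ex -> eqmod l (e * (d r)%:Z) 0 ->
    exists e', e = e' * l%:Z.
  move=> rex; rewrite /eqmod eqz_mod_dvd subr0.
  by rewrite Gauss_dvdzl; [move/dvdzP | exact: co].
have pair i (e : int) r : i \in ex ->
    eqmod l (\sum_m (e * B m i) * L m r) (e * if r == i then (d i)%:Z else 0).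
  move=> iex; rewrite (eq_bigr (fun m => e * (B m i * L m r))) => [|m _].
    by rewrite -mulr_sumr eqmodMl ?cp.
  by rewrite mulrA.
have divide u v : (forall i, u * B i k = v * B i j) ->
    exists u' v', [/\ u = u' * l%:Z, v = v' * l%:Z & forall i, u' * B i k = v' * B i j].
  move=> uv.
  have sumE r : \sum_m (u * B m k) * L m r = \sum_m (v * B m j) * L m r.
    by apply: eq_bigr => m _; rewrite uv.
  have [u' uE] : exists u', u = u' * l%:Z.
    apply: (dvdl _ k) => //; have := pair j v k jex; have := pair k u k kex.
    rewrite sumE eqxx eq_sym (negPf jk) mulr0 /eqmod => /eqP<- /eqP->.
    exact: eqxx.
  have [v' vE] : exists v', v = v' * l%:Z.
    apply: (dvdl _ j) => //; have := pair j v j jex; have := pair k u j kex.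
    rewrite sumE eqxx (negPf jk) mulr0 /eqmod => /eqP + /eqP<-.
    by move->.
  exists u', v'; split=> // i; have := uv i; rewrite uE vE.
  by move: (B i k) (B i j) => x y; nia.
have: exists n : nat, (absz a <= n)%N by exists (absz a).
case=> n; elim: n a b => [|n IHn] a b an ab; first by lia.
have [a' [b' [aE bE ab']]] := divide _ _ ab.
have [a'0|/eqP a'0] := eqVneq a' 0; first by rewrite aE a'0 mul0r.
case: a'0; apply: (IHn a' b') => //; nia.
Qed.

Lemma deg_self_gt0 (b : 'rV[int]_N) : b != 0 -> 0 < deg b b.
Proof.
case/rV0Pn => i bi; rewrite /deg (bigD1 i) //=.
rewrite ltr_pwDl ?sumr_ge0 // => [|j _]; last by rewrite -expr2 sqr_ge0.
by rewrite -expr2 exprn_even_gt0 // bi orbT.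
Qed.

Lemma degB_lin (u v f : 'rV[int]_N) (a b : int) :
  deg (a *: u - b *: v) f = a * deg u f - b * deg v f.
Proof.
rewrite /deg !mulr_sumr -sumrB; apply: eq_bigr => i _.
by rewrite !mxE; ring.
Qed.

Lemma degC (u v : 'rV[int]_N) : deg u v = deg v u.
Proof. by apply: eq_bigr => i _; rewrite mulrC. Qed.

(** A zero column pairs to [0] with [L], whereas compatibility gives [d k], which is invertible
    modulo [l > 1]. *)
Lemma good_col_neq0 k : k \in ex -> colv k B != 0.
Proof.
move=> kex; have [L [d [[d0 _ cp] co]]] := Bgood.
apply/eqP => /rowP b0; have := cp k k kex; rewrite eqxx big1 => [|m _]; last first.
  by have := b0 m; rewrite !mxE => ->; rewrite mul0r.
rewrite /eqmod eq_sym eqz_mod_dvd subr0 => ld.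
have := co k kex; rewrite /coprime; have /gcdn_idPl -> : (l %| d k)%N by [].
lia.
Qed.

(* [w] is the component of column [k] orthogonal to column [j]. *)
Lemma good_weight j k : j \in ex -> k \in ex -> j != k ->
  exists w : 'rV[int]_N, deg w (colv j B) = 0 /\ 0 < deg w (colv k B).
Proof.
move=> jex kex jk; set u := colv j B; set v := colv k B.
pose w := deg u u *: v - deg u v *: u.
have u0 : 0 < deg u u by rewrite deg_self_gt0 ?good_col_neq0.
have wu : deg w u = 0 by rewrite degB_lin (degC v u); ring.
exists w; split=> //.
have w0 : w != 0.
  apply/eqP => /rowP w0; have : deg u u = 0.
    apply: (@good_col_indep j k _ (deg u v)) => // i.
    by apply/eqP; rewrite -subr_eq0; apply/eqP; have := w0 i; rewrite !mxE.
  lia.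
have := deg_self_gt0 w0; rewrite {2}/w degC degB_lin (degC u w) wu mulr0 subr0 (degC v w).
by rewrite pmulr_rgt0.
Qed.

Lemma good_weight1 k : k \in ex -> exists w : 'rV[int]_N, 0 < deg w (colv k B).
Proof. by move=> kex; exists (colv k B); rewrite deg_self_gt0 ?good_col_neq0. Qed.

End Consequences.
End Good.

(** * Exchange relations and upper bounds *)

Section ClusterMutation.
Variables (K : fieldType) (N : nat) (ex : {set 'I_N}).
Implicit Types (Y : 'I_N -> K) (B : 'M[int]_N) (i j k : 'I_N) (f : 'rV[int]_N).

(** The same formula as for toric frames, with Laurent monomials in [Y] in place of the frame. The
    new variable is the exchange polynomial [exch] divided by [Y k]. *)
Definition mutY k Y B j : K :=
  if j == k then mon Y (- ev k + posv (colv k B)) + mon Y (- ev k - negv (colv k B))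
  else Y j.

Definition exch k Y B := mon Y (posv (colv k B)) + mon Y (- negv (colv k B)).

Lemma mutYNk k Y B j : j != k -> mutY k Y B j = Y j.
Proof. by rewrite /mutY => /negPf->. Qed.

Lemma mutY_opp k Y B : mutY k Y (- B) = mutY k Y B.
Proof.
apply/funext => j; rewrite /mutY; case: ifP => // _.
by rewrite colvN posvN negvN opprK addrC.
Qed.

Lemma exchV k Y B : mutY k Y B k = mon Y (- ev k + posv (colv k B)) + mon Y (- ev k - negv (colv k B)).
Proof. by rewrite /mutY eqxx. Qed.

Lemma exch_mutY k Y B : (forall i, Y i != 0) -> Y k * mutY k Y B k = exch k Y B.
Proof.
move=> Y0; rewrite exchV mulrDr -[in LHS](mon_ev Y k) -!monD //.
by rewrite addrA subrr add0r addrA subrr add0r.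
Qed.

Lemma eq_mon_mutY k Y B f : f 0 k = 0 -> mon (mutY k Y B) f = mon Y f.
Proof.
move=> fk; apply: eq_mon => i; case: (eqVneq i k) => [->|ik]; first by left.
by right; rewrite mutYNk.
Qed.

Lemma posv0 f i : f 0 i = 0 -> posv f 0 i = 0.
Proof. by move=> fi; rewrite posvE fi. Qed.

Lemma negv0 f i : f 0 i = 0 -> negv f 0 i = 0.
Proof. by move=> fi; rewrite negvE fi. Qed.

Lemma colv0 k B i : B i k = 0 -> colv k B 0 i = 0.
Proof. by rewrite mxE. Qed.

Lemma posv_colv0 k B i : B i k = 0 -> posv (colv k B) 0 i = 0.
Proof. by move=> Bik; rewrite posv0 ?colv0. Qed.

Lemma negv_colv0 k B i : B i k = 0 -> (- negv (colv k B)) 0 i = 0.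
Proof. by move=> Bik; rewrite mxE negv0 ?oppr0 ?colv0. Qed.

(** Mutation negates column [k], which swaps the two terms, and neither term involves [Y k] because
    [B k k = 0]. *)
Lemma exch_mut k Y B : k \in ex -> B k k = 0 ->
  exch k (mutY k Y B) (mutB ex k B) = exch k Y B.
Proof.
move=> kex Bkk; rewrite /exch colv_mutB // posvN negvN opprK addrC.
by rewrite !eq_mon_mutY ?posv_colv0 ?negv_colv0.
Qed.

Lemma mutYK k Y B : (forall i, Y i != 0) -> exch k Y B != 0 -> k \in ex -> B k k = 0 ->
  mutY k (mutY k Y B) (mutB ex k B) = Y.
Proof.
move=> Y0 E0 kex Bkk; apply/funext => j; case: (eqVneq j k) => [->|jk]; last by rewrite !mutYNk.
have Yk : mutY k Y B k != 0.
  by apply: contraNneq E0; rewrite -exch_mutY // => ->; rewrite mulr0.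
have Y'0 i : mutY k Y B i != 0 by case: (eqVneq i k) => [->//|ik]; rewrite mutYNk.
apply: (mulfI Yk); rewrite exch_mutY // exch_mut // -exch_mutY //.
by rewrite mulrC.
Qed.

Lemma exchE k Y B : (forall i, Y i != 0) ->
  exch k Y B = mon Y (- negv (colv k B)) * (1 + mon Y (colv k B)).
Proof.
move=> Y0; rewrite /exch mulrDr mulr1 -monD // addrC; set b := colv k B.
by congr (_ + mon _ _); rewrite -[RHS](addrC b) -[X in X - _]posv_sub_negv addrK.
Qed.

Section Independence.
Variable k0 : subringClosed K.

Lemma exch_laurent k Y B : exch k Y B \in laurent k0 Y.
Proof. by rewrite sringD ?laurent_mon. Qed.

Lemma exch_homog k Y B : indep k0 Y -> B k k = 0 -> homog k0 Y (ev k) 0 (exch k Y B).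
Proof.
move=> ind Bkk; apply: homogD => //.
  rewrite -[mon _ _]mul1r -[X in homog _ _ _ X](_ : deg (ev k) (posv (colv k B)) = 0).
    by apply: homog_mon => //; apply: rpred1.
  by rewrite deg_ev posv_colv0.
rewrite -[mon _ _]mul1r -[X in homog _ _ _ X](_ : deg (ev k) (- negv (colv k B)) = 0).
  by apply: homog_mon => //; apply: rpred1.
by rewrite deg_ev negv_colv0.
Qed.

(** The substitution of [E / Y k] for the variable [k] changes exponents by [flip k], apart from a
    power of [E]. *)
Definition flip k f : 'rV[int]_N := \row_i if i == k then - f 0 i else f 0 i.

Lemma flipK k : involutive (flip k).
Proof. by move=> f; apply/rowP => i; rewrite !mxE; case: eqP => //; rewrite opprK. Qed.

Lemma mon_mutY k Y B f : (forall i, Y i != 0) -> exch k Y B != 0 ->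
  mon (mutY k Y B) f = mon Y (flip k f) * exch k Y B ^ f 0 k.
Proof.
move=> Y0 E0; rewrite /mon (bigD1 k) //= [in RHS](bigD1 k) //= mxE eqxx.
have -> : mutY k Y B k = (Y k)^-1 * exch k Y B by rewrite -exch_mutY // mulKf.
rewrite exprzMl ?unitfE ?invr_eq0 // exprz_inv -!mulrA; congr (_ * _).
rewrite mulrC; congr (_ * _); apply: eq_bigr => i ik.
by rewrite mutYNk // mxE (negPf ik).
Qed.

(** The exchange polynomial [E] is free of [Y k], so the grading by the exponent of [Y k] separates
    the terms of a relation; within one degree all terms carry the same power of [E], which
    cancels. *)
Lemma indep_mutY k Y B : indep k0 Y -> exch k Y B != 0 -> B k k = 0 ->
  indep k0 (mutY k Y B).
Proof.
move=> ind E0 Bkk s ks s0 h; have Y0 := indep_neq0 ind.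
set E := exch k Y B in E0; have hE := exch_homog ind Bkk.
(* Multiplying by [E ^+ n] makes all exponents of [E] nonnegative, so that the relation lives in the
   Laurent ring of [Y]. *)
have [n sn] : exists n : nat, forall p : K * 'rV[int]_N, p \in s -> 0 <= n%:Z + p.2 0 k.
  elim: (s) => [|a r [n IHn]]; first by exists 0.
  exists (n + (absz (a.2 0%R k)))%N => p; rewrite inE => /orP[/eqP->|/IHn pn].
    by move: (a.2 0 k) => x; lia.
  by move: (a.2 0 k) (p.2 0 k) pn => x y; lia.
have E0' : \sum_(p <- s) p.1 * mon Y (flip k p.2) * E ^+ absz (n%:Z + p.2 0 k)%R = 0.
  transitivity (E ^+ n * msum (mutY k Y B) s); last by rewrite s0 mulr0.
  rewrite mulr_sumr; apply: eq_big_seq => p /sn pn; rewrite mon_mutY // -/E [RHS]mulrCA -!mulrA; congr (_ * _).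
  rewrite [RHS]mulrCA; congr (_ * _).
  by rewrite !exprnP -expfzDr // gez0_abs.
have hE' m : homog k0 Y (ev k) 0 (E ^+ m).
  elim: m => [|m IHm]; first by rewrite expr0; apply: homog_coef => //; apply: rpred1.
  by rewrite exprS -[0]addr0; apply: homogM.
have part0 : \sum_(p <- s | p.2 0 k == h 0 k) p.1 * mon Y (flip k p.2) = 0.
  apply: (mulIf (expf_neq0 (absz (n%:Z + h 0 k)%R) E0)); rewrite mul0r mulr_suml.
  have := congr1 (part k0 Y (ev k) (- h 0 k)) E0'.
  rewrite [X in _ = X -> _](comp0 ind) big_seq part_sum //; last first.
    by move=> p /ks pk; rewrite sringM ?sringX ?exch_laurent // sringM ?laurent_mon ?laurent_coef.
  move=> E0''; rewrite -[RHS]E0'' big_mkcond big_seq; apply: eq_bigr => p ps.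
  have hp : homog k0 Y (ev k) (- p.2 0 k) (p.1 * mon Y (flip k p.2) * E ^+ absz (n%:Z + p.2 0 k)%R).
    have := homogM ind (homog_mon ind (ev k) (flip k p.2) (ks p ps)) (hE' (absz (n%:Z + p.2 0 k)%R)).
    by rewrite addr0 deg_ev mxE eqxx.
  by rewrite (homog_part ind _ hp) eqr_opp; case: eqP => // ->.
have := ind [seq (p.1, flip k p.2) | p : K * 'rV[int]_N <- s & p.2 0 k == h 0 k].
rewrite /msum big_map big_filter /= part0 => ind'.
have {}ind' := ind' _ erefl (flip k h).
rewrite big_map big_filter_cond /= in ind'; rewrite -[RHS]ind'.
  apply: eq_bigl => p; rewrite (can_eq (flipK k)).
  by case: eqP => [->|]; rewrite ?eqxx ?andbF.
by move=> p /mapP[r]; rewrite mem_filter => /andP[_ /ks kr ->].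
Qed.

End Independence.
End ClusterMutation.

(** * Elements regular modulo another element *)

Section Regular.
Variables (K : fieldType) (R : subringClosed K).
Implicit Types (x g a t s : K).

(** Multiplication by [g] is injective on [R / xR]. *)
Definition regular x g := forall t s, t \in R -> s \in R -> g * t = x * s ->
  exists2 s', s' \in R & t = x * s'.

Lemma regularM x g g' : g' \in R -> regular x g -> regular x g' -> regular x (g * g').
Proof.
move=> g'R xg xg' t s tR sR; rewrite -mulrA => /xg[||s' s'R]; rewrite ?rpredM //.
by move=> /xg'; apply.
Qed.

(** The intersection of [R[1/x]] and [R[1/g]] is [R]: as [g] is regular modulo [x], the powers of
    [x] in the denominator cancel one at a time. *)
Lemma regular_loc x g m n a : x \in R -> g \in R -> x != 0 -> regular x g ->
  x ^+ m * a \in R -> g ^+ n * a \in R -> a \in R.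
Proof.
move=> xR gR x0 xg + gn; elim: m => [|m IHm]; first by rewrite mul1r.
move=> xm; apply: IHm.
have : g ^+ n * (x ^+ m.+1 * a) = x * (x ^+ m * (g ^+ n * a)).
  by rewrite exprS; ring.
have : x ^+ m * (g ^+ n * a) \in R by rewrite rpredM ?rpredX.
move: (x ^+ m * (g ^+ n * a)) => s; elim: n {gn} s => [|n IHn] s sR.
  by rewrite mul1r exprS -mulrA => /(mulfI x0)->.
rewrite exprS -mulrA => /xg[|//|s' s'R]; first by rewrite rpredM ?rpredX.
exact: IHn.
Qed.

Lemma laurent_loc (k0 : subringClosed K) N (Y : 'I_N -> K) D :
  (forall c, c \in k0 -> c \in R) -> D \in R ->
  (forall i, exists n, D ^+ n * Y i \in R /\ D ^+ n * (Y i)^-1 \in R) ->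
  forall a, a \in laurent k0 Y -> exists n, D ^+ n * a \in R.
Proof.
move=> kR DR DY a aL.
have [] := @sring_loc K (laurent_gens k0 Y) R (fun d => exists n, d = D ^+ n) _ _ _ _ _ a aL.
- by exists 0.
- by move=> _ _ [m ->] [n ->]; exists (m + n)%N; rewrite exprD.
- by move=> _ [n ->]; rewrite rpredX.
- by move=> d x _; rewrite mulrC.
- move=> x [/kR xR|[i]]; first by exists 1; [exists 0|rewrite mul1r].
  by have [n [Dn DnV]] := DY i; move=> [->|->]; exists (D ^+ n) => //; exists n.
- by move=> _ [n ->]; exists n.
Qed.

End Regular.

(** * Invariance of upper bounds under mutation *)

Section LaurentStep.
Variables (K : fieldType) (k0 : subringClosed K) (N l : nat) (ex : {set 'I_N}).
Hypothesis l1 : (1 < l)%N.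
Implicit Types (Y : 'I_N -> K) (B : 'M[int]_N).

Lemma one_plus_mon_neq0 Y (b : 'rV[int]_N) : indep k0 Y -> b != 0 -> 1 + mon Y b != 0.
Proof.
move=> ind b0; apply: contraNneq b0 => e0.
have : 1 * mon Y 0 = -1 * mon Y b.
  by rewrite mul1r mon0 mulN1r; apply/eqP; rewrite -subr_eq0 opprK e0.
by case/(mon_inj ind); rewrite ?rpred1 ?rpredN ?rpred1 ?oner_neq0 // => <-.
Qed.

Lemma exch_neq0 Y B k : indep k0 Y -> good l ex B -> k \in ex -> exch k Y B != 0.
Proof.
move=> ind Bgood kex; have Y0 := indep_neq0 ind.
by rewrite exchE // mulf_neq0 ?mon_neq0 // one_plus_mon_neq0 // (good_col_neq0 Bgood).
Qed.

(** The linear term is kept separately: after division by [x] in an exchange relation it still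
    counts modulo [x] when [z] contains only one factor [x]. *)
Lemma exprD2 (R : subringClosed K) (a z : K) (m : nat) : a \in R -> z \in R ->
  exists2 h, h \in R & (a + z) ^+ m = a ^+ m + m%:R * a ^+ m.-1 * z + z ^+ 2 * h.
Proof.
move=> aR zR; elim: m => [|m [h hR IHm]].
  by exists 0; rewrite ?rpred0 // !expr0 mul0r mul0r mulr0 !addr0.
exists (m%:R * a ^+ m.-1 + (a + z) * h).
  by rewrite rpredD // rpredM ?rpredX ?rpred_nat ?rpredD.
rewrite exprS IHm /= -[in m.+1%:R]natr1; case: m {IHm} => [|m] /=; first by rewrite !expr0 expr1; ring.
by rewrite (exprS a m.+1) (exprS a m); ring.
Qed.

Section Fixed.
Variables (Y : 'I_N -> K) (B : 'M[int]_N) (j k : 'I_N).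
Hypotheses (ind : indep k0 Y) (Bgood : good l ex B).
Hypotheses (jex : j \in ex) (kex : k \in ex) (jk : j != k).

Let kj : k != j. Proof. by rewrite eq_sym. Qed.
Let Y' := mutY k Y B.
Let B' := mutB ex k B.
Let Y1 := mutY j Y B.
Let Y2 := mutY j Y' B'.
Local Notation R := (laurent k0 Y2).
Let B'good : good l ex B'. Proof. by have [] := good_mut Bgood kex. Qed.
Let ind' : indep k0 Y'.
Proof. by apply: indep_mutY => //; rewrite ?(good_diag Bgood) ?(exch_neq0 ind Bgood). Qed.
Let ind2 : indep k0 Y2.
Proof. by apply: indep_mutY => //; rewrite ?(good_diag B'good) ?(exch_neq0 ind' B'good). Qed.
Let ind1 : indep k0 Y1.
Proof. by apply: indep_mutY => //; rewrite ?(good_diag Bgood) ?(exch_neq0 ind Bgood). Qed.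
Let Y0 := indep_neq0 ind.
Let Y'0 := indep_neq0 ind'.
Let Y20 := indep_neq0 ind2.
Let Y10 := indep_neq0 ind1.
Let b' := colv j B'.
Let b'j : b' 0 j = 0. Proof. by rewrite mxE (good_diag B'good). Qed.

Let Y'j : Y' j = Y j. Proof. by rewrite /Y' mutYNk. Qed.
Let Y2k : Y2 k = Y' k. Proof. by rewrite /Y2 mutYNk. Qed.
Let Y2i i : i != j -> i != k -> Y2 i = Y i.
Proof. by move=> ij ik; rewrite /Y2 mutYNk // /Y' mutYNk. Qed.

Let monY2 (f : 'rV[int]_N) : f 0 j = 0 -> f 0 k = 0 -> mon Y f = mon Y2 f.
Proof. by move=> fj fk; rewrite /Y2 eq_mon_mutY // /Y' eq_mon_mutY. Qed.

Let monY2' (f : 'rV[int]_N) : f 0 j = 0 -> mon Y2 f = mon Y' f.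
Proof. exact: eq_mon_mutY. Qed.

Let xE : Y j * Y2 j = mon Y2 (- negv b') * (1 + mon Y2 b').
Proof.
rewrite -Y'j exch_mutY // exchE // !monY2' //.
exact: (negv_colv0 (good_diag B'good jex)).
Qed.

(** Up to this unit of [R], the element [Y j] is [1 + mon Y2 b'], so regularity modulo [Y j] becomes
    a question about gradings. *)
Let unit_x := mon Y2 (- negv b') / Y2 j.
Let unit_xR : unit_x \in R. Proof. by rewrite sringM ?laurent_mon ?laurent_varV. Qed.
Let unit_xVR : unit_x^-1 \in R.
Proof. by rewrite invfM invrK -monN // sringM ?laurent_mon ?laurent_var. Qed.
Let unit_x0 : unit_x != 0.
Proof. by rewrite mulf_neq0 ?invr_eq0 ?mon_neq0. Qed.
Let xE' : Y j = unit_x * (1 + mon Y2 b').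
Proof. by apply: (mulIf (Y20 j)); rewrite xE /unit_x; field. Qed.
Let xR : Y j \in R.
Proof. by rewrite xE' sringM // sringD ?sring1 ?laurent_mon. Qed.

(** Over the cluster [Y2], mutated at [k] and then at [j], elements of the first Laurent ring need
    only powers of [Y j] as denominators, those of the second only powers of [Y1 j * Y k].
    Regularity of the latter modulo [Y j] makes both kinds of denominators disappear. *)
Lemma laurent_step_of_regular : Y1 j \in R -> Y k \in R ->
  regular R (Y j) (Y1 j) -> regular R (Y j) (Y k) ->
  forall a, a \in laurent k0 Y' -> a \in laurent k0 Y1 -> a \in R.
Proof.
move=> x'R wR rx rw a aY' aY1.
have kR c : c \in k0 -> c \in R by apply: laurent_coef.
have [|m xm] := laurent_loc kR xR _ aY'.
  move=> i; exists 1; rewrite expr1; have [->|ij] := eqVneq i j.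
    by rewrite Y'j divff // sring1 sringM.
  have -> : Y' i = Y2 i by rewrite /Y2 [RHS]mutYNk.
  by rewrite !sringM ?laurent_var ?laurent_varV.
have DR : Y1 j * Y k \in R by rewrite sringM.
have [|n Dn] := laurent_loc kR DR _ aY1.
  move=> i; exists 1; rewrite expr1; have [->|ij] := eqVneq i j.
    by split; [rewrite !sringM|rewrite mulrAC divff // mul1r].
  have -> : Y1 i = Y i by rewrite /Y1 mutYNk.
  have [->|ik] := eqVneq i k.
    by split; [rewrite !sringM|rewrite -mulrA divff // mulr1].
  by rewrite -(Y2i ij ik) !(sringM DR) ?laurent_var ?laurent_varV.
exact: (regular_loc xR DR (Y0 j) (regularM wR rx rw) xm Dn).
Qed.

(** Modulo [Y j] the element is a unit times [1 + r], where [r] has positive weight while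
    [1 + mon Y2 b'] has weight [0]; this is the situation of [homog_regular]. *)
Let regular_unit1 (w : 'rV[int]_N) (n : int) (u r h : K) : 0 < n -> u \in R -> u^-1 \in R -> u != 0 ->
  homog k0 Y2 w n r -> deg w b' = 0 -> h \in R ->
  regular R (Y j) (u * (1 + r + Y j * h)).
Proof.
move=> n0 uR uVR u0 hr wb hR t s tR sR; rewrite -mulrA => e.
have e1 : (1 + r) * t = (1 + mon Y2 b') * (unit_x * (s / u - h * t)).
  rewrite mulrA [_ * unit_x]mulrC -xE'; apply: (mulfI u0).
  by rewrite -[LHS](addrK (u * (Y j * h * t))) -mulrDr -mulrDl e; field.
have hd : homog k0 Y2 w 0 (1 + mon Y2 b').
  apply: homogD => //; first by apply: homog_coef => //; apply: rpred1.
  by have := homog_mon ind2 w b' (rpred1 k0); rewrite mul1r wb.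
have [|t' t'R ->] := homog_regular ind2 n0 hr hd tR _ e1.
  by rewrite sringM // sringB // sringM.
exists (unit_x^-1 * t'); first by rewrite sringM.
by rewrite xE' -mulrA (mulrCA (1 + _)) mulVKf.
Qed.

(** In unlinked directions the mutations do not interact: [Y1 j] is the unit [Y2 j], and a weight
    that kills column [j] but not column [k] makes [Y k] regular modulo [Y j]. *)
Lemma laurent_step0 a : B j k = 0 ->
  a \in laurent k0 Y' -> a \in laurent k0 Y1 -> a \in R.
Proof.
move=> bjk; have bkj := good_eq0 Bgood jex kex bjk.
have bkk := good_diag Bgood kex; have bjj := good_diag Bgood jex.
have b'E : b' = colv j B.
  apply/rowP => i; rewrite !mxE -/(mutB _ _ _ _ _) exchange_half jex /= (negPf jk) orbF.
  case: eqVneq => [->|ik]; first by rewrite bkj oppr0.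
  by rewrite bkj mulr0 oppr0 !if_same addr0.
have x'E : Y1 j = Y2 j.
  rewrite /Y1 /Y2 !exchV -/b' b'E /Y'.
  have evjk : (- ev j : 'rV[int]_N) 0 k = 0 by rewrite !mxE (negPf kj) oppr0.
  by rewrite !eq_mon_mutY // mxE evjk add0r ?posv_colv0 ?negv_colv0.
have wE : Y k = mon Y2 (- negv (colv k B)) / Y2 k * (1 + mon Y2 (colv k B)).
  apply: (mulIf (Y20 k)); rewrite [in LHS]Y2k exch_mutY // exchE //.
  by rewrite !monY2 ?negv_colv0 ?colv0 //; field.
have uR : mon Y2 (- negv (colv k B)) / Y2 k \in R by rewrite sringM ?laurent_mon ?laurent_varV.
have [w [wj wk]] := good_weight Bgood l1 jex kex jk.
apply: laurent_step_of_regular.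
- by rewrite x'E laurent_var.
- by rewrite wE sringM // sringD ?sring1 ?laurent_mon.
- move=> t s tR sR; rewrite x'E => e; exists (s / Y2 j); first by rewrite sringM ?laurent_varV.
  by apply: (mulfI (Y20 j)); rewrite e; field.
- have -> : Y k = mon Y2 (- negv (colv k B)) / Y2 k * (1 + mon Y2 (colv k B) + Y j * 0).
    by rewrite mulr0 addr0.
  apply: (@regular_unit1 w _ _ _ _ wk) => //; last 1 first.
  + exact: sring0.
  + by rewrite invfM invrK -monN // sringM ?laurent_mon ?laurent_var.
  + by rewrite mulf_neq0 ?invr_eq0 ?mon_neq0.
  + by have := homog_mon ind2 w (colv k B) (rpred1 k0); rewrite mul1r.
  + by rewrite b'E.
Qed.

(** Modulo [x = Y j] the variable [Y k] is a unit, and [Y1 j] is a unit times [1] plus a term of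
    exponent [-1] in [Y2 j]. The exchange polynomial in direction [j] is free of [Y2 j], so the
    weight [- ev j] shows regularity. *)
Lemma laurent_step_gt0 a : 0 < B j k ->
  a \in laurent k0 Y' -> a \in laurent k0 Y1 -> a \in R.
Proof.
move=> bjk; have bkj := good_gt0 Bgood jex kex bjk.
have bkk := good_diag Bgood kex; have bjj := good_diag Bgood jex.
have [n n0 nE] : exists2 n : nat, (0 < n)%N & B j k = n%:Z.
  by exists (absz (B j k)); [rewrite absz_gt0 gt_eqF|rewrite gtz0_abs].
have [m m0 mE] : exists2 m : nat, (0 < m)%N & B k j = - m%:Z.
  by exists (absz (B k j)); [rewrite absz_gt0 lt_eqF|rewrite ltz0_abs // opprK].
have n0z : 0 < n%:Z by rewrite ltz_nat.
have m0z : 0 < m%:Z by rewrite ltz_nat.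
set bj := colv j B; set bk := colv k B.
(* The exponents of the terms in the exchange relations at [k] and [j], with the factors [Y j ^+ n]
   and [Y k ^+ m] removed. They vanish at [j] and [k], so these monomials are the same in [Y] and in
   [Y2]. *)
pose fA := - negv bk; pose fB := posv bk - ev j *+ n.
pose fG := - negv bj - ev k *+ m; pose fD := posv bj.
have evE (i i' : 'I_N) (c : nat) : (- ev i *+ c) 0 i' = if i' == i then - c%:Z else 0.
  by rewrite mulNrn mxE -scaler_nat !mxE eqxx /=; case: eqP; rewrite ?mulr1 ?mulr0 ?oppr0 ?natz.
have fAj : fA 0 j = 0 by rewrite mxE negvE mxE nE; rewrite (lt_geF n0z) oppr0.
have fAk : fA 0 k = 0 by rewrite negv_colv0.
have fBj : fB 0 j = 0. rewrite /fB -mulNrn mxE evE eqxx posvE mxE nE.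
  by rewrite le0z_nat subrr.
have fBk : fB 0 k = 0 by rewrite /fB -mulNrn mxE evE (negPf kj) posv_colv0.
have fGj : fG 0 j = 0 by rewrite /fG -mulNrn mxE evE (negPf jk) negv_colv0.
have fGk : fG 0 k = 0 by rewrite /fG -mulNrn mxE evE eqxx mxE negvE mxE mE; rewrite oppr_le0 le0z_nat opprK subrr.
have fDj : fD 0 j = 0 by rewrite posv_colv0.
have fDk : fD 0 k = 0 by rewrite posvE mxE mE; rewrite oppr_ge0 (lt_geF m0z).
pose x := Y j; pose w := Y k; pose w' := Y2 k.
pose A := mon Y2 fA; pose C := mon Y2 fB; pose G := mon Y2 fG; pose D := mon Y2 fD.
have wE : w * w' = A + x ^+ n * C.
  rewrite /w' Y2k exch_mutY // /exch addrC; congr (_ + _); first by rewrite monY2.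
  by rewrite /C -monY2 // /fB monB // monMn // mon_ev mulrC divfK ?expf_neq0.
have x'E : x * Y1 j = G * w ^+ m + D.
  rewrite exch_mutY // /exch addrC; congr (_ + _); last by rewrite monY2.
  by rewrite /G -monY2 // /fG monB // monMn // mon_ev divfK ?expf_neq0.
have rowMn (f : 'rV[int]_N) c i : (f *+ c) 0 i = c%:Z * f 0 i.
  by rewrite -scaler_nat mxE natz.
(* The matrix mutation rule in terms of exponents: [G * A ^+ m] and [D * w' ^+ m] stand in the same
   ratio as the two terms of the exchange polynomial at [j] after mutation at [k]. *)
have expE : fG + fA *+ m = fD + ev k *+ m - b'.
  apply/rowP => i.
  have -> : (fG + fA *+ m) 0 i = fG 0 i + m%:Z * fA 0 i by rewrite mxE rowMn.
  have -> : (fD + ev k *+ m - b') 0 i = fD 0 i + m%:Z * ev k 0 i - b' 0 i.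
    by rewrite mxE [X in X + _]mxE [X in _ + X]mxE rowMn.
  have evk : ev k 0 i = if i == k then 1 else 0 by rewrite mxE eqxx /=; case: eqP.
  have [ij|ij] := eqVneq i j.
    by rewrite evk ij fGj fAj fDj b'j (negPf jk) ?mulr0 ?addr0 ?subr0.
  rewrite evk [b' 0 i]mxE mutBE jex (negPf jk) orbF /=.
  have [ik|ik] := eqVneq i k.
    by rewrite ik fGk fAk fDk mE /= mulr0 mulr1 !add0r !opprK subrr.
  have -> : fG 0 i = - negv bj 0 i.
    by rewrite /fG -mulNrn mxE [X in X + _]mxE evE (negPf ik) addr0.
  have -> : fA 0 i = - negv bk 0 i by rewrite mxE.
  rewrite mE !negvE posvE !mxE; have -> : (0 <= - m%:Z) = false by rewrite oppr_ge0 (lt_geF m0z).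
  have -> : (- m%:Z < 0) by rewrite oppr_lt0.
  rewrite andbF andbT; move: (B i j) (B i k) => u v.
  by case: (ltgtP u 0) => [_|_|->]; case: (ltgtP v 0) => [_|_|->]; ring.
have GAE : G * A ^+ m = D * w' ^+ m * mon Y2 (- b').
  by rewrite -monMn // -monD // expE !monD // monMn // mon_ev.
pose fV := fD + ev k *+ m - b' + negv b'; pose V := mon Y2 fV.
have VE : V = D * w' ^+ m * mon Y2 (- b') / mon Y2 (- negv b').
  by rewrite /V /fV !monD // monMn // mon_ev (monN _ (negv _)) // invrK.
(* This is [w' ^+ m * (G * w ^+ m + D)] with [w * w'] replaced by [A], its value modulo [x]; being a
   monomial times the new exchange polynomial, it is divisible by [x]. *)
have sumE : G * A ^+ m + D * w' ^+ m = V * x * Y2 j.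
  by rewrite -mulrA xE GAE VE monN //; field; rewrite !mon_neq0.
have inR : [/\ A \in R, C \in R, G \in R, D \in R & w' \in R].
  by split; rewrite ?laurent_mon ?laurent_var.
have [AR CR GR DR w'R] := inR.
have AV : A^-1 \in R by rewrite -monN // laurent_mon.
have w'V : w'^-1 \in R by rewrite laurent_varV.
have VR : V \in R by rewrite laurent_mon.
have VV : V^-1 \in R by rewrite -monN // laurent_mon.
have V0 : V != 0 by rewrite mon_neq0.
have A0 : A != 0 by rewrite mon_neq0.
have w'0 : w' != 0 by rewrite Y20.
have x0 : x != 0 by rewrite Y0.
have wR : w \in R.
  have -> : w = (A + x ^+ n * C) / w' by rewrite -wE mulfK.
  by rewrite sringM // sringD // sringM // sringX.
have [h h1R hE] := exprD2 m AR (sringM (sringX n xR) CR).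
(* The term linear in [x]; for [n > 1] it already belongs to the part divisible by [x ^+ 2]. *)
pose h0 := if n == 1%N then m%:R * A ^+ m.-1 * C * G else 0.
have [h2 h2R hE2] : exists2 h2, h2 \in R & G * (A + x ^+ n * C) ^+ m = G * A ^+ m + x * h0 + x ^+ 2 * h2.
  rewrite -/x in hE; rewrite hE /h0.
  have [->|[n' ->]] : n = 1%N \/ exists n', n = n'.+2.
    by case: (n) n0 => [//|[|n']] _; [left|right; exists n'].
  - exists (G * C ^+ 2 * h); first by rewrite !sringM ?sringX.
    by rewrite /= expr1; ring.
  - exists (G * (m%:R * A ^+ m.-1 * x ^+ n' * C + x ^+ n'.+1 * x ^+ n'.+1 * C ^+ 2 * h)).
      by rewrite sringM // sringD // !sringM ?sringX ?sring_nat.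
    by rewrite /= !exprS; ring.
have Y1E : Y1 j = V * Y2 j / w' ^+ m * (1 + h0 / (V * Y2 j) + x * (h2 / (V * Y2 j))).
  apply: (mulfI x0); rewrite x'E.
  have wE' : w = (A + x ^+ n * C) / w' by rewrite -wE mulfK.
  rewrite wE' expr_div_n mulrA hE2.
  have -> : G * A ^+ m = V * x * Y2 j - D * w' ^+ m by rewrite -sumE addrK.
  by field; rewrite Y20 V0 expf_neq0.
pose u := V * Y2 j / w' ^+ m.
have w'mV : (w' ^+ m)^-1 \in R.
  by have := exprVn w' m => <-; rewrite sringX.
have uR : u \in R by rewrite !sringM ?laurent_var.
have uV : u^-1 \in R by rewrite /u !invfM invrK !sringM ?sringX ?laurent_varV.
have u0 : u != 0 by rewrite /u !mulf_neq0 ?invr_eq0 ?expf_neq0.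
have vV : (V * Y2 j)^-1 \in R by rewrite invfM sringM ?laurent_varV.
have h0R : h0 \in R.
  by rewrite /h0; case: ifP => _; rewrite ?sring0 // !sringM ?sringX ?sring_nat.
apply: laurent_step_of_regular => //.
- rewrite Y1E; apply: sringM => //; apply: sringD.
    by rewrite sringD ?sring1 // sringM.
  by rewrite sringM // sringM.
- rewrite Y1E; apply: (@regular_unit1 (- ev j) 1) => //; last by rewrite sringM.
    rewrite /h0; case: eqP => _; last by rewrite mul0r; apply: homog0.
    pose f := fA *+ m.-1 + fB + fG - fV - ev j.
    have fj : deg (- ev j) f = 1.
      rewrite degN deg_ev /f mxE [X in X + _]mxE [X in X + _ + _]mxE [X in X + _ + _ + _]mxE.
      rewrite rowMn fAj fBj fGj ![(- _ : 'rV_N) 0 j]mxE [ev j 0 j]mxE !eqxx.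
      have -> : fV 0 j = 0.
        rewrite /fV mxE [X in X + _]mxE [X in X + _ + _]mxE rowMn fDj [(- b') 0 j]mxE b'j.
        by rewrite negv0 // [ev k 0 j]mxE (negPf jk) /= mulr0.
      by rewrite mulr0.
    rewrite -fj (_ : _ / _ = m%:R * mon Y2 f); first by apply: homog_mon => //; apply: rpred_nat.
    rewrite /f (monB Y20 _ (ev j)) (monB Y20 _ fV) (monD Y20 _ fG) (monD Y20 _ fB) monMn // mon_ev.
    rewrite -/A -/C -/G -/V.
    by field; rewrite V0 Y20.
  by rewrite degN deg_ev b'j oppr0.
(* The relation [w * w' = A + x ^+ n * C] makes [w] congruent to the unit [A / w'] modulo [x]. *)
- move=> t s tR sR e; exists ((s * w' - x ^+ n.-1 * C * t) / A).
    by rewrite sringM // sringB ?sringM ?sringX.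
  have xn : x ^+ n = x * x ^+ n.-1 by rewrite -exprS prednK.
  rewrite -/x mulrA; apply: (mulIf A0); rewrite divfK //.
  rewrite mulrBr !mulrA -e -/w mulrAC wE xn.
  ring.
Qed.

End Fixed.

Lemma laurent_step Y B j k a : indep k0 Y -> good l ex B ->
  j \in ex -> k \in ex -> j != k ->
  a \in laurent k0 (mutY k Y B) -> a \in laurent k0 (mutY j Y B) ->
  a \in laurent k0 (mutY j (mutY k Y B) (mutB ex k B)).
Proof.
move=> ind Bgood jex kex jk ak aj; case: (ltgtP (B j k) 0) => bjk.
(* Negating [B] swaps the terms of every exchange relation, so it changes no variable and turns a
   negative entry into a positive one. *)
- rewrite -(mutY_opp k Y) -(mutY_opp j (mutY k Y (- B))) -mutB_opp.
  apply: laurent_step_gt0 => //; rewrite ?mutY_opp //.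
    exact: good_opp.
  by rewrite mxE oppr_gt0.
- exact: laurent_step_gt0.
- exact: laurent_step0.
Qed.

(* The upper bound of Berenstein, Fomin and Zelevinsky. *)
Definition upper Y B a :=
  a \in laurent k0 Y /\ forall k, k \in ex -> a \in laurent k0 (mutY k Y B).

Lemma upper_mut Y B k a : indep k0 Y -> good l ex B -> k \in ex ->
  upper Y B a -> upper (mutY k Y B) (mutB ex k B) a.
Proof.
move=> ind Bgood kex [aY ak]; split; first exact: ak.
move=> j jex; have [->|jk] := eqVneq j k; last by apply: laurent_step; auto.
by rewrite mutYK ?(good_diag Bgood) ?(exch_neq0 ind Bgood) //; exact: (indep_neq0 ind).
Qed.

Lemma upper_var Y B i : indep k0 Y -> good l ex B -> upper Y B (Y i).
Proof.
move=> ind Bgood; split=> [|k kex]; first exact: laurent_var.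
have Y0 := indep_neq0 ind.
have [->|ik] := eqVneq i k; last by rewrite -(mutYNk Y B ik) laurent_var.
have E0 := exch_neq0 ind Bgood kex.
have ind' : indep k0 (mutY k Y B) by apply: indep_mutY => //; rewrite (good_diag Bgood).
rewrite -[Y k](mulfK (indep_neq0 ind' k)) exch_mutY //.
rewrite -(exch_mut _ kex) ?(good_diag Bgood) //.
by rewrite sringM ?laurent_varV ?exch_laurent.
Qed.

End LaurentStep.

(** * Subtraction-free expressions *)

Section FrozenOrder.
Variables (K : fieldType) (k0 : subringClosed K) (N : nat) (ex : {set 'I_N}).
Hypothesis K0 : forall n : nat, n.+1%:R != 0 :> K.
Variables (Y : 'I_N -> K) (i : 'I_N).
Hypotheses (ind : indep k0 Y) (iex : i \notin ex).
Let Y0 := indep_neq0 ind.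
Implicit Types (f : 'rV[int]_N) (a b : K).

(** The generated ring consists of the Laurent polynomials that are polynomial in [Y i]. *)
Definition nonneg_gens x :=
  exists c f, [/\ c \in k0, 0 <= f 0 i & x = c * mon Y f].

Notation nonneg := (sring nonneg_gens).

Definition possum a := exists2 s : seq 'rV[int]_N,
  forall f, f \in s -> 0 <= f 0 i & a = \sum_(f <- s) mon Y f.

(** Some monomial is free of [Y i], so [a] does not vanish along [Y i = 0]. Positivity of the
    coefficients keeps this true for products, and for sums with any [possum]. *)
Definition possum0 a := exists2 s : seq 'rV[int]_N,
  (forall f, f \in s -> 0 <= f 0 i) /\ (exists2 f, f \in s & f 0 i = 0) &
  a = \sum_(f <- s) mon Y f.

Lemma possum0W a : possum0 a -> possum a.
Proof. by case=> s [s0 _] ->; exists s. Qed.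

Lemma possum_mon f : 0 <= f 0 i -> possum (mon Y f).
Proof. by move=> f0; exists [:: f] => [g|]; rewrite ?inE ?big_seq1 // => /eqP->. Qed.

Lemma possum0_mon f : f 0 i = 0 -> possum0 (mon Y f).
Proof.
move=> f0; exists [:: f]; last by rewrite big_seq1.
split=> [g|]; first by rewrite inE => /eqP->; rewrite f0.
by exists f; rewrite ?inE.
Qed.

Lemma possum01 : possum0 1.
Proof. by rewrite -(mon0 Y); apply: possum0_mon; rewrite mxE. Qed.

Lemma possumM a b : possum a -> possum b -> possum (a * b).
Proof.
case=> s s0 -> [r r0 ->]; exists [seq f + g | f <- s, g <- r].
  by move=> h /allpairsP[[f g] /= [/s0 f0 /r0 g0 ->]]; rewrite mxE addr_ge0.
rewrite big_allpairs_dep mulr_suml; apply: eq_bigr => f _.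
by rewrite mulr_sumr; apply: eq_bigr => g _; rewrite monD.
Qed.

Lemma possum0M a b : possum0 a -> possum0 b -> possum0 (a * b).
Proof.
case=> s [s0 [f fs f0]] -> [r [r0 [g gr g0]] ->]; exists [seq f + g | f <- s, g <- r].
  split=> [h /allpairsP[[f' g'] /= [/s0 f0' /r0 g0' ->]]|].
    by rewrite mxE addr_ge0.
  by exists (f + g); [apply/allpairsP; exists (f, g)|rewrite mxE f0 g0].
rewrite big_allpairs_dep mulr_suml; apply: eq_bigr => f' _.
by rewrite mulr_sumr; apply: eq_bigr => g' _; rewrite monD.
Qed.

Lemma possum0D a b : possum0 a -> possum b -> possum0 (a + b).
Proof.
case=> s [s0 [f fs f0]] -> [r r0 ->]; exists (s ++ r); last by rewrite big_cat.
split=> [h|]; first by rewrite mem_cat => /orP[/s0|/r0].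
by exists f; rewrite // mem_cat fs.
Qed.

Lemma possum_nonneg a : possum a -> a \in nonneg.
Proof.
case=> s s0 ->; rewrite big_seq sring_sum // => f /s0 f0.
by apply: sring_gen; exists 1, f; rewrite mul1r rpred1.
Qed.

Lemma nonneg_part a d : a \in nonneg -> d < 0 -> part k0 Y (ev i) d a = 0.
Proof.
suff: forall a, a \in nonneg -> exists2 s : seq (K * 'rV[int]_N), coef_in k0 s /\
    (forall p, p \in s -> 0 <= p.2 0 i) & a = msum Y s.
  move=> /(_ a) h /h[s [ks s0] ->] d0; rewrite /part comp_msum // big_seq_cond big1 // => p.
  by case/andP => /s0 p0 /eqP pd; rewrite -pd deg_ev ltNge p0 in d0.
move=> {}a /sringP; elim=> {a} [x [c [f [kc f0 ->]]]||x _|x y _ + _|x y _ + _].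
- by exists [:: (c, f)]; [split=> p; rewrite inE => /eqP->|rewrite /msum big_seq1].
- exists [:: (1, 0)]; last by rewrite /msum big_seq1 mon0 mulr1.
  by split=> p; rewrite inE => /eqP-> /=; [apply: rpred1|rewrite mxE].
- case=> s [ks s0] ->; exists [seq (- p.1, p.2) | p <- s].
    by split=> p /mapP[r rs ->] /=; [rewrite rpredN; apply: ks|apply: s0].
  by rewrite /msum big_map -sumrN; apply: eq_bigr => p _; rewrite mulNr.
- move=> [s [ks s0] ->] [r [kr r0] ->]; exists (s ++ r); last by rewrite /msum big_cat.
  by split=> p; rewrite mem_cat => /orP[]; auto.
- move=> [s [ks s0] ->] [r [kr r0] ->].
  exists [seq (p.1 * q.1, p.2 + q.2) | p <- s, q <- r].
    split=> p /allpairsP[[u v] /= [us vr ->]] /=.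
      by rewrite rpredM //; [apply: ks|apply: kr].
    by rewrite mxE addr_ge0 //; [apply: s0|apply: r0].
  rewrite /msum big_allpairs_dep mulr_suml; apply: eq_bigr => p _.
  by rewrite mulr_sumr; apply: eq_bigr => q _ /=; rewrite monD // mulrACA.
Qed.

(* In characteristic zero a sum of monomials cannot cancel. *)
Lemma possum0_part a : possum0 a -> part k0 Y (ev i) 0 a != 0.
Proof.
case=> s [s0 [f fs f0]] ->.
have -> : \sum_(g <- s) mon Y g = msum Y [seq (1, g) | g <- s].
  by rewrite /msum big_map; apply: eq_bigr => g _; rewrite mul1r.
have k1 (r : seq 'rV[int]_N) : coef_in k0 [seq (1, g) | g <- r].
  by move=> p /mapP[g _ ->]; apply: rpred1.
rewrite /part comp_msum // big_map -big_filter.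
apply/eqP; set r := [seq _ <- s | _] => r0.
have := ind (k1 r); rewrite /msum big_map r0 => /(_ erefl f).
rewrite big_map big_const_seq iter_addr_0 => /eqP.
have : (0 < count (fun g => g == f) r)%N.
  by rewrite -has_count; apply/hasP; exists f; rewrite // mem_filter deg_ev f0 eqxx.
by case: (count _ _) => // n _; rewrite (negPf (K0 n)).
Qed.

Lemma possum0_neq0 a : possum0 a -> a != 0.
Proof. by move/possum0_part; apply: contraNneq => ->; rewrite /part comp0. Qed.

Definition ratio (P : K -> Prop) a := exists2 u, P u & exists2 v, possum0 v & v * a = u.

Lemma ratio1 : ratio possum0 1.
Proof. by exists 1; [exact: possum01|exists 1; rewrite ?mulr1 //; exact: possum01]. Qed.

Lemma ratioM (P : K -> Prop) a b : (forall a b, P a -> P b -> P (a * b)) ->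
  ratio P a -> ratio P b -> ratio P (a * b).
Proof.
move=> PM [u Pu [v v0 vE]] [u' Pu' [v' v0' vE']].
exists (u * u'); first exact: PM.
by exists (v * v'); [exact: possum0M|rewrite mulrACA vE vE'].
Qed.

Lemma ratioV a : ratio possum0 a -> ratio possum0 a^-1.
Proof.
case=> u u0 [v v0 va]; exists v => //; exists u => //; rewrite -va.
by rewrite mulfK //; apply: contraNneq (possum0_neq0 u0) => a0; rewrite -va a0 mulr0.
Qed.

Lemma ratioW a : ratio possum0 a -> ratio possum a.
Proof. by case=> u u0 va; exists u => //; apply: possum0W. Qed.

Lemma ratioD a b : ratio possum0 a -> ratio possum b -> ratio possum0 (a + b).
Proof.
case=> u u0 [v v0 vE] [u' u0' [v' v0' vE']]; exists (v' * u + v * u').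
  by apply: possum0D; [exact: possum0M|apply: possumM => //; exact: possum0W].
by exists (v * v'); [exact: possum0M|rewrite -vE -vE'; ring].
Qed.

Definition admissible (Y' : 'I_N -> K) := Y' i = Y i /\
  forall j, j != i -> ratio possum0 (Y' j).

Lemma admissible_refl : admissible Y.
Proof.
split=> // j ji; exists (mon Y (ev j)).
  by apply: possum0_mon; rewrite mxE eq_sym (negPf ji) andbF.
by exists 1; [exact: possum01|rewrite mul1r mon_ev].
Qed.

Lemma admissible_mon Y' f : admissible Y' ->
  (0 <= f 0 i -> ratio possum (mon Y' f)) /\ (f 0 i = 0 -> ratio possum0 (mon Y' f)).
Proof.
case=> Y'i Y'j.
have rest : ratio possum0 (\prod_(j | j != i) Y' j ^ f 0 j).
  apply: (big_ind (ratio possum0)) => [|x y|j ji]; first exact: ratio1.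
    by apply: ratioM; exact: possum0M.
  have exp (n : nat) : ratio possum0 (Y' j ^+ n).
    elim: n => [|n IHn]; first exact: ratio1.
    by rewrite exprS; apply: ratioM IHn; [exact: possum0M|exact: Y'j].
  by case: (f 0 j) => n; [exact: exp|rewrite NegzE; exact: (ratioV (exp n.+1))].
rewrite /mon (bigD1 i) //= Y'i; split=> [f0|->]; last by rewrite expr0z mul1r.
apply: ratioM (ratioW rest); first exact: possumM.
exists (Y i ^ f 0 i); last by exists 1; [exact: possum01|rewrite mul1r].
case: (f 0 i) f0 => // n _; rewrite -exprnP -(mon_ev Y i) -monMn //.
by apply: possum_mon; rewrite -scaler_nat mxE mulr_ge0 // mxE.
Qed.

(** Of the two terms in an exchange relation at most one contains the variable [i], so their sum
    does not vanish along [Y i = 0]. *)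
Lemma admissible_mut Y' B k : (forall j, Y' j != 0) -> k \in ex ->
  admissible Y' -> admissible (mutY k Y' B).
Proof.
move=> Y'0 kex adm; have ik : i != k by apply: contraNneq iex => ->.
have [Y'i Y'j] := adm; split=> [|j ji]; first by rewrite mutYNk.
have [->|jk] := eqVneq j k; last by rewrite mutYNk //; apply: Y'j.
have -> : mutY k Y' B k = (Y' k)^-1 * exch k Y' B by rewrite -exch_mutY // mulKf.
apply: ratioM; [exact: possum0M|by apply/ratioV/Y'j; rewrite eq_sym|].
rewrite /exch; have [b0|/ltW b0] := leP 0 (colv k B 0 i).
  rewrite addrC; apply: ratioD; apply admissible_mon => //.
    by rewrite mxE negvE; case: (ltgtP (colv k B 0 i) 0) b0 => // ->; rewrite oppr0.
  by rewrite posvE b0.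
apply: ratioD; apply admissible_mon => //.
  by rewrite posvE; case: (ltgtP (colv k B 0 i) 0) b0 => // ->.
by rewrite mxE negvE b0 oppr_ge0.
Qed.

Lemma admissible_nonneg Y' j : admissible Y' -> exists2 v, possum0 v & v * Y' j \in nonneg.
Proof.
case=> Y'i Y'j; have [->|ji] := eqVneq j i.
  exists 1; first exact: possum01.
  rewrite mul1r Y'i -(mon_ev Y i); apply/possum_nonneg/possum_mon.
  by rewrite mxE.
have [u u0 [v v0 vE]] := Y'j j ji; exists v => //.
by rewrite vE; apply/possum_nonneg/possum0W.
Qed.

Lemma sring_nonneg (G : K -> Prop) a :
  (forall x, G x -> exists2 v, possum0 v & v * x \in nonneg) ->
  a \in sring G -> exists2 v, possum0 v & v * a \in nonneg.
Proof.
move=> GS; apply: sring_loc => //; first exact: possum01.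
- exact: possum0M.
- by move=> v /possum0W/possum_nonneg.
- by move=> v x _; rewrite mulrC.
Qed.

(** In degree [f 0 i] the product has the part [c * mon Y f] times the degree [0] part of [v], which
    is nonzero; a negative degree cannot occur in [nonneg]. *)
Lemma nonneg_exponent v c f : possum0 v -> c \in k0 -> c != 0 ->
  v * (c * mon Y f) \in nonneg -> 0 <= f 0 i.
Proof.
move=> v0 kc c0 vcf; rewrite leNgt; apply/negP => f0.
have := nonneg_part vcf f0; rewrite mulrC -[X in part _ _ _ X](deg_ev i).
have vL : v \in laurent k0 Y.
  apply: sring_sub (possum_nonneg (possum0W v0)) => _ [d [g [kd _ ->]]].
  by rewrite sringM ?laurent_mon ?laurent_coef.
rewrite (part_homogM ind _ (homog_mon ind _ _ kc)) // subrr => /eqP.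
by rewrite !mulf_eq0 (negPf c0) (negPf (mon_neq0 Y0 f)) (negPf (possum0_part v0)).
Qed.

End FrozenOrder.

Notation nonneg k0 Y i := (sring (nonneg_gens k0 Y i)).

(** * Cyclotomic integers *)

(** ['Phi_n] is the minimal polynomial of each of its roots in [algC], so a nonzero rational
    polynomial of smaller degree is coprime to it; a Bezout relation over the rationals is then
    cleared of denominators. *)
Lemma cyclotomic_coprime_int (n : nat) (p : {poly int}) : (0 < n)%N -> p != 0 ->
  (size p <= totient n)%N ->
  exists u v (c : int), c != 0 /\ u * p + v * 'Phi_n = c%:P.
Proof.
move=> n0 p0 sp; pose toQ := map_poly (intr : int -> rat).
have toQ_inj : injective toQ by apply: map_inj_poly => //; apply: intr_inj.
have cop : coprimep (toQ p) (toQ 'Phi_n).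
  rewrite /coprimep -(size_map_poly (ratr : rat -> algC)) gcdp_map.
  apply/negPn/negP => /closed_rootP[w].
  have mapC (r : {poly int}) : map_poly ratr (toQ r) = map_poly (intr : int -> algC) r.
    by rewrite -map_poly_comp; apply: eq_map_poly => c /=; rewrite ratr_int.
  rewrite root_gcd !mapC => /andP[pw Phiw].
  have [z prim_z] := C_prim_root_exists n0.
  rewrite (Cintr_Cyclotomic prim_z) root_cyclotomic // in Phiw.
  have [m [mE _] mdvd] := minCpolyP w.
  have : (m %| toQ p)%R by rewrite -mdvd mapC.
  have p0' : toQ p != 0 by apply: contraNneq p0 => e; apply/eqP/toQ_inj; rewrite e /toQ map_poly0.
  move/dvdp_leq => /(_ p0'); rewrite /toQ size_map_inj_poly //; last exact: intr_inj.
  rewrite leqNgt; case/negP; apply: leq_ltn_trans sp _.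
  rewrite -(size_map_poly (ratr : rat -> algC)) -mE (minCpoly_cyclotomic Phiw).
  by rewrite size_cyclotomic.
have [[u v] /= uv1] := Bezout_coprimepP _ _ cop.
have [u' [a a0 uE]] := rat_poly_scale u; have [v' [b b0 vE]] := rat_poly_scale v.
move: uv1; rewrite -size_poly_eq1 => /size_poly1P[c c0 cE].
exists ((b * denq c) *: u'), ((a * denq c) *: v'), (a * b * numq c); split.
  by rewrite !mulf_neq0 // numq_eq0.
have a0' : a%:~R != 0 :> rat by rewrite intr_eq0.
have b0' : b%:~R != 0 :> rat by rewrite intr_eq0.
have d0' : (denq c)%:~R != 0 :> rat by rewrite intr_eq0 denq_neq0.
apply: toQ_inj.
have -> : toQ (a * b * numq c)%:P = (a%:~R * b%:~R * (denq c)%:~R) *: c%:P.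
  by rewrite /toQ map_polyC /= !intrM numqE -mul_polyC -polyCM; congr _%:P; ring.
rewrite -cE /toQ rmorphD !rmorphM /= !map_polyZ /= uE vE !intrM scalerDr -!scalerAl !scalerA.
by congr (_ *: _ + _ *: _); field.
Qed.

Section Cyclotomic.
Variables (K : fieldType) (l : nat) (q : K).
Hypothesis K0 : forall n : nat, n.+1%:R != 0 :> K.
Hypothesis qP : l.-primitive_root q.
Let l0 : (0 < l)%N := prim_order_gt0 qP.

Local Notation toK := (map_poly (intr : int -> K)).

Lemma intr_neq0 (n : int) : n != 0 -> n%:~R != 0 :> K.
Proof. by case: n => [[|n]|n] //= _; rewrite ?NegzE ?mulrNz ?oppr_eq0 ?K0 //; exact: K0. Qed.

(** As a root of [X^l - 1], [x] is a root of some ['Phi_d] with [d] dividing [l]; then [x ^+ d = 1],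
    which forces [d = l]. *)
Lemma root_Cyclotomic x : l.-primitive_root x -> root (toK 'Phi_l) x.
Proof.
move=> xP; have := congr1 (fun p => (toK p).[x]) (prod_Cyclotomic l0).
rewrite rmorphB /= map_polyXn rmorph1 !hornerE (prim_expr_order xP) subrr.
rewrite rmorph_prod horner_prod => /eqP; rewrite prodf_seq_eq0 => /hasP[d].
rewrite -dvdn_divisors // => dl /= rd.
suff <- : d = l by [].
have d0 : (0 < d)%N by apply: dvdn_gt0 dl.
apply/eqP; rewrite eqn_dvd dl (prim_order_dvd xP) -subr_eq0 /=.
have := congr1 (fun p => (toK p).[x]) (prod_Cyclotomic d0).
rewrite rmorphB /= map_polyXn rmorph1 !hornerE => <-.
rewrite rmorph_prod horner_prod prodf_seq_eq0; apply/hasP; exists d => //.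
by rewrite -dvdn_divisors.
Qed.

(** The integral Bezout relation carries irreducibility over from [algC] to [K], where a nonzero
    integer stays nonzero. *)
Lemma int_indep (p : {poly int}) : (size p <= totient l)%N -> (toK p).[q] = 0 -> p = 0.
Proof.
move=> sp pq; apply/eqP/negPn/negP => p0.
have [u [v [c [c0 uv]]]] := cyclotomic_coprime_int l0 p0 sp.
have := congr1 (fun p => (toK p).[q]) uv.
rewrite rmorphD !rmorphM /= map_polyC /= !hornerE pq (eqP (root_Cyclotomic qP)) !mulr0 addr0.
by move/esym/eqP; rewrite (negPf (intr_neq0 c0)).
Qed.

Definition Zq := sring (fun x : K => x = q).

Lemma ZqP x : x \in sring (fun x : K => x = q) <-> exists p : {poly int}, x = (toK p).[q].
Proof.
split=> [/sringP|[p ->]]; last first.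
  rewrite horner_coef sring_sum // => i _.
  by rewrite coef_map sringM ?sring_int ?sringX // sring_gen.
elim=> {x} [x ->||x _ [p ->]|x y _ [p ->] _ [r ->]|x y _ [p ->] _ [r ->]].
- by exists 'X; rewrite map_polyX hornerX.
- by exists 1; rewrite rmorph1 hornerC.
- by exists (- p); rewrite rmorphN hornerN.
- by exists (p + r); rewrite rmorphD hornerD.
- by exists (p * r); rewrite rmorphM hornerM.
Qed.

Lemma toK_mod (p : {poly int}) x : l.-primitive_root x ->
  (toK p).[x] = (toK (Pdiv.Ring.rmodp p 'Phi_l)).[x].
Proof.
move=> xP; rewrite {1}(Pdiv.RingMonic.rdivp_eq (Cyclotomic_monic l) p).
by rewrite rmorphD rmorphM /= !hornerE (eqP (root_Cyclotomic xP)) mulr0 add0r.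
Qed.

Lemma size_mod_Phi (p : {poly int}) : (size (Pdiv.Ring.rmodp p 'Phi_l) <= totient l)%N.
Proof.
by rewrite -ltnS -(size_Cyclotomic l) Pdiv.Ring.ltn_rmodpN0 // monic_neq0 // Cyclotomic_monic.
Qed.

Lemma horner_small (p : {poly int}) x : (size p <= totient l)%N ->
  (toK p).[x] = \sum_(i < totient l) (p`_i)%:~R * x ^+ i.
Proof.
move=> sp; rewrite (@horner_coef_wide _ (totient l)); last exact: leq_trans (size_poly _ _) sp.
by apply: eq_bigr => i _; rewrite coef_map.
Qed.

End Cyclotomic.

(** * The trace form and the discriminant of the cyclotomic integers *)

Section ScalarBasis.
Variables (K : fieldType) (k0 Z : {pred K}) (r : nat) (e : 'I_r -> K).

Definition scalar_basis :=
  [/\ forall i, e i \in Z,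
      forall z, z \in Z -> exists2 c : 'I_r -> K, (forall i, c i \in k0) & z = \sum_i c i * e i
    & forall c : 'I_r -> K, (forall i, c i \in k0) -> \sum_i c i * e i = 0 -> forall i, c i = 0].

(** [G] is the Gram matrix of the trace form in the basis [e], with traces taken of multiplication
    matrices over [k0]. *)
Definition trace_form (G : 'M[K]_r) := forall i j, exists m : 'M[K]_r,
  [/\ forall a b, m a b \in k0,
      forall b, e i * e j * e b = \sum_a m a b * e a & G i j = \tr m].

End ScalarBasis.

Notation int_ring K := (sring (fun _ : K => False)).
Notation cyclo_ring q := (sring (fun x => x = q)).

Lemma prim_root_neq0 (K : fieldType) n (z : K) : n.-primitive_root z -> z != 0.
Proof. by move=> zP; rewrite (prim_root_eq0 zP) -lt0n (prim_order_gt0 zP). Qed.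

Section CyclotomicDiscriminant.
Variables (K : fieldType) (l : nat) (q : K).
Hypothesis K0 : forall n : nat, n.+1%:R != 0 :> K.
Hypothesis qP : l.-primitive_root q.
Let l0 : (0 < l)%N := prim_order_gt0 qP.
Let q0 : q != 0.
Proof. exact: prim_root_neq0 qP. Qed.
Let r := totient l.
Local Notation toK := (map_poly (intr : int -> K)).
Local Notation Zq := (cyclo_ring q).

Lemma int_ringP x : x \in int_ring K <-> exists n : int, x = n%:~R.
Proof.
split=> [/sringP|[n ->]]; last exact: sring_int.
elim=> {x} [x []||x _ [n ->]|x y _ [n ->] _ [m ->]|x y _ [n ->] _ [m ->]].
- by exists 1.
- by exists (- n); rewrite mulrNz.
- by exists (n + m); rewrite intrD.
- by exists (n * m); rewrite intrM.
Qed.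

Lemma qZq : q \in Zq. Proof. exact: sring_gen. Qed.

Definition zbasis (i : 'I_r) : K := q ^+ i.

Lemma cyclo_scalar_basis : scalar_basis (int_ring K) Zq zbasis.
Proof.
split=> [i|z /(ZqP q)[p ->]|c ck c0 i].
- by rewrite sringX // qZq.
- rewrite (toK_mod qP p qP) (@horner_small _ l) ?size_mod_Phi //.
  by eexists; last reflexivity; move=> i; apply: sring_int.
- have /fin_all_exists[n nE] j : exists n : int, c j = n%:~R by apply/int_ringP/ck.
  pose p := \poly_(j < r) (if insub j is Some j' then n j' else 0).
  have pj (j : 'I_r) : p`_j = n j by rewrite coef_poly ltn_ord valK.
  have : p = 0.
    apply: (int_indep K0 qP); first exact: size_poly.
    rewrite (@horner_small _ l) ?size_poly // -[RHS]c0; apply: eq_bigr => j _.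
    by rewrite pj nE.
  by move/(congr1 (fun u : {poly int} => u`_i)); rewrite pj coef0 nE => ->.
Qed.

Definition units := [seq a <- index_iota 0 l | coprime l a].

Lemma size_units : size units = r.
Proof. by rewrite /r totient_count_coprime size_filter -sum1_count big_mkcond; apply: eq_bigr => a _; case: coprime. Qed.

Definition conjq (i : 'I_r) : K := q ^+ nth 0%N units i.

Lemma nth_units (i : 'I_r) : (nth 0%N units i < l)%N /\ coprime l (nth 0%N units i).
Proof.
have : nth 0%N units i \in units by rewrite mem_nth ?size_units.
by rewrite mem_filter mem_index_iota => /andP[-> /andP[_ ->]].
Qed.

Lemma conjq_prim i : l.-primitive_root (conjq i).
Proof. by have [_] := nth_units i; rewrite (prim_root_exp_coprime _ qP) coprime_sym. Qed.

Lemma units_uniq : uniq units. Proof. by rewrite filter_uniq ?iota_uniq. Qed.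

Lemma conjq_inj : injective conjq.
Proof.
move=> i j /eqP; have [il _] := nth_units i; have [jl _] := nth_units j.
rewrite (eq_prim_root_expr qP) !modn_small // nth_uniq ?size_units ?units_uniq //.
by move/eqP/val_inj.
Qed.

(** The conjugates of the power basis: entry [(a, i)] is the image of [q ^+ i] under the [a]-th
    embedding. *)
Let V := (Vandermonde r (\row_i conjq i))^T.

Lemma VE a i : V a i = conjq a ^+ i. Proof. by rewrite !mxE. Qed.

Lemma V_unit : V \in unitmx.
Proof.
rewrite unitmx_tr unitmxE unitfE det_Vandermonde.
apply/prodf_neq0 => i _; apply/prodf_neq0 => j ij; rewrite !mxE subr_eq0.
by apply/eqP => /conjq_inj ji; rewrite ji ltnn in ij.
Qed.

(** Reduction modulo ['Phi_l] is valid at every primitive root, so [V] conjugates multiplication by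
    [q ^+ (i + j)] into the diagonal matrix of its conjugates. *)
Lemma cyclo_trace_form : trace_form (int_ring K) zbasis (V^T *m V).
Proof.
move=> i j; pose p b := Pdiv.Ring.rmodp ('X^(i + j + b) : {poly int}) 'Phi_l.
pose m : 'M[K]_r := \matrix_(a, b) ((p b)`_a)%:~R.
have mE x (b : 'I_r) : l.-primitive_root x -> x ^+ (i + j + b) = \sum_a m a b * x ^+ a.
  move=> xP; have -> : x ^+ (i + j + b) = (toK 'X^(i + j + b)).[x] by rewrite map_polyXn hornerXn.
  rewrite (toK_mod qP _ xP) (@horner_small _ l) ?size_mod_Phi //.
  by apply: eq_bigr => a _; rewrite mxE.
exists m; split=> [a b|b|].
- by rewrite mxE sring_int.
- by rewrite -!exprD (mE _ _ qP).
- have Vm : V *m m = diag_mx (\row_a conjq a ^+ (i + j)) *m V.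
    apply/matrixP => a b; rewrite mul_diag_mx !mxE -exprD (mE _ _ (conjq_prim a)).
    by apply: eq_bigr => c _; rewrite mulrC !mxE.
  have -> : m = invmx V *m (diag_mx (\row_a conjq a ^+ (i + j)) *m V).
    by rewrite -Vm mulKmx // V_unit.
  rewrite mxtrace_mulC -mulmxA mulmxV ?V_unit // mulmx1 mxtrace_diag mxE.
  by apply: eq_bigr => a _; rewrite !mxE -exprD.
Qed.

Definition zunit u := [/\ u \in Zq, u^-1 \in Zq & u != 0].

Lemma zunit1 : zunit 1.
Proof. by split; rewrite ?invr1 ?sring1 ?oner_eq0. Qed.

Lemma zunitM u v : zunit u -> zunit v -> zunit (u * v).
Proof. by move=> [? ? ?] [? ? ?]; split; rewrite ?invfM ?sringM ?mulf_neq0. Qed.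

Lemma zunitV u : zunit u -> zunit u^-1.
Proof. by move=> [? ? ?]; split; rewrite ?invrK ?invr_eq0. Qed.

Lemma zunitN1 : zunit (-1).
Proof. by split; rewrite ?invrN1 ?sringN ?sring1 ?oppr_eq0 ?oner_eq0. Qed.

Lemma zunit_q n : zunit (q ^+ n).
Proof.
elim: n => [|n IHn]; first exact: zunit1.
rewrite exprS; apply: zunitM IHn; split; rewrite ?qZq //.
have -> : q^-1 = q ^+ l.-1.
  by apply: (mulfI q0); rewrite divff // -exprS prednK // (prim_expr_order qP).
by rewrite sringX ?qZq.
Qed.

(** The discriminant is computed up to units of [Z[q]]. Since it is an integer, [assoc_int] then
    determines it up to sign. *)
Definition assoc x y := exists2 u, zunit u & x = u * y.

Lemma assoc_refl x : assoc x x.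
Proof. by exists 1; [exact: zunit1|rewrite mul1r]. Qed.

Lemma assoc_sym x y : assoc x y -> assoc y x.
Proof.
by case=> u uz ->; exists u^-1; [exact: zunitV|case: uz => _ _ u0; rewrite mulKf].
Qed.

Lemma assoc_trans y x z : assoc x y -> assoc y z -> assoc x z.
Proof. by case=> u uz -> [v vz ->]; exists (u * v); [exact: zunitM|rewrite mulrA]. Qed.

Lemma assocM x y x' y' : assoc x y -> assoc x' y' -> assoc (x * x') (y * y').
Proof. by case=> u uz -> [v vz ->]; exists (u * v); [exact: zunitM|rewrite mulrACA]. Qed.

Lemma assoc_prod (I : Type) (s : seq I) (P : pred I) (F G : I -> K) :
  (forall i, P i -> assoc (F i) (G i)) ->
  assoc (\prod_(i <- s | P i) F i) (\prod_(i <- s | P i) G i).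
Proof.
by move=> FG; apply: (big_ind2 assoc) => //; [exact: assoc_refl|move=> *; exact: assocM].
Qed.

Lemma assocX x y n : assoc x y -> assoc (x ^+ n) (y ^+ n).
Proof. by move=> xy; elim: n => [|n IHn]; [exact: assoc_refl|rewrite !exprS; exact: assocM]. Qed.

Lemma assoc_unit u : zunit u -> assoc u 1.
Proof. by exists u; rewrite ?mulr1. Qed.

Lemma assocN x : assoc (- x) x.
Proof. by exists (-1); [exact: zunitN1|rewrite mulN1r]. Qed.

(** The powers of [q] below [totient l] are independent over the integers, so divisibility of
    integers in [Z[q]] can be tested on the constant coefficient. *)
Lemma assoc_int (m n : int) : assoc m%:~R n%:~R -> absz m = absz n.
Proof.
have dvd (a b : int) : assoc a%:~R b%:~R -> (b %| a)%Z.
  case=> u [/(ZqP q)[p uE] _ _].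
  rewrite uE (toK_mod qP p qP) => ab; set p' := Pdiv.Ring.rmodp _ _ in ab.
  have r0 : (0 < r)%N by rewrite totient_gt0.
  have : a%:P - b *: p' = 0.
    apply: (int_indep K0 qP).
      rewrite (leq_trans (size_polyD _ _)) // size_polyN geq_max size_polyC.
      rewrite (leq_trans (leq_b1 _)) // (leq_trans (size_scale_leq _ _)) //.
      exact: size_mod_Phi.
    by rewrite rmorphB /= map_polyC map_polyZ /= !hornerE ab mulrC subrr.
  move/(congr1 (fun v : {poly int} => v`_0)); rewrite coefB coefC coefZ coef0 /=.
  by move/eqP; rewrite subr_eq0 => /eqP->; rewrite dvdz_mulr.
move=> mn; apply/eqP; rewrite eqn_dvd; apply/andP; split.
  exact: (dvd _ _ (assoc_sym mn)).
exact: (dvd _ _ mn).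
Qed.

(** This is the derivative of [X^n - 1] at [z ^+ a], obtained by dividing out [X - z ^+ a]. *)
Lemma prod_root_diff n (z : K) a : n.-primitive_root z -> (a < n)%N ->
  \prod_(0 <= b < n | b != a) (z ^+ a - z ^+ b) = n%:R * z ^+ (a * n.-1).
Proof.
move=> zP an; have := factor_Xn_sub_1 zP.
rewrite (bigD1_seq a) ?iota_uniq ?mem_index_iota //=.
have -> : 'X^n - 1 = ('X - (z ^+ a)%:P) * \sum_(i < n) 'X^(n.-1 - i) * (z ^+ a)%:P ^+ i.
  by rewrite -subrXX -polyC_exp -exprM mulnC exprM (prim_expr_order zP) expr1n.
have X0 : 'X - (z ^+ a)%:P != 0 by rewrite polyXsubC_eq0.
move/(mulfI X0)/(congr1 (fun p => p.[z ^+ a])).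
rewrite horner_prod horner_sum => e.
rewrite (eq_bigr (fun b => ('X - (z ^+ b)%:P).[z ^+ a])) => [|b _]; last by rewrite !hornerE.
rewrite e (eq_bigr (fun=> z ^+ (a * n.-1))) => [|i _].
  by rewrite sumr_const card_ord mulr_natl.
rewrite -polyC_exp !hornerE -exprD -exprM subnK //.
by rewrite -ltnS prednK // (leq_ltn_trans _ an).
Qed.

(** Each of [x], [y] is a power of the other, so the two differences divide each other by geometric
    sums. *)
Lemma assoc_1sub x y m k : x \in Zq -> y \in Zq -> y = x ^+ m -> x = y ^+ k -> x != 1 ->
  assoc (1 - y) (1 - x).
Proof.
move=> xZ yZ yx xy x1.
have y1 : y != 1 by apply: contraNneq x1 => y1; rewrite xy y1 expr1n.
have dvd u v n : u \in Zq -> u != 1 -> v = u ^+ n -> (1 - v) / (1 - u) \in Zq.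
  move=> uZ u1 ->; rewrite -{1}(expr1n _ n) subrXX mulrC mulKf ?subr_eq0 1?eq_sym //.
  by rewrite sring_sum // => i _; rewrite sringM ?sringX ?sring1.
have n0 : 1 - x != 0 by rewrite subr_eq0 eq_sym.
have m0 : 1 - y != 0 by rewrite subr_eq0 eq_sym.
exists ((1 - y) / (1 - x)); last by rewrite divfK.
split; first exact: dvd yx.
  by rewrite invf_div; apply: dvd xy.
by rewrite mulf_neq0 ?invr_eq0.
Qed.

Lemma prim_root_dvd_prime p w : prime p -> p.-primitive_root w -> w \in Zq ->
  exists2 s, s \in Zq & p%:R = (1 - w) * s.
Proof.
move=> pr wP wZ; have p1 := prime_gt1 pr.
have := prod_root_diff wP (prime_gt0 pr); rewrite mul0n expr0 mulr1 => <-.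
rewrite -big_filter (bigD1_seq 1%N) ?filter_uniq ?iota_uniq //; last first.
  by rewrite mem_filter mem_index_iota p1.
rewrite /= expr1; eexists; last reflexivity.
rewrite big_seq_cond; apply: (big_ind (fun x => x \in Zq)) => [|x y|b _].
- exact: sring1.
- exact: sringM.
- by rewrite sringB ?sring1 ?sringX.
Qed.

(* Then [1 - x] divides two distinct primes. *)
Lemma zunit_1sub x m p m' p' : x \in Zq -> prime p -> prime p' -> p != p' ->
  p.-primitive_root (x ^+ m) -> p'.-primitive_root (x ^+ m') -> zunit (1 - x).
Proof.
move=> xZ pr pr' pp' xm xm'.
have dvd r0 n : prime r0 -> r0.-primitive_root (x ^+ n) ->
    exists2 s, s \in Zq & r0%:R = (1 - x) * s.
  move=> rp xn; have [s sZ ->] := prim_root_dvd_prime rp xn (sringX n xZ).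
  rewrite -{1}(expr1n _ n) subrXX; eexists; last by rewrite -mulrA; reflexivity.
  by rewrite sringM // sring_sum // => i _; rewrite sringM ?sringX ?sring1.
have [s sZ sE] := dvd _ _ pr xm; have [s' s'Z s'E] := dvd _ _ pr' xm'.
have co : coprime p p' by rewrite prime_coprime // dvdn_prime2.
have [[u v] /= uv] := coprimeP p' (prime_gt0 pr) co.
have uvK : (1 - x) * (u%:R * s - v%:R * s') = 1.
  rewrite mulrBr !(mulrCA (1 - x)) -sE -s'E -!natrM -natrB ?uv //.
  by rewrite ltnW // -subn_gt0 uv.
have x0 : 1 - x != 0.
  by apply/eqP => x0; move/eqP: uvK; rewrite x0 mul0r eq_sym oner_eq0.
split=> //; first by rewrite sringB ?sring1.
have -> : (1 - x)^-1 = u%:R * s - v%:R * s' by apply: (mulfI x0); rewrite divff ?uvK.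
by rewrite sringB // sringM ?sring_nat.
Qed.

(** [1 - w] for a primitive [p]-th root of unity [w]; its [(p - 1)]-st power is associated to
    [p]. *)
Definition unif p := 1 - q ^+ (l %/ p).

Lemma coprime_inv a p : (0 < a)%N -> coprime a p -> exists k, (a * k = 1 %[mod p])%N.
Proof.
move=> a0 /(coprimeP _ a0)[[u v] /= uv]; exists u.
have -> : (a * u = v * p + 1)%N by lia.
by rewrite modnMDl.
Qed.

Lemma prim_unif p : prime p -> (p %| l)%N -> p.-primitive_root (q ^+ (l %/ p)).
Proof. by move=> pr pl; apply: dvdn_prim_root. Qed.

Lemma prim_root_neq1 p (w : K) : (1 < p)%N -> p.-primitive_root w -> w != 1.
Proof.
move=> p1 wP; rewrite -(expr0 w) -{1}[w]expr1 (eq_prim_root_expr wP).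
by rewrite mod0n modn_small.
Qed.

Lemma assoc_unif_exp p a : prime p -> (p %| l)%N -> coprime a p ->
  assoc (1 - q ^+ (l %/ p * a)) (unif p).
Proof.
move=> pr pl ap; have wP := prim_unif pr pl.
have a0 : (0 < a)%N by rewrite lt0n; apply: contraTneq ap => ->; rewrite /coprime gcd0n gtn_eqF ?prime_gt1.
have [k ak] := coprime_inv a0 ap.
apply: (@assoc_1sub (q ^+ (l %/ p)) _ a k); rewrite ?sringX ?qZq //.
- by rewrite exprM.
- rewrite exprM; set w := q ^+ _ in wP *; rewrite -exprM -[LHS]expr1.
  by apply/eqP; rewrite (eq_prim_root_expr wP) ak.
- exact: prim_root_neq1 (prime_gt1 pr) wP.
Qed.

Lemma assoc_unif_prime p : prime p -> (p %| l)%N -> assoc p%:R (unif p ^+ p.-1).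
Proof.
move=> pr pl; have wP := prim_unif pr pl.
have := prod_root_diff wP (prime_gt0 pr); rewrite mul0n expr0 mulr1 => <-.
rewrite big_ltn_cond ?prime_gt0 //= big_nat_cond.
apply: (@assoc_trans (\prod_(1 <= b < p) unif p)).
  rewrite [X in assoc _ X]big_nat_cond (eq_bigl (fun b => (0 < b < p)%N && true)); last first.
    by case=> [|b]; rewrite //= andbT.
  apply: assoc_prod => b /andP[/andP[b0 bp] _]; rewrite -exprM.
  apply: assoc_unif_exp => //; rewrite coprime_sym prime_coprime //.
  by rewrite gtnNdvd.
rewrite prodr_const_nat subn1; exact: assoc_refl.
Qed.

(** The powers [q ^+ b] with [p] dividing [b] are the roots of [X^(l/p) - 1], which is evaluated at
    [q ^+ a]. *)
Lemma assoc_prod_multiples p a : prime p -> (p %| l)%N -> coprime l a ->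
  assoc (\prod_(0 <= b < l | (p %| b)%N) (q ^+ a - q ^+ b)) (unif p).
Proof.
move=> pr pl la; have p0 := prime_gt0 pr.
have -> : \prod_(0 <= b < l | (p %| b)%N) (q ^+ a - q ^+ b) =
    \prod_(0 <= s < l %/ p) (q ^+ a - (q ^+ p) ^+ s).
  rewrite -big_filter (perm_big [seq (p * s)%N | s <- index_iota 0 (l %/ p)]).
    by rewrite big_map; apply: eq_bigr => s _; rewrite exprM.
  apply: uniq_perm; rewrite ?filter_uniq ?iota_uniq //.
    rewrite map_inj_uniq ?iota_uniq // => s t /eqP.
    by rewrite eqn_pmul2l // => /eqP.
  move=> b; rewrite mem_filter mem_index_iota; apply/andP/mapP.
    case=> pb bl; exists (b %/ p)%N; last by rewrite mulnC divnK.
    by rewrite mem_index_iota ltn_divRL // divnK.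
  case=> s; rewrite mem_index_iota => /andP[_ sl] ->.
  by rewrite dvdn_mulr // mulnC -ltn_divRL.
have qpP : (l %/ p).-primitive_root (q ^+ p).
  by have := exp_prim_root qP p; rewrite (gcdn_idPl pl).
have := congr1 (fun u => u.[q ^+ a]) (factor_Xn_sub_1 qpP).
rewrite horner_prod !hornerE -exprM mulnC => e.
rewrite (eq_bigr (fun s => ('X - ((q ^+ p) ^+ s)%:P).[q ^+ a])) => [|b _]; last by rewrite !hornerE.
rewrite e; apply: (@assoc_trans (1 - q ^+ (l %/ p * a))).
  by rewrite -opprB; apply: assocN.
by apply: assoc_unif_exp => //; rewrite coprime_sym; apply: coprime_dvdl la.
Qed.

(** Both primes divide [b] and [l] but not [a], so [q ^+ b / q ^+ a] has powers that are primitive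
    roots of order [p] and of order [p']. *)
Lemma unif_multi a b p p' : (a < l)%N -> coprime l a -> prime p -> prime p' -> p != p' ->
  (p %| l)%N -> (p' %| l)%N -> (p %| b)%N -> (p' %| b)%N -> zunit (q ^+ a - q ^+ b).
Proof.
move=> al la pr pr' pp' pl p'l pb p'b; pose t := (b + (l - a))%N.
have qt : q ^+ a * q ^+ t = q ^+ b.
  by rewrite -exprD /t addnCA subnKC 1?ltnW // exprD (prim_expr_order qP) mulr1.
have -> : q ^+ a - q ^+ b = q ^+ a * (1 - q ^+ t) by rewrite mulrBr mulr1 qt.
apply: zunitM; first exact: zunit_q.
have prim s : prime s -> (s %| l)%N -> (s %| b)%N -> s.-primitive_root ((q ^+ t) ^+ (l %/ s)).
  move=> rs sl sb; rewrite -exprM mulnC exprM (prim_root_exp_coprime _ (prim_unif rs sl)).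
  rewrite coprime_sym prime_coprime // /t dvdn_addr // dvdn_subr // 1?ltnW //.
  rewrite -prime_coprime //; exact: coprime_dvdl la.
by apply: (zunit_1sub _ pr pr' pp' (prim p _ _ _) (prim p' _ _ _)); rewrite // sringX ?qZq.
Qed.

(** Each factor is counted once for every prime dividing both [l] and [b]. With two such primes or
    more the factor is a unit, so the overcounting is harmless. *)
Lemma assoc_prod_noncoprime a : (a < l)%N -> coprime l a ->
  assoc (\prod_(0 <= b < l | ~~ coprime l b) (q ^+ a - q ^+ b))
        (\prod_(p <- primes l) unif p).
Proof.
move=> al la; pose x b := q ^+ a - q ^+ b.
apply: (@assoc_trans (\prod_(0 <= b < l) \prod_(p <- primes l | (p %| b)%N) x b)); last first.
  rewrite (exchange_big_dep xpredT) //= big_seq [X in assoc _ X]big_seq.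
  apply: assoc_prod => p; rewrite mem_primes => /and3P[pr _ pl].
  exact: assoc_prod_multiples.
rewrite big_mkcond /=; apply: assoc_prod => b _.
rewrite -big_filter; set c := filter _ _.
have cP p : p \in c -> [/\ prime p, (p %| l)%N & (p %| b)%N].
  by rewrite mem_filter mem_primes => /and4P[-> -> _ ->].
have cu : uniq c by rewrite filter_uniq // primes_uniq.
case: (boolP (coprime l b)) => lb /=.
  rewrite big_seq big1 => [|p /cP[pr pl pb]]; first exact: assoc_refl.
  have : (p %| gcdn l b)%N by rewrite dvdn_gcd pl pb.
  by rewrite (eqP lb) dvdn1 => /eqP p1; rewrite p1 in pr.
have : c != [::].
  have g1 : gcdn l b != 1%N by [].
  have g0 : (0 < gcdn l b)%N by rewrite gcdn_gt0 l0.
  have gg1 : (1 < gcdn l b)%N by rewrite ltn_neqAle eq_sym g1.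
  have := pdiv_dvd (gcdn l b); rewrite dvdn_gcd => /andP[pl pb].
  suff : pdiv (gcdn l b) \in c by case: (c).
  by rewrite mem_filter pb mem_primes pdiv_prime // l0.
case: c cu cP => [|p [|p' c]] // cu cP _.
  by rewrite big_seq1; exact: assoc_refl.
have xu : zunit (x b).
  have [pr pl pb] := cP p (mem_head _ _).
  have [|pr' p'l p'b] := cP p'; first by rewrite !inE eqxx orbT.
  apply: (unif_multi al la pr pr') => //.
  by apply: contraTneq cu => ->; rewrite /= inE eqxx.
apply: (assoc_trans (assoc_unit xu)); apply: assoc_sym.
apply: (@assoc_trans (\prod_(i <- [:: p, p' & c]) 1)).
  by apply: assoc_prod => i _; apply: assoc_unit.
by rewrite big1_eq; exact: assoc_refl.
Qed.

Lemma assoc_unit_row a : (a < l)%N -> coprime l a ->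
  assoc ((\prod_(b <- units | b != a) (q ^+ a - q ^+ b)) * \prod_(p <- primes l) unif p) l%:R.
Proof.
move=> al la; apply: assoc_sym.
apply: (@assoc_trans (\prod_(0 <= b < l | b != a) (q ^+ a - q ^+ b))).
  rewrite (prod_root_diff qP al) mulrC; apply: assoc_sym.
  exists (q ^+ (a * l.-1)) => //; exact: zunit_q.
rewrite (bigID (fun b => coprime l b)) /=; apply: assocM.
  rewrite big_filter_cond (eq_bigl (fun b => coprime l b && (b != a))) => [|b]; last by rewrite andbC.
  exact: assoc_refl.
rewrite (eq_bigl (fun b => ~~ coprime l b)) => [|b]; first exact: assoc_prod_noncoprime.
by case: eqVneq => // ->; rewrite la.
Qed.

Lemma big_units (F : nat -> K) (P : pred nat) :
  \prod_(b <- units | P b) F b = \prod_(i < r | P (nth 0%N units i)) F (nth 0%N units i).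
Proof. by rewrite (big_nth 0%N) size_units big_mkord. Qed.

(** The squared Vandermonde determinant is, up to sign, the product of the differences over all
    ordered pairs of distinct conjugates. *)
Lemma assoc_det_gram : assoc (\det (V^T *m V))
  (\prod_(a <- units) \prod_(b <- units | b != a) (q ^+ a - q ^+ b)).
Proof.
rewrite det_mulmx det_tr /V det_tr det_Vandermonde.
rewrite big_units.
pose x (i j : 'I_r) := conjq i - conjq j.
have -> : \prod_(i < r) \prod_(b <- units | b != nth 0%N units i) (q ^+ nth 0%N units i - q ^+ b) =
    \prod_(i < r) \prod_(j < r | j != i) x i j.
  apply: eq_bigr => i _; rewrite big_units; apply: eq_bigl => j.
  by rewrite nth_uniq ?size_units ?units_uniq.
have -> : \prod_(i < r) \prod_(j < r | j != i) x i j =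
    \prod_(i < r) \prod_(j < r | (i < j)%N) x i j * \prod_(i < r) \prod_(j < r | (j < i)%N) x i j.
  rewrite -big_split; apply: eq_bigr => i _ /=.
  rewrite (bigID (fun j : 'I_r => (i < j)%N)) /=; congr (_ * _); apply: eq_bigl => j.
    by rewrite -val_eqE; case: ltngtP.
  by rewrite -val_eqE; case: ltngtP.
apply: assocM.
  apply: assoc_prod => i _; apply: assoc_prod => j _; rewrite !mxE -opprB; exact: assocN.
rewrite [X in assoc _ X](exchange_big_dep xpredT) //=.
by apply: assoc_prod => i _; apply: assoc_prod => j _; rewrite !mxE; exact: assoc_refl.
Qed.

(* The factors [q^a - q^b] that are not units of [Z[q]] come from prime power orders. *)
Lemma cyclo_disc : exists s : bool,
  \det (V^T *m V) * (\prod_(p <- primes l) p ^ (r %/ p.-1))%:R = (-1) ^+ s * (l ^ r)%:R.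
Proof.
have [n nE] : exists n : int, \det (V^T *m V) = n%:~R.
  apply/int_ringP; apply: rpred_sum => s _; rewrite rpredM ?rpredX ?rpredN ?rpred1 //.
  apply: rpred_prod => i _; have [m [mk _ ->]] := cyclo_trace_form i (s i).
  by apply: rpred_sum => a _; exact: mk.
have key : assoc (\det (V^T *m V) * (\prod_(p <- primes l) p ^ (r %/ p.-1))%:R) (l ^ r)%:R.
  apply: (@assoc_trans (\prod_(a <- units)
     ((\prod_(b <- units | b != a) (q ^+ a - q ^+ b)) * \prod_(p <- primes l) unif p))).
    rewrite big_split /=; apply: assocM; first exact: assoc_det_gram.
    rewrite natr_prod exchange_big /= big_seq [X in assoc _ X]big_seq.
    apply: assoc_prod => p; rewrite mem_primes => /and3P[pr _ pl].
    rewrite big_units prodr_const card_ord natrX.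
    (* Needed for the [r] factors [unif p] to group into blocks of length [p - 1], each associated
       to [p]. *)
    have pr1 : (p.-1 %| r)%N.
      rewrite /r totientE // (bigD1_seq p) ?primes_uniq ?mem_primes ?pr ?l0 //=.
      by rewrite -mulnA dvdn_mulr.
    by rewrite -[X in assoc _ (_ ^+ X)](divnK pr1) mulnC exprM; apply/assocX/assoc_unif_prime.
  rewrite natrX -(card_ord r) -prodr_const big_units; apply: assoc_prod => i _.
  by have [] := nth_units i; exact: assoc_unit_row.
move: key; rewrite nE [(\prod_(_ <- _) _)%:R]pmulrn [(l ^ r)%:R]pmulrn -intrM => /assoc_int e.
have [] : n * (\prod_(p <- primes l) p ^ (r %/ p.-1))%N%:Z = (l ^ r)%N%:Z \/
   n * (\prod_(p <- primes l) p ^ (r %/ p.-1))%N%:Z = - (l ^ r)%N%:Z.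
  by move: e; move: (n * _) (l ^ r)%N => u v; lia.
- by move->; exists false; rewrite mul1r.
- by move->; exists true; rewrite mulrNz mulN1r.
Qed.

End CyclotomicDiscriminant.

(** * The center of a division ring *)

Section Center.
Variable F : unitRingType.

Definition centerp : {pred F} := fun x => `[< central x >].

Lemma centerP x : reflect (central x) (x \in centerp).
Proof. exact: asboolP. Qed.

Lemma centerp_divring : divring_closed centerp.
Proof.
split.
- by apply/centerP => y; rewrite mul1r mulr1.
- move=> x y /centerP xc /centerP yc; apply/centerP => z.
  by rewrite mulrBl mulrBr xc yc.
- move=> x y /centerP xc /centerP yc; apply/centerP => z.
  by apply/commr_sym/commrM; [|apply: commrV]; apply/commr_sym; [exact: xc|exact: yc].
Qed.

HB.instance Definition _ := GRing.isDivringClosed.Build F centerp centerp_divring.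

(* The proof of [division_ring F] is a parameter so that the center carries a field structure. *)
Record center (divF : division_ring F) := Center { cval :> F; _ : cval \in centerp }.

Section Instances.
Variable divF : division_ring F.
Notation Z := (center divF).

HB.instance Definition _ := [isSub for @cval divF].
HB.instance Definition _ := [Choice of Z by <:].
HB.instance Definition _ := [SubChoice_isSubUnitRing of Z by <:].

Lemma center_mulC : commutative (@GRing.mul Z).
Proof. by move=> x y; apply: val_inj; apply: (centerP _ (valP x)). Qed.

HB.instance Definition _ := GRing.PzRing_hasCommutativeMul.Build Z center_mulC.

Lemma center_fieldP (x : Z) : x != 0 -> x \is a GRing.unit.
Proof.
move=> x0; have vx : val x \is a GRing.unit.
  by apply: divF; apply: contraNneq x0 => e; apply/eqP/val_inj; rewrite e rmorph0.
have vc : (val x)^-1 \in centerp by rewrite rpredV; exact: valP.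
apply/unitrP; exists (Center divF vc).
by split; apply: val_inj; rewrite rmorphM rmorph1 /= ?mulVr ?mulrV.
Qed.

HB.instance Definition _ := GRing.ComUnitRing_isField.Build Z center_fieldP.

End Instances.
End Center.

Section CenterTheory.
Variables (F : unitRingType) (divF : division_ring F).
Notation Z := (center divF).
Implicit Types (z : Z) (x y : F).

Definition cen x : Z :=
  if pselect (central x) is left h then Center divF (introT (centerP x) h) else 0.

Lemma cenK x : central x -> val (cen x) = x.
Proof. by rewrite /cen; case: pselect. Qed.

Lemma cvalC z : central (val z).
Proof. exact/centerP/valP. Qed.

Lemma cvalM z z' : val (z * z') = val z * val z'. Proof. exact: rmorphM. Qed.
Lemma cvalD z z' : val (z + z') = val z + val z'. Proof. exact: rmorphD. Qed.
Lemma cvalN z : val (- z) = - val z. Proof. exact: rmorphN. Qed.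
Lemma cval0 : val (0 : Z) = 0. Proof. exact: rmorph0. Qed.
Lemma cval1 : val (1 : Z) = 1. Proof. exact: rmorph1. Qed.
Lemma cvalX z n : val (z ^+ n) = val z ^+ n. Proof. exact: rmorphXn. Qed.
Lemma cval_sum (I : Type) (r : seq I) (P : pred I) (G : I -> Z) :
  val (\sum_(i <- r | P i) G i) = \sum_(i <- r | P i) val (G i).
Proof. exact: rmorph_sum. Qed.

Lemma cvalV z : z != 0 -> val z^-1 = (val z)^-1.
Proof.
move=> z0; have vu : val z \is a GRing.unit.
  by apply/unitrP; exists (val z^-1); rewrite -!cvalM mulVf ?divff ?cval1.
by apply: (mulrI vu); rewrite -cvalM divff // cval1 divrr.
Qed.

Lemma cval_exprz z (n : int) : z != 0 -> val (z ^ n) = val z ^ n.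
Proof.
move=> z0; case: n => n; first exact: cvalX.
by rewrite NegzE -!exprz_inv -!exprnP cvalX cvalV.
Qed.

Lemma subring_gen_val (G : F -> Prop) (H : Z -> Prop) z :
  (forall z, H z -> subring_gen G (val z)) -> z \in sring H -> subring_gen G (val z).
Proof.
move=> HG /sringP; elim=> {z} [z /HG //||z _ Gz|z w _ Gz _ Gw|z w _ Gz _ Gw].
- by rewrite cval1; apply: sg_one.
- by rewrite cvalN; apply: sg_opp.
- by rewrite cvalD; apply: sg_add.
- by rewrite cvalM; apply: sg_mul.
Qed.

Lemma central_of_gen (P : F -> Prop) x :
  (forall y, P y -> x * y = y * x) ->
  (forall y, exists a b, [/\ P a, P b, b != 0 & y = a * b^-1]) -> central x.
Proof.
move=> xP frac y; have [a [b [Pa Pb b0 ->]]] := frac y.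
by apply: commrM; [exact: xP|apply/commrV/xP].
Qed.

End CenterTheory.

Arguments cen {F} divF x.

Section Bilinear.
Variables (N : nat) (L : 'M[int]_N).
Implicit Types f g h : 'rV[int]_N.

Lemma bformDl f g h : bform L (f + g) h = bform L f h + bform L g h.
Proof. by rewrite /bform !mulmxDl mxE. Qed.

Lemma bformDr f g h : bform L f (g + h) = bform L f g + bform L f h.
Proof. by rewrite /bform linearD mulmxDr mxE. Qed.

Lemma bformNl f g : bform L (- f) g = - bform L f g.
Proof. by rewrite /bform !mulNmx mxE. Qed.

Lemma bformNr f g : bform L f (- g) = - bform L f g.
Proof. by rewrite /bform linearN mulmxN mxE. Qed.

Lemma bform0r f : bform L f 0 = 0.
Proof. by rewrite /bform trmx0 mulmx0 mxE. Qed.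

Lemma bform0l f : bform L 0 f = 0.
Proof. by rewrite /bform !mul0mx mxE. Qed.

Lemma bformMnl f g n : bform L (f *+ n) g = bform L f g * n%:Z.
Proof. elim: n => [|n IHn]; rewrite ?mulr0n ?bform0l ?mulr0 // mulrS bformDl IHn intS.
by rewrite mulrDr mulr1. Qed.

Lemma bformMnr f g n : bform L f (g *+ n) = bform L f g * n%:Z.
Proof. elim: n => [|n IHn]; rewrite ?mulr0n ?bform0r ?mulr0 // mulrS bformDr IHn intS.
by rewrite mulrDr mulr1. Qed.

Lemma bformE f g : bform L f g = \sum_i \sum_j f 0 i * L i j * g 0 j.
Proof.
rewrite /bform mxE exchange_big; apply: eq_bigr => j _.
by rewrite mxE mulr_suml [g^T _ _]mxE.
Qed.

Lemma bform_ev i j : bform L (ev i) (ev j) = L i j.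
Proof. by rewrite /bform /ev -rowE trmx_delta -colE !mxE. Qed.

Variable l : nat.
Hypotheses (skewL : skew_mod l L) (oddl : odd l).

Lemma bform_skew f g : eqmod l (bform L f g) (- bform L g f).
Proof.
rewrite !bformE exchange_big -sumrN; apply: eqmod_sum => i _.
rewrite -sumrN; apply: eqmod_sum => j _.
have -> : f 0 j * L j i * g 0 i = f 0 j * g 0 i * L j i by ring.
have -> : - (g 0 i * L i j * f 0 j) = f 0 j * g 0 i * - L i j by ring.
exact: eqmodMl.
Qed.

(** Skew-symmetry kills twice the value, and [2] is invertible modulo the odd number [l]. *)
Lemma bform_diag f : eqmod l (bform L f f) 0.
Proof.
have /eqmod_intP[c e] := bform_skew f f; move: e; move: (bform L f f) => x e.
have co : coprimez l%:Z 2 by exact: (etrans (coprimen2 l) oddl).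
rewrite /eqmod eqz_mod_dvd subr0 -(Gauss_dvdzl x co); apply/dvdzP; exists c; lia.
Qed.

End Bilinear.

Lemma mon_uniq (K : fieldType) N (h : 'rV[int]_N -> K) : h 0 = 1 ->
  (forall f g, h (f + g) = h f * h g) -> forall f, h f = mon (fun i => h (ev i)) f.
Proof.
move=> h0 hD f; have hN g : h g * h (- g) = 1 by rewrite -hD subrr.
have hnz g : h g != 0.
  by apply/eqP => e; move/eqP: (hN g); rewrite e mul0r eq_sym oner_eq0.
have hV g : h (- g) = (h g)^-1 by apply: (mulfI (hnz g)); rewrite hN divff.
have hMn g n : h (g *+ n) = h g ^+ n.
  by elim: n => [|n IHn]; rewrite ?mulr0n // mulrS hD IHn exprS.
have hMz g n : h (g *~ n) = h g ^ n.
  case: n => n; first exact: hMn.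
  by rewrite NegzE mulrNz hV -pmulrn hMn exprnN.
have {1}-> : f = \sum_i ev i *~ f 0 i.
  apply/rowP => j; rewrite summxE (bigD1 j) //= big1 ?addr0 => [|i ij].
    by rewrite -scaler_int !mxE !eqxx mulr1 intz.
  by rewrite -scaler_int !mxE (eq_sym j) (negPf ij) mulr0.
rewrite /mon; elim: (index_enum _) => [|i r IHr]; first by rewrite !big_nil.
by rewrite !big_cons hD IHr hMz.
Qed.

(** * Root of unity toric frames *)

Section Scalars.
Variables (F : unitRingType) (divF : division_ring F) (q : F) (l : nat).
Hypotheses (F0 : char0 F) (qc : central q) (qP : l.-primitive_root q) (oddl : odd l).
Notation Z := (center divF).
Let qz : Z := cen divF q.
Notation Zq := (cyclo_ring qz).

Lemma val_qz : val qz = q. Proof. exact: cenK. Qed.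

Lemma center_char0 (n : nat) : n.+1%:R != 0 :> Z.
Proof.
apply: contraNneq (F0 n) => e; have := congr1 val e.
by rewrite rmorph_nat rmorph0 => ->.
Qed.

Lemma qz_prim : l.-primitive_root qz.
Proof.
have l0 := prim_order_gt0 qP.
case/andP: (qP) => _ /forallP qn; rewrite /primitive_root_of_unity l0 /=.
apply/forallP => i; have := qn i; rewrite !unity_rootE => /eqP <-.
by apply/eqP; rewrite -val_qz -cvalX -(inj_eq val_inj) cval1.
Qed.

Lemma qz_neq0 : qz != 0.
Proof. exact: prim_root_neq0 qz_prim. Qed.

Lemma qz_eqmod (a b : int) : eqmod l a b -> qz ^ a = qz ^ b.
Proof.
case/eqmod_intP => c ->; rewrite expfzDr ?qz_neq0 // (mulrC c) -exprz_exp -exprnP.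
by rewrite (prim_expr_order qz_prim) exp1rz mulr1.
Qed.

Lemma qz_eq (a b : int) : qz ^ a = qz ^ b -> eqmod l a b.
Proof.
move=> ab; have l0 : l%:Z != 0 by have := prim_order_gt0 qP; case: (l).
have e : qz ^ (a - b) = 1 by rewrite expfzDr ?qz_neq0 // ab -expfzDr ?qz_neq0 // subrr.
have mo : eqmod l ((a - b) %% l%:Z)%Z (a - b) by rewrite /eqmod modz_mod.
have := qz_eqmod mo; rewrite e; have := modz_ge0 (a - b) l0.
have rl := ltz_pmod (a - b) (_ : 0 < l%:Z); move: mo.
case: ((a - b) %% l%:Z)%Z rl => // n rl mo _; rewrite -exprnP => /eqP.
rewrite -(prim_order_dvd qz_prim) => ln; have nl : (n < l)%N.
  by have := rl _; rewrite ltz_nat; apply; rewrite ltz_nat (prim_order_gt0 qP).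
have n0 : n = 0%N.
  case: n ln nl {rl mo} => // n ln nl.
  by have := dvdn_leq (isT : (0 < n.+1)%N) ln; rewrite leqNgt nl.
by move: mo; rewrite n0 /eqmod eqz_mod_dvd sub0r rpredN -eqz_mod_dvd eq_sym.
Qed.

Lemma zqz (n : int) : qz ^ n \in Zq.
Proof.
have l0 : (0 < l)%N := prim_order_gt0 qP.
have qZ : qz \in Zq by apply: sring_gen.
case: n => n; first by rewrite -exprnP sringX.
rewrite NegzE -exprz_inv -exprnP sringX //.
have -> : qz^-1 = qz ^+ l.-1.
  by apply: (mulfI qz_neq0); rewrite divff ?qz_neq0 // -exprS prednK // (prim_expr_order qz_prim).
by rewrite sringX.
Qed.

Lemma in_ZqP x : in_Zq q x <-> exists2 z, z \in Zq & x = val z.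
Proof.
split=> [[p ->]|[z /(ZqP qz)[p ->] ->]].
  exists (\sum_(i < size p) (p`_i)%:~R * qz ^+ i).
    by rewrite sring_sum // => i _; rewrite sringM ?sring_int ?sringX // sring_gen.
  by rewrite cval_sum; apply: eq_bigr => i _; rewrite cvalM cvalX val_qz rmorph_int.
exists p; rewrite (@horner_coef_wide _ (size p)) ?size_poly // cval_sum.
by apply: eq_bigr => i _; rewrite coef_map cvalM cvalX val_qz rmorph_int.
Qed.

End Scalars.

Section Torus.
Variables (F : unitRingType) (divF : division_ring F) (q : F) (l : nat).
Hypotheses (F0 : char0 F) (qc : central q) (qP : l.-primitive_root q) (oddl : odd l).
Variables (N : nat) (M : 'rV[int]_N -> F) (L : 'M[int]_N).
Hypothesis Mframe : is_frame q l M L.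
Notation Z := (center divF).
Let qz : Z := cen divF q.
Notation Zq := (cyclo_ring qz).
Implicit Types f g h : 'rV[int]_N.

Let qz0 : qz != 0. Proof. exact: qz_neq0 qc qP. Qed.
Let eqmod_qz (a b : int) : eqmod l a b -> qz ^ a = qz ^ b. Proof. exact: qz_eqmod qc qP _ _. Qed.
Let skewL : skew_mod l L. Proof. by case: Mframe. Qed.

Lemma frame_mul f g : M f * M g = val (qz ^ bform L f g) * M (f + g).
Proof. by case: Mframe => _ _ -> _ _; rewrite cval_exprz // val_qz. Qed.

Lemma frame0 : M 0 = 1. Proof. by case: Mframe. Qed.

Lemma cval_unit (z : Z) : z != 0 -> val z \is a GRing.unit.
Proof.
move=> z0; apply/unitrP; exists (val z^-1).
by rewrite -!cvalM mulVf ?divff ?cval1.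
Qed.

Lemma frame_mulN f : M f * M (- f) = 1.
Proof.
rewrite frame_mul subrr frame0 mulr1 bformNr -(cval1 divF) -(expr0z qz).
congr val; apply: eqmod_qz; have := bform_diag skewL oddl f.
by move=> /(eqmodMl (-1)); rewrite mulN1r mulr0.
Qed.

Lemma frame_unit f : M f \is a GRing.unit.
Proof. by apply/unitrP; exists (M (- f)); rewrite -{2}(opprK f) !frame_mulN. Qed.

Lemma frame_neq0 f : M f != 0.
Proof. by apply: contraTneq (frame_unit f) => ->; rewrite unitr0. Qed.

Lemma frame_inv f : M (- f) = (M f)^-1.
Proof. by apply: (mulrI (frame_unit f)); rewrite frame_mulN divrr ?frame_unit. Qed.

Lemma frame_comm f g : M f * M g = val (qz ^ (bform L f g + bform L f g)) * (M g * M f).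
Proof.
rewrite !frame_mul addrC mulrA -cvalM -expfzDr //; congr (val _ * _).
apply: eqmod_qz; rewrite -[X in eqmod _ X](subrK (bform L f g)) addrC.
rewrite -[X in eqmod _ _ X]addrA; apply: eqmodD; first exact/eqxx.
have := bform_skew skewL f g; rewrite subrr => /eqmod_intP[c e].
by apply/eqmod_intP; exists (- c); lia.
Qed.

Lemma frame_pow f n : M f ^+ n = M (f *+ n).
Proof.
elim: n => [|n IHn]; first by rewrite mulr0n frame0.
rewrite exprS IHn frame_mul mulrS bformMnr -[RHS]mul1r -(cval1 divF) -(expr0z qz).
congr (val _ * _); apply: eqmod_qz.
by have /(eqmodMl n%:Z) := bform_diag skewL oddl f; rewrite mulr0 mulrC.
Qed.

Lemma eqmod_mull (a : int) : eqmod l (a * l%:Z) 0.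
Proof. by apply/eqmod_intP; exists a; rewrite add0r. Qed.

(** Moving [M (f *+ l)] past a monomial costs a power of [q] with exponent divisible by [l], and [F]
    consists of fractions of the image of the torus. *)
Lemma frame_central f : central (M (f *+ l)).
Proof.
apply: (central_of_gen (P := in_image q M)); last by case: Mframe.
move=> _ [s [sq ->]]; rewrite mulr_sumr mulr_suml !big_seq; apply: eq_bigr => p /sq.
move=> /(in_ZqP divF qc)[z _ ->]; rewrite mulrA -cvalC -!mulrA; congr (_ * _).
rewrite frame_comm (eqmod_qz (b := 0)) ?expr0z ?cval1 ?mul1r //.
by rewrite bformMnl -mulrDl eqmod_mull.
Qed.

Definition frameY i : Z := cen divF (M (ev i) ^+ l).

Lemma frame_mon f : val (mon frameY f) = M (f *+ l).
Proof.
have cenE g : val (cen divF (M (g *+ l))) = M (g *+ l).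
  by rewrite cenK //; exact: frame_central.
rewrite -[RHS]cenE; congr val.
rewrite (mon_uniq (h := fun g => cen divF (M (g *+ l)))).
- by apply: eq_mon => i; right; rewrite /frameY frame_pow.
- by apply: val_inj; rewrite cenE mul0rn frame0 cval1.
- move=> g h; apply: val_inj; rewrite cvalM !cenE frame_mul mulrnDl.
  rewrite (eqmod_qz (b := 0)) ?expr0z ?cval1 ?mul1r //.
  by rewrite bformMnr eqmod_mull.
Qed.

Lemma frameYE i : val (frameY i) = M (ev i) ^+ l.
Proof. by rewrite /frameY frame_pow cenK //; exact: frame_central. Qed.

Lemma frameY_neq0 i : frameY i != 0.
Proof. by apply: contraNneq (frame_neq0 (ev i *+ l)) => e; rewrite -frame_pow -frameYE e cval0. Qed.

Lemma frame_indep (s : seq (Z * 'rV[int]_N)) : coef_in Zq s ->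
  \sum_(p <- s) val p.1 * M p.2 = 0 -> forall h, \sum_(p <- s | p.2 == h) p.1 = 0.
Proof.
move=> ks s0 h; pose U := undup (map snd s).
pose c g : Z := \sum_(p <- s | p.2 == g) p.1.
have cZ g : c g \in Zq by rewrite /c big_seq_cond sring_sum // => p /andP[/ks].
have [_ _ _ ind _] := Mframe.
have := ind [seq (val (c g), g) | g <- U].
rewrite -map_comp map_id undup_uniq big_map => /(_ isT) ind'.
case: (boolP (h \in U)) => hU; last first.
  rewrite big_seq_cond big1 // => p /andP[ps /eqP ph].
  by case/negP: hU; rewrite -ph mem_undup map_f.
apply: val_inj; rewrite cval0; apply: (ind' _ _ (val (c h), h)); last by rewrite map_f.
  by move=> _ /mapP[g _ ->]; apply/(in_ZqP divF qc); exists (c g).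
rewrite -[RHS]s0 (eq_bigr (fun g => \sum_(p <- s | p.2 == g) val p.1 * M p.2)).
  rewrite (exchange_big_dep xpredT) //=; apply: eq_big_seq => p ps.
  rewrite -big_filter (eq_filter (a2 := pred1 p.2)); last by move=> g; rewrite eq_sym.
  by rewrite filter_pred1_uniq ?undup_uniq ?big_seq1 // mem_undup map_f.
move=> g _; rewrite cval_sum mulr_suml.
by apply: eq_bigr => p /eqP->.
Qed.

Lemma frame_indepY (k0 : subringClosed Z) : (forall c, c \in k0 -> c \in Zq) -> indep k0 frameY.
Proof.
move=> kZ s ks s0 h; have l0 := prim_order_gt0 qP.
have inj : injective (fun g : 'rV[int]_N => g *+ l).
  move=> g g' /rowP e; apply/rowP => i; have := e i.
  by rewrite -!scaler_nat !mxE; apply: mulfI; rewrite pnatr_eq0 -lt0n.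
have := @frame_indep [seq (p.1, p.2 *+ l) | p <- s].
rewrite !big_map => ind.
have {}ind := ind _ _ (h *+ l); rewrite big_map in ind.
rewrite -[RHS]ind.
- by apply: eq_bigl => p /=; rewrite (inj_eq inj).
- by move=> _ /mapP[p /ks/kZ pk ->].
- transitivity (val (msum frameY s)); last by rewrite s0 cval0.
  by rewrite /msum cval_sum; apply: eq_bigr => p _; rewrite cvalM frame_mon.
Qed.

End Torus.

(** * Powers of sums of [q]-commuting elements *)

Lemma prod_1_addZX (K : fieldType) (w : K) n : n.-primitive_root w -> odd n ->
  \prod_(0 <= i < n) (1 + w ^+ i *: 'X) = 1 + 'X^n.
Proof.
move=> wP oddn; have n0 := prim_order_gt0 wP.
have w0 : w != 0.
  by rewrite -unitfE; apply/unitrP; exists (w ^+ n.-1); rewrite -exprS -exprSr prednK // (prim_expr_order wP).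
have vE : w^-1 = w ^+ n.-1.
  by apply: (mulfI w0); rewrite divff // -exprS prednK // (prim_expr_order wP).
have vP : n.-primitive_root w^-1.
  by rewrite vE (prim_root_exp_coprime _ wP) coprimePn.
(* Substituting [- X] in the factorization of [X^n - 1] over the powers of [w^-1] gives the product
   up to a constant; [n] odd fixes the sign, and the value at [0] fixes the constant. *)
have := congr1 (fun p => p \Po (- 'X)) (factor_Xn_sub_1 vP).
rewrite rmorph_prod /= rmorphB /= comp_Xn_poly comp_polyC exprNn -signr_odd oddn mulN1r.
rewrite (eq_bigr (fun i => - (w ^- i)%:P * (1 + w ^+ i *: 'X))) => [|i _]; last first.
  rewrite comp_polyB comp_polyX comp_polyC mulrDr mulr1 mulNr -mul_polyC mulrA -polyCM.
  by rewrite exprVn mulVf ?expf_neq0 // mul1r addrC.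
rewrite big_split /= => e.
have {}e : \prod_(0 <= i < n) - (w ^- i)%:P * \prod_(0 <= i < n) (1 + w ^+ i *: 'X) = - (1 + 'X^n).
  by rewrite e opprD addrC.
pose c := \prod_(0 <= i < n) - (w ^- i).
have cE : \prod_(0 <= i < n) - (w ^- i)%:P = c%:P.
  by rewrite /c rmorph_prod /=; apply: eq_bigr => i _; rewrite polyCN.
rewrite cE in e.
have c1 : c = -1.
  have := congr1 (fun p => p.[0]) e; rewrite !hornerE horner_prod big1 => [|i _]; last by rewrite !hornerE ?mulr0 ?addr0.
  by rewrite expr0n gtn_eqF // addr0 mulr1.
by apply: oppr_inj; rewrite -e c1 polyCN mulN1r.
Qed.

Section TwistedPower.
Variables (F : unitRingType) (divF : division_ring F).
Notation Z := (center divF).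

Lemma cval_comm (t : F) : commr_rmorph (\val : Z -> F) t.
Proof. by move=> z; apply/commr_sym/cvalC. Qed.

(** Evaluation at a possibly noncentral [t] is multiplicative because the coefficients are
    central. *)
Definition evalc t (p : {poly Z}) : F := horner_morph (cval_comm t) p.

Lemma evalcD t p p' : evalc t (p + p') = evalc t p + evalc t p'.
Proof. exact: rmorphD. Qed.
Lemma evalcM t p p' : evalc t (p * p') = evalc t p * evalc t p'.
Proof. exact: rmorphM. Qed.
Lemma evalc1 t : evalc t 1 = 1. Proof. exact: rmorph1. Qed.
Lemma evalcC t z : evalc t z%:P = val z. Proof. exact: horner_morphC. Qed.
Lemma evalcX t : evalc t 'X = t. Proof. exact: horner_morphX. Qed.
Lemma evalcXn t n : evalc t 'X^n = t ^+ n.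
Proof. by rewrite -[in RHS](evalcX t); exact: rmorphXn. Qed.

(** Each factor [u] moved to the left past a polynomial in [t] rescales [t] by [w]. *)
Lemma twisted_pow (u t : F) (w : Z) n : t * u = val w * (u * t) ->
  (u * (1 + t)) ^+ n =
  u ^+ n * evalc t (\prod_(0 <= i < n) (1 + w ^+ i *: 'X)).
Proof.
move=> tu; elim: n => [|n IHn]; first by rewrite big_nil evalc1 mulr1.
have tun m : t * u ^+ m = val (w ^+ m) * (u ^+ m * t).
  elim: m => [|m IHm]; first by rewrite !expr0 cval1 !mul1r mulr1.
  rewrite exprS mulrA tu -!mulrA IHm (mulrA u (val _)) -[u * val _](cvalC (w ^+ m)).
  by rewrite exprS cvalM !mulrA.
have -> : \prod_(0 <= i < n.+1) (1 + w ^+ i *: 'X) =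
    (1 + w ^+ n *: 'X) * \prod_(0 <= i < n) (1 + w ^+ i *: 'X) :> {poly Z}.
  by rewrite big_nat_recr //= mulrC.
rewrite exprS IHn evalcM !mulrA; congr (_ * _).
rewrite evalcD evalc1 -mul_polyC evalcM evalcC evalcX.
rewrite -[LHS]mulrA mulrDl mul1r tun !mulrDr mulr1 exprS -!mulrA; congr (_ + _).
by congr (u * _); rewrite !mulrA (cvalC (w ^+ n)).
Qed.

End TwistedPower.

Section Exchange.
Variables (F : unitRingType) (divF : division_ring F) (q : F) (l : nat).
Hypotheses (F0 : char0 F) (qc : central q) (qP : l.-primitive_root q) (oddl : odd l).
Variables (N : nat) (M : 'rV[int]_N -> F) (L : 'M[int]_N).
Hypothesis Mframe : is_frame q l M L.
Notation Z := (center divF).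
Let qz : Z := cen divF q.
Implicit Types f g h : 'rV[int]_N.

Let qz0 : qz != 0. Proof. exact: qz_neq0 qc qP. Qed.

(* The two terms commute up to a primitive [l]-th root of unity, so all intermediate binomial terms
   vanish. *)
Lemma exchange_pow f b (d : nat) : eqmod l (bform L b f) (- d%:Z) -> coprime l d ->
  (M f + M (f - b)) ^+ l = M (f *+ l) + M ((f - b) *+ l).
Proof.
move=> Lbf ld; pose t := val (qz ^ (- bform L f (- b))) * M (- b).
have Mt : M f * t = M (f - b).
  rewrite /t mulrA -cvalC -mulrA (frame_mul divF qc qP Mframe) mulrA -cvalM.
  by rewrite -expfzDr // addrC subrr expr0z cval1 mul1r.
(* Commuting two frame elements doubles the value of the form. The exponent [d + d] is coprime to
   [l] because [l] is odd and coprime to [d], so [w] is again primitive. *)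
pose w := qz ^+ (d + d).
have tM : t * M f = val w * (M f * t).
  have -> : w = qz ^ (bform L (- b) f + bform L (- b) f).
    rewrite /w exprnP; apply: (qz_eqmod _ qc qP); rewrite bformNl PoszD.
    have /(eqmodMl (-1)) := Lbf; rewrite mulrNN mul1r mulN1r => e.
    by have /eqmod_intP[c ->] := eqmodD e e; apply/eqmod_intP; exists (- c); rewrite mulNr addrK.
  rewrite /t -mulrA (frame_comm divF qc qP oddl Mframe) !mulrA; congr (_ * _).
  by rewrite -[RHS]mulrA -(cvalC (qz ^ (- bform L f (- b)))) -!mulrA [RHS]cvalC -!mulrA; congr (_ * _); rewrite cvalC.
have wP : l.-primitive_root w.
  rewrite /w (prim_root_exp_coprime _ (qz_prim divF qc qP)) addnn -muln2.
  by rewrite coprimeMl coprime_sym ld coprime2n.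
rewrite -Mt -[X in X + _]mulr1 -mulrDr (twisted_pow l tM) (prod_1_addZX wP oddl).
rewrite evalcD evalc1 evalcXn mulrDr mulr1.
have frp := frame_pow divF qc qP oddl Mframe.
congr (_ + _); first exact: frp.
have cl : val (qz ^ (- bform L f (- b))) ^+ l = 1.
  rewrite -cvalX exprnP exprz_exp -(cval1 divF) -(expr0z qz); congr val.
  by apply: (qz_eqmod _ qc qP); rewrite eqmod_mull.
rewrite /t exprMn_comm; last exact: cvalC.
rewrite cl mul1r !frp (frame_mul divF qc qP Mframe) -mulrnDl.
rewrite (qz_eqmod _ qc qP (b := 0)) ?expr0z ?cval1 ?mul1r //.
by rewrite bformMnr eqmod_mull.
Qed.

End Exchange.

(** * Denominators regular modulo integers *)

Section IntegerRegular.
Variables (K : fieldType) (k0 : subringClosed K) (N : nat).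
Implicit Types (Y : 'I_N -> K) (B : 'M[int]_N).

(* [a] stays a nonzerodivisor modulo every positive integer, so that a denominator [a] can be cancelled
   against an integer one. *)
Definition reg Y a := (a != 0 /\ a \in laurent k0 Y) /\ forall (n : nat) z w,
  z \in laurent k0 Y -> w \in laurent k0 Y -> a * z = n.+1%:R * w ->
  exists2 u, u \in laurent k0 Y & z = n.+1%:R * u.

Lemma reg1 Y : reg Y 1.
Proof. by split=> [|n z w _ wL]; rewrite ?oner_neq0 ?sring1 // mul1r => ->; exists w. Qed.

Lemma regM Y a b : reg Y a -> reg Y b -> reg Y (a * b).
Proof.
move=> [[a0 aL] ar] [[b0 bL] br]; split=> [|n z w zL wL]; first by rewrite mulf_neq0 ?sringM.
rewrite -mulrA => e; have [u uL bz] := ar n (b * z) w (sringM bL zL) wL e.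
exact: br bz.
Qed.

Lemma regX Y a n : reg Y a -> reg Y (a ^+ n).
Proof. by move=> ar; elim: n => [|n IHn]; [exact: reg1|rewrite exprS; exact: regM]. Qed.

Section Mutation.
Variables (l : nat) (ex : {set 'I_N}) (Y : 'I_N -> K) (B : 'M[int]_N) (k : 'I_N).
Hypotheses (l1 : (1 < l)%N) (ind : indep k0 Y) (Bgood : good l ex B) (kex : k \in ex).
Let Y' := mutY k Y B.
Let E := exch k Y B.
Let E0 : E != 0. Proof. exact: exch_neq0 l1 _ _ _ ind Bgood kex. Qed.
Let Y0 := indep_neq0 ind.
Let ind' : indep k0 Y'. Proof. by apply: indep_mutY; rewrite ?(good_diag Bgood). Qed.
Let Y'0 := indep_neq0 ind'.
Let EY : E \in laurent k0 Y. Proof. exact: exch_laurent. Qed.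
Let EY' : E \in laurent k0 Y'.
Proof. by rewrite /E -(exch_mut Y kex) ?(good_diag Bgood) // exch_laurent. Qed.
Let YY' : Y k * Y' k = E. Proof. exact: exch_mutY. Qed.

(** Up to a unit monomial [E] is [1 + Y^b]; a weight positive on [b] gives integers degree [0], so
    [homog_regular] applies with an integer as modulus. *)
Lemma reg_exch : reg Y E.
Proof.
split=> // n z w zL wL; rewrite /E exchE // => e.
have [u wt] := good_weight1 Bgood l1 kex.
have hr := homog_mon ind u (colv k B) (rpred1 k0); rewrite mul1r in hr.
have hd : homog k0 Y u 0 n.+1%:R by apply: homog_coef => //; apply: rpred_nat.
apply: (homog_regular ind wt hr hd zL (z := mon Y (negv (colv k B)) * w)).
  by rewrite sringM ?laurent_mon.
apply: (mulfI (mon_neq0 Y0 (- negv (colv k B)))); rewrite mulrA e.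
by rewrite [RHS]mulrCA [mon _ (- _) * (_ * _)]mulrA -monD // addNr mon0 mul1r.
Qed.

Lemma laurent_mut_loc a : a \in laurent k0 Y' -> exists m, E ^+ m * a \in laurent k0 Y.
Proof.
apply: laurent_loc => //; first by move=> c; apply: laurent_coef.
move=> i; exists 1; rewrite expr1; have [->|ik] := eqVneq i k; last first.
  by rewrite /Y' mutYNk // !sringM ?laurent_var ?laurent_varV.
have -> : Y' k = (Y k)^-1 * E by rewrite -YY' mulKf.
split; first by rewrite !sringM ?laurent_varV.
by rewrite invfM invrK mulrCA divff // mulr1 laurent_var.
Qed.

Lemma laurent_mut_loc' a : a \in laurent k0 Y -> exists m, E ^+ m * a \in laurent k0 Y'.
Proof.
apply: laurent_loc => //; first by move=> c; apply: laurent_coef.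
move=> i; exists 1; rewrite expr1; have [->|ik] := eqVneq i k; last first.
  by rewrite -(mutYNk Y B ik) !sringM ?laurent_var ?laurent_varV.
have -> : Y k = (Y' k)^-1 * E by rewrite -YY' mulrC mulfK.
split; first by rewrite !sringM ?laurent_varV.
by rewrite invfM invrK mulrCA divff // mulr1 laurent_var.
Qed.

(** Inverting [E] identifies the two Laurent rings. A division by an integer in the ring of [Y']
    therefore transfers to [Y] after multiplication by a power of [E], and that power is itself
    regular. *)
Lemma reg_mut a : reg Y' a -> exists m, reg Y (E ^+ m * a).
Proof.
case=> [[a0 aY'] ar]; have [m Em] := laurent_mut_loc aY'; exists m.
split=> [|n z w zL wL e]; first by rewrite mulf_neq0 ?expf_neq0.
have [r zr] := laurent_mut_loc' zL; have [s ws] := laurent_mut_loc' wL.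
have [|||u uL zE] := ar n (E ^+ m * E ^+ s * (E ^+ r * z)) (E ^+ r * (E ^+ s * w)).
- by rewrite sringM // sringM ?sringX.
- by rewrite sringM ?sringX.
- have -> : a * (E ^+ m * E ^+ s * (E ^+ r * z)) = E ^+ r * E ^+ s * (E ^+ m * a * z) by ring.
  by rewrite e; ring.
have [t ut] := laurent_mut_loc uL.
have [_ Er] := regX (t + m + s + r) reg_exch.
apply: (Er n z (E ^+ t * u)) => //.
by rewrite mulrCA -zE !exprD; ring.
Qed.

End Mutation.
End IntegerRegular.

Section TorusRing.
Variables (F : unitRingType) (divF : division_ring F) (q : F) (l : nat).
Hypotheses (F0 : char0 F) (qc : central q) (qP : l.-primitive_root q) (oddl : odd l).
Notation Z := (center divF).
Let qz : Z := cen divF q.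
Notation Zq := (cyclo_ring qz).
Variable N : nat.
Implicit Types (M : 'rV[int]_N -> F) (L B : 'M[int]_N).

Definition torus_gens M x := (exists2 z, z \in Zq & x = val z) \/ exists f, x = M f.
Notation torus M := (sring (torus_gens M)).

Lemma torus_scalar M z : z \in Zq -> val z \in torus M.
Proof. by move=> zZ; apply: sring_gen; left; exists z. Qed.

Lemma torus_mon M f : M f \in torus M.
Proof. by apply: sring_gen; right; exists f. Qed.

Lemma torusP M L x : is_frame q l M L -> x \in torus M ->
  exists2 s : seq (Z * 'rV[int]_N), coef_in Zq s & x = \sum_(p <- s) val p.1 * M p.2.
Proof.
move=> Mfr /sringP; elim=> {x} [x [[z zZ ->]|[f ->]]||x _|x y _ + _|x y _ + _].
- exists [:: (z, 0)]; first by move=> p; rewrite inE => /eqP->.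
  by rewrite big_seq1 (frame0 Mfr) mulr1.
- exists [:: (1, f)]; first by move=> p; rewrite inE => /eqP->; apply: sring1.
  by rewrite big_seq1 cval1 mul1r.
- exists [:: (1, 0)]; first by move=> p; rewrite inE => /eqP->; apply: sring1.
  by rewrite big_seq1 (frame0 Mfr) cval1 mul1r.
- case=> s ks ->; exists [seq (- p.1, p.2) | p <- s] => [p /mapP[r /ks kr ->]|].
    by rewrite sringN.
  by rewrite big_map -sumrN; apply: eq_bigr => p _; rewrite cvalN mulNr.
- move=> [s ks ->] [s' ks' ->]; exists (s ++ s') => [p|].
    by rewrite mem_cat => /orP[/ks|/ks'].
  by rewrite big_cat.
- move=> [s ks ->] [s' ks' ->].
  exists [seq (p.1 * r.1 * qz ^ bform L p.2 r.2, p.2 + r.2) | p <- s, r <- s'] => [p|].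
    case/allpairsP => -[a b] /= [/ks ka /ks' kb ->].
    by rewrite sringM ?sringM // (zqz divF qc qP).
  rewrite big_allpairs_dep mulr_suml; apply: eq_bigr => p _.
  rewrite mulr_sumr; apply: eq_bigr => r _.
  rewrite -[RHS]/(val (p.1 * r.1 * qz ^ bform L p.2 r.2) * M (p.2 + r.2)).
  rewrite !cvalM -!mulrA -(frame_mul divF qc qP Mfr); congr (_ * _).
  by rewrite !mulrA cvalC.
Qed.

(* A monomial is, up to a power of [q], a product of variables and their inverses. *)
Lemma frame_sign_ind M L (P : F -> Prop) (f : 'rV[int]_N) : is_frame q l M L ->
  (forall x y, P x -> P y -> P (x * y)) -> (forall n : int, P (val (qz ^ n))) ->
  (forall j, 0 < f 0 j -> P (M (ev j))) -> (forall j, f 0 j < 0 -> P (M (- ev j))) -> P (M f).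
Proof.
move=> Mfr PM Pq Ppos Pneg; have qz0 := qz_neq0 divF qc qP.
have PD g h : P (M g) -> P (M h) -> P (M (g + h)).
  move=> Pg Ph; have -> : M (g + h) = val (qz ^ (- bform L g h)) * (M g * M h).
    rewrite (frame_mul divF qc qP Mfr) mulrA -cvalM -expfzDr // addNr.
    by rewrite expr0z cval1 mul1r.
  exact: (PM _ _ (Pq _) (PM _ _ Pg Ph)).
have P0 : P (M 0) by rewrite (frame0 Mfr) -(cval1 divF) -(expr0z qz).
have PMn g n : P (M g) -> P (M (g *+ n)).
  by move=> Pg; elim: n => [|n IHn]; rewrite ?mulr0n // mulrS; apply: PD.
have -> : f = \sum_i ev i *~ f 0 i.
  apply/rowP => j; rewrite summxE (bigD1 j) //= big1 ?addr0 => [|i ij].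
    by rewrite -scaler_int !mxE !eqxx mulr1 intz.
  by rewrite -scaler_int !mxE (eq_sym j) (negPf ij) mulr0.
apply: (big_ind (fun g => P (M g))) => // i _; have := Ppos i; have := Pneg i.
case: (f 0 i) => [[|n]|n] neg pos; first by rewrite mulr0z.
  exact/PMn/pos.
by rewrite NegzE mulrNz -mulNrz; exact/PMn/neg.
Qed.

Lemma frame_gen_ind M L (P : F -> Prop) (f : 'rV[int]_N) : is_frame q l M L ->
  (forall x y, P x -> P y -> P (x * y)) -> (forall n : int, P (val (qz ^ n))) ->
  (forall j, f 0 j != 0 -> P (M (ev j)) /\ P (M (- ev j))) -> P (M f).
Proof.
move=> Mfr PM Pq Pev; apply: (frame_sign_ind Mfr) => // j fj; have [] := Pev j => //.
  by rewrite gt_eqF.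
by rewrite lt_eqF.
Qed.

Section Seeds.
Variables (ex : {set 'I_N}) (k : 'I_N) (M M' : 'rV[int]_N -> F) (L L' B : 'M[int]_N).
Hypotheses (Mfr : is_frame q l M L) (M'fr : is_frame q l M' L') (kex : k \in ex).
Variable d : 'I_N -> nat.
Hypotheses (cp : compatible_with l ex L B d) (co : forall i, i \in ex -> coprime l (d i)).
Hypothesis M'j : forall j, j != k -> M' (ev j) = M (ev j).
Hypothesis M'k : M' (ev k) = M (- ev k + posv (colv k B)) + M (- ev k - negv (colv k B)).
Let Y := frameY divF l M.
Let Y' := frameY divF l M'.
Let Bgood : good l ex B. Proof. by exists L, d. Qed.

Lemma bform_col g : eqmod l (bform L (colv k B) g) (g 0 k * (d k)%:Z).
Proof.
have -> : g 0 k * (d k)%:Z = \sum_i g 0 i * (if i == k then (d k)%:Z else 0).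
  by rewrite (bigD1 k) //= eqxx big1 ?addr0 // => i /negPf->; rewrite mulr0.
rewrite bformE exchange_big; apply: eqmod_sum => i _.
rewrite (eq_bigr (fun m => g 0 i * (B m k * L m i))) => [|m _]; last by rewrite mxE mulrC.
by rewrite -mulr_sumr; apply: eqmodMl; have [_ _] := cp; apply.
Qed.

(** The exponents of the two terms of [M' (ev k)] differ by [b^k], and the first has entry [-1] at
    [k], so compatibility gives the form value [- d k]; since [d k] is coprime to [l], the [l]-th
    power is additive on these terms. *)
Lemma mutation_frameY : Y' = mutY k Y B.
Proof.
apply/funext => j; have [->|jk] := eqVneq j k; last first.
  by rewrite mutYNk //; apply: val_inj; rewrite /Y /Y' /frameY M'j.
apply: val_inj; rewrite exchV cvalD !(frame_mon divF qc qP oddl Mfr).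
rewrite (frameYE divF qc qP oddl M'fr) M'k.
set f := - ev k + _; have fb : - ev k - negv (colv k B) = f - colv k B.
  by rewrite /f -[X in _ = _ - X]posv_sub_negv opprD addrA addrK.
rewrite fb; apply: (exchange_pow divF qc qP oddl Mfr (d := d k)); last exact: co.
have := bform_col f; rewrite /f [(_ + _ : 'rV_N) 0 k]mxE posv_colv0 ?(good_diag Bgood) //.
by rewrite !mxE !eqxx addr0 mulN1r.
Qed.

End Seeds.
End TorusRing.

(** * Seeds and mutations *)

Notation torus divF q M := (sring (torus_gens divF q M)).

Section LaurentUnits.
Variables (K : fieldType) (k0 : subringClosed K) (N : nat) (Y : 'I_N -> K).
Hypothesis ind : indep k0 Y.
Let Y0 := indep_neq0 ind.

Lemma laurent_unitV u : u \in laurent k0 Y -> u != 0 -> u^-1 \in laurent k0 Y ->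
  exists c f, [/\ c \in k0, c^-1 \in k0, c != 0 & u = c * mon Y f].
Proof.
move=> uL u0 vL; have [c [f [kc c0 uE]]] := laurent_unit ind uL vL (divff u0).
have [c' [f' [kc' c'0 vE]]] := laurent_unit ind vL uL (mulVf u0).
have e : (c * c') * mon Y (f + f') = 1 * mon Y 0.
  by rewrite mon0 mulr1 monD // mulrACA -uE -vE divff.
have [_ cc'] := mon_inj ind (rpredM kc kc') (rpred1 k0) (mulf_neq0 c0 c'0) e.
exists c, f; split=> //; suff -> : c^-1 = c' by [].
by apply: (mulfI c0); rewrite divff // cc'.
Qed.

Section Edge.
Variables (l : nat) (ex : {set 'I_N}) (B : 'M[int]_N) (k : 'I_N).
Hypotheses (l1 : (1 < l)%N) (Bgood : good l ex B) (kex : k \in ex).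

(** Units are homogeneous for every weight, whereas [1 + Y^b] has nonzero parts in degree [0] and in
    a positive degree. *)
Lemma exch_not_unit v : v \in laurent k0 Y -> exch k Y B * v <> 1.
Proof.
move=> vL; rewrite exchE // -mulrA mulrCA => e.
have bL : 1 + mon Y (colv k B) \in laurent k0 Y by rewrite sringD ?sring1 ?laurent_mon.
have [w wb] := good_weight1 Bgood l1 kex.
have [|d hd] := laurent_unit_homog ind w bL _ e; first by rewrite sringM ?laurent_mon.
have h1 : homog k0 Y w 0 1 by apply: homog_coef => //; apply: rpred1.
have hb := homog_mon ind w (colv k B) (rpred1 k0); rewrite mul1r in hb.
have partD e' : part k0 Y w e' (1 + mon Y (colv k B)) =
    (if 0 == e' then 1 else 0) + (if deg w (colv k B) == e' then mon Y (colv k B) else 0).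
  by rewrite -(homog_part ind _ h1) -(homog_part ind _ hb) /part compD ?sring1 ?laurent_mon.
have := homog_part ind 0 hd; rewrite partD eqxx gt_eqF // addr0.
case: eqP => [d0 _|_ /eqP]; last by rewrite oner_eq0.
have := homog_part ind (deg w (colv k B)) hd; rewrite partD eqxx d0 lt_eqF // add0r.
by move/eqP; rewrite (negPf (mon_neq0 Y0 _)).
Qed.

(** Substituting [E / Y k] for the mutated variable exhibits [E ^ f' 0 k] as a unit of the Laurent
    ring; since [E] is not a unit, the exponent is [0]. *)
Lemma edge_exponent c c' f f' : c \in k0 -> c^-1 \in k0 -> c != 0 ->
  c' \in k0 -> c'^-1 \in k0 -> c' != 0 ->
  c * mon Y f = c' * mon (mutY k Y B) f' -> f = f' /\ f 0 k = 0.
Proof.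
move=> kc kcV c0 kc' kcV' c0' e.
have E0 := exch_neq0 l1 ind Bgood kex.
have unitM a g : a \in k0 -> a * mon Y g \in laurent k0 Y.
  by move=> ka; rewrite sringM ?laurent_mon ?laurent_coef.
rewrite mon_mutY // in e.
set t := c'^-1 * c * mon Y (f - flip k f').
have Et : exch k Y B ^ f' 0 k = t.
  have p0 : c' * mon Y (flip k f') != 0 by rewrite mulf_neq0 ?mon_neq0.
  apply: (mulfI p0); rewrite -mulrA -e /t monB //.
  by field; rewrite c0' mon_neq0.
have tL : t \in laurent k0 Y by rewrite unitM // rpredM.
have t0 : t != 0 by rewrite !mulf_neq0 ?invr_eq0 ?mon_neq0.
have tVL : t^-1 \in laurent k0 Y.
  rewrite /t invfM -monN // unitM // invfM invrK mulrC rpredM //.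
have EL : exch k Y B \in laurent k0 Y by exact: exch_laurent.
have fk : f' 0 k = 0.
  case: (f' 0 k) Et => [[|n]|n] // Et.
    case: (@exch_not_unit (exch k Y B ^+ n / t)); first by rewrite sringM ?sringX.
    by rewrite mulrA -exprS exprnP Et divff.
  case: (@exch_not_unit (exch k Y B ^+ n * t)); first by rewrite sringM ?sringX.
  by rewrite mulrA -exprS -Et NegzE -exprnN mulfV // expf_neq0.
have ff : flip k f' = f'.
  by apply/rowP => i; rewrite mxE; case: eqP => // ->; rewrite fk oppr0.
move: e; rewrite fk expr0z mulr1 ff => e.
have [-> _] := mon_inj ind kc kc' c0 e; by split.
Qed.

End Edge.
End LaurentUnits.

Section Seeds.
Variables (F : unitRingType) (divF : division_ring F) (q : F) (l : nat).
Hypotheses (F0 : char0 F) (qc : central q) (qP : l.-primitive_root q) (oddl : odd l).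
Notation Z := (center divF).
Let qz : Z := cen divF q.
Notation Zq := (cyclo_ring qz).
Variables (N : nat) (ex : {set 'I_N}) (d : 'I_N -> nat).
Hypothesis co : forall i, i \in ex -> coprime l (d i).
Hypothesis l1 : (1 < l)%N.
Implicit Types (S : seed F N) (f g : 'rV[int]_N).

(** The multipliers [d] are common to all seeds, being preserved by mutation; only the form
    changes. *)
Definition seed_ok S := exists L, is_frame q l S.1 L /\ compatible_with l ex L S.2 d.

Notation seedY S := (frameY divF l S.1).

Lemma seed_ok_good S : seed_ok S -> good l ex S.2.
Proof. by case=> L [_ cp]; exists L, d. Qed.

(** A [mutation] comes with its own form for the frame; as [q] has order [l], it agrees modulo [l]
    with the form already at hand. *)
Lemma frame_eqmod (M : 'rV[int]_N -> F) (L L' : 'M[int]_N) i j : is_frame q l M L -> is_frame q l M L' ->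
  eqmod l (L i j) (L' i j).
Proof.
move=> Mfr Mfr'; apply: (qz_eq (divF := divF) qc qP); rewrite -!bform_ev.
apply: val_inj; apply: (mulIr (frame_unit divF qc qP oddl Mfr (ev i + ev j))).
by rewrite -(frame_mul divF qc qP Mfr) -(frame_mul divF qc qP Mfr').
Qed.

Lemma compatible_eqmod (L L' B : 'M[int]_N) : (forall i j, eqmod l (L i j) (L' i j)) ->
  compatible_with l ex L B d -> compatible_with l ex L' B d.
Proof.
move=> LL' [d0 sk cp]; split=> // i j jex.
have := cp i j jex; rewrite /eqmod => /eqP <-; rewrite eq_sym.
by apply: eqmod_sum => k _; apply: eqmodMl.
Qed.

Lemma seed_ok_mut k S S' : seed_ok S -> mutation q l ex k S S' -> seed_ok S'.
Proof.
move=> Sok [kex S2 [L' [fr fr']] _ _]; have [L [Mfr cp]] := Sok.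
have cp' := compatible_eqmod (fun i j => frame_eqmod i j Mfr fr) cp.
exists (mutL k S.2 L'); split=> //; rewrite S2.
by have [+ _] := good_mut (seed_ok_good Sok) kex; apply.
Qed.

Lemma mut_equiv_ok S0 S : seed_ok S0 -> mut_equiv q l ex S0 S -> seed_ok S.
Proof. by move=> S0ok; elim=> // {}S S' k _ IH; exact: seed_ok_mut. Qed.

Lemma mut_equiv_frozen S0 S i : i \notin ex -> mut_equiv q l ex S0 S ->
  S.1 (ev i) = S0.1 (ev i).
Proof.
move=> iex; elim=> // {}S S' k _ IH [kex _ _ Sj _].
by rewrite Sj //; apply: contraNneq iex => ->.
Qed.

(** The consequences of a mutation in a shape that also holds for the reversed edge, as paths in the
    nerve may traverse edges either way. *)
Definition adjacent k S S' := [/\ k \in ex, seedY S' = mutY k (seedY S) S.2,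
  S'.2 = mutB ex k S.2, forall j, j != k -> S'.1 (ev j) = S.1 (ev j)
  & S'.1 (ev k) \in torus divF q S.1].

Section OneSeed.
Variable S : seed F N.
Hypothesis Sok : seed_ok S.
Variable k0 : subringClosed Z.
Hypothesis kZ : forall c, c \in k0 -> c \in Zq.

Lemma seed_indep : indep k0 (seedY S).
Proof. by have [L [Mfr _]] := Sok; exact: (frame_indepY qc qP oddl Mfr). Qed.

End OneSeed.

Lemma mutation_adjacent k S S' : seed_ok S -> mutation q l ex k S S' ->
  adjacent k S S' /\ adjacent k S' S.
Proof.
move=> Sok mut; have S'ok := seed_ok_mut Sok mut.
have [kex S2 _ Sj Sk] := mut; have [L [Mfr cp]] := Sok; have [L' [M'fr cp']] := S'ok.
have Ymut := mutation_frameY divF qc qP oddl Mfr M'fr kex cp co Sj Sk.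
have Bg := seed_ok_good Sok; have Bkk := good_diag Bg kex.
have ind : indep Zq (seedY S) by apply: seed_indep.
split; split=> //.
- by rewrite Sk sringD ?torus_mon.
- rewrite Ymut S2 mutYK //; first exact: (indep_neq0 ind).
  exact: exch_neq0 l1 _ _ _ ind Bg kex.
- by rewrite S2 mutBK.
- by move=> j jk; rewrite Sj.
(* Monomials without index [k] are powers of [q] times products of variables common to both seeds
   and their inverses. *)
- have torus_g g : g 0 k = 0 -> S.1 g \in torus divF q S'.1.
    move=> gk; apply: (frame_gen_ind qc qP (P := fun x => x \in torus divF q S'.1) Mfr).
    + by move=> x y; exact: sringM.
    + by move=> n; rewrite torus_scalar // (zqz divF qc qP).
    + move=> j gj; have jk : j != k by apply: contraNneq gj => ->; rewrite gk.
      have inv1 := frame_inv divF qc qP oddl Mfr (ev j).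
      have inv2 := frame_inv divF qc qP oddl M'fr (ev j).
      by rewrite inv1 -Sj // -inv2; split; exact: torus_mon.
  set b := colv k S.2 in Sk *; set x := S.1 (ev k).
  have mulE g : S.1 (- ev k + g) = val (cen divF q ^ (- bform L g (- ev k))) * S.1 g * x^-1.
    rewrite -(frame_inv divF qc qP oddl Mfr) -mulrA (frame_mul divF qc qP Mfr) mulrA -cvalM.
    by rewrite -expfzDr ?(qz_neq0 divF qc qP) // addNr expr0z cval1 mul1r [g - _]addrC.
  have xu : x \is a GRing.unit := frame_unit divF qc qP oddl Mfr _.
  have x'u : S'.1 (ev k) \is a GRing.unit := frame_unit divF qc qP oddl M'fr _.
  have e : S'.1 (ev k) * x \in torus divF q S'.1.
    rewrite Sk !mulE -mulrDl -mulrA mulVr // mulr1.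
    by rewrite sringD // sringM ?torus_scalar ?(zqz divF qc qP) // torus_g // ?negv_colv0 ?posv_colv0.
  (* The product of the old and the new variable involves common variables only, so the old variable
     is a torus element of the new seed. *)
  have -> : x = S'.1 (- ev k) * (S'.1 (ev k) * x).
    by rewrite (frame_inv divF qc qP oddl M'fr) mulKr.
  by rewrite sringM ?torus_mon.
Qed.

Section Base.
Variable k0 : subringClosed Z.
Hypothesis kZ : forall c, c \in k0 -> c \in Zq.

Lemma torus_laurent S a : seed_ok S -> a \in laurent k0 (seedY S) -> val a \in torus divF q S.1.
Proof.
case=> L [Mfr _] /sringP; elim=> {a} [x [/kZ xZ|[i [->|->]]]||x _|x y _ + _|x y _ + _].
- exact: torus_scalar.
- by rewrite (frameYE divF qc qP oddl Mfr) sringX ?torus_mon.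
- rewrite cvalV ?(frameY_neq0 divF qc qP oddl Mfr) // (frameYE divF qc qP oddl Mfr).
  by rewrite -exprVn -(frame_inv divF qc qP oddl Mfr) sringX ?torus_mon.
- by rewrite cval1 sring1.
- by move=> xT; rewrite cvalN sringN.
- by move=> xT yT; rewrite cvalD sringD.
- by move=> xT yT; rewrite cvalM sringM.
Qed.

(* The quantum torus of [S] with integrally regular central denominators; it stands in for the quantum
   Laurent phenomenon. *)
Definition vset S x := exists2 a, reg k0 (seedY S) a & val a * x \in torus divF q S.1.

Lemma vset_closed S (G : F -> Prop) x : seed_ok S -> (forall y, G y -> vset S y) ->
  x \in sring G -> vset S x.
Proof.
move=> Sok GV xG; pose Q v := exists2 a, reg k0 (seedY S) a & v = val a.
have [|||||v [a ar ->] aT] := @sring_loc F G (torus divF q S.1) Q _ _ _ _ _ x xG.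
- by exists 1; [exact: reg1|rewrite cval1].
- by move=> _ _ [a ar ->] [b br ->]; exists (a * b); [exact: regM|rewrite cvalM].
- by move=> _ [a [[_ aL] _] ->]; exact: torus_laurent.
- by move=> _ y [a _ ->]; exact: cvalC.
- by move=> y /GV[a ar aT]; exists (val a) => //; exists a.
- by exists a.
Qed.

Lemma vset_torus S x : x \in torus divF q S.1 -> vset S x.
Proof. by exists 1; [exact: reg1|rewrite cval1 mul1r]. Qed.

Lemma vset_adjacent k S S' x : seed_ok S -> seed_ok S' -> adjacent k S S' ->
  vset S' x -> vset S x.
Proof.
move=> Sok S'ok [kex Ymut S'2 Sj Sk].
have [L [Mfr _]] := Sok; have [L' [M'fr _]] := S'ok.
have ind := seed_indep Sok kZ; have Bg := seed_ok_good Sok.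
have ind' := seed_indep S'ok kZ.
set Y := seedY S in Ymut ind; set E := exch k Y S.2.
have Ereg : reg k0 Y E := reg_exch l1 ind Bg kex.
have vM y z : vset S y -> vset S z -> vset S (y * z).
  move=> Vy Vz; apply: (@vset_closed S (vset S)) => //; apply: sringM; exact: sring_gen.
have inv f := frame_inv divF qc qP oddl Mfr f.
have inv' f := frame_inv divF qc qP oddl M'fr f.
have mon' f : vset S (S'.1 f).
  apply: (frame_gen_ind qc qP M'fr) => // [n|j _].
    by apply: vset_torus; rewrite torus_scalar // (zqz divF qc qP).
  have [->|jk] := eqVneq j k; last first.
    by rewrite inv' Sj // -inv; split; apply: vset_torus; exact: torus_mon.
  split; first exact: vset_torus.
  exists E => //; have l0 := prim_order_gt0 qP.
  have Yk0 : seedY S' k != 0 by exact: (indep_neq0 ind').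
  have YE : E = Y k * seedY S' k by rewrite Ymut exch_mutY //; exact: (indep_neq0 ind).
  (* The inverse of a noncentral variable is traded for that of its central [l]-th power, which
     equals [Y k / E]; thus only the central denominator [E] appears. *)
  have -> : S'.1 (- ev k) = val (seedY S' k)^-1 * S'.1 (ev k) ^+ l.-1.
    rewrite cvalV // (frameYE divF qc qP oddl M'fr) inv'.
    have xu := frame_unit divF qc qP oddl M'fr (ev k).
    rewrite -exprVn; apply: (mulrI (unitrX l xu)).
    rewrite mulrA exprVn mulrV ?unitrX // mul1r.
    by rewrite -{1}(prednK l0) exprSr mulrK.
  rewrite mulrA -cvalM YE -mulrA mulfV // mulr1.
  by rewrite sringM ?sringX // (torus_laurent Sok) // laurent_var.
case=> a ar aT.
have : vset S (val a * x).
  apply: (@vset_closed S (torus_gens divF q S'.1)) => // y [[z zZ ->]|[f ->]] //.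
  by apply: vset_torus; rewrite torus_scalar.
case=> b br bT; rewrite Ymut in ar.
have [m mr] := reg_mut l1 ind Bg kex ar.
exists (E ^+ m * a * b); first exact: regM.
have -> : E ^+ m * a * b = E ^+ m * (b * a) by rewrite -mulrA [a * b]mulrC.
rewrite !cvalM -!mulrA sringM // (torus_laurent Sok) // sringX //.
by case: Ereg => [[]].
Qed.

Lemma upper_adjacent k S S' a : seed_ok S -> adjacent k S S' ->
  upper k0 ex (seedY S) S.2 a -> upper k0 ex (seedY S') S'.2 a.
Proof.
move=> Sok [kex -> -> _ _].
exact: (upper_mut l1 (seed_indep Sok kZ) (seed_ok_good Sok) kex).
Qed.

Section Path.
Variable Theta : seed F N -> Prop.
Hypothesis Tok : forall S, Theta S -> seed_ok S.

Lemma step_adjacent k S S' : Theta S -> Theta S' ->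
  mutation q l ex k S S' \/ mutation q l ex k S' S -> adjacent k S S' /\ adjacent k S' S.
Proof.
move=> TS TS' [/mutation_adjacent|/mutation_adjacent] h; first exact: h (Tok TS).
by have [] := h (Tok TS').
Qed.

Lemma path_vset S S' x : Theta S -> path_in q l ex Theta S S' -> vset S' x -> vset S x.
Proof.
move=> TS SS'; suff: Theta S' /\ (forall x, vset S' x -> vset S x) by case=> _; apply.
elim: SS' => [|{}S' S'' k _ [TS' IH] TS'' e]; first by split.
split=> // y Vy; have [adj _] := step_adjacent TS' TS'' e.
by apply: IH; apply: vset_adjacent adj Vy; exact: Tok.
Qed.

Lemma path_upper S S' a : Theta S -> path_in q l ex Theta S S' ->
  upper k0 ex (seedY S') S'.2 a -> upper k0 ex (seedY S) S.2 a.
Proof.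
move=> TS SS'.
suff: Theta S' /\ (forall a, upper k0 ex (seedY S') S'.2 a -> upper k0 ex (seedY S) S.2 a).
  by case=> _; apply.
elim: SS' => [|{}S' S'' k _ [TS' IH] TS'' e]; first by split.
split=> // b Ub; have [_ adj] := step_adjacent TS' TS'' e.
by apply: IH; apply: upper_adjacent adj Ub; exact: Tok.
Qed.

Lemma path_var S S' i : Theta S -> Theta S' -> path_in q l ex Theta S S' ->
  seedY S' i \in laurent k0 (seedY S).
Proof.
move=> TS TS' p; suff: upper k0 ex (seedY S) S.2 (seedY S' i) by case.
apply: (path_upper TS p).
exact: (upper_var l1 _ (seed_indep (Tok TS') kZ) (seed_ok_good (Tok TS'))).
Qed.

End Path.
End Base.
End Seeds.

(** * The trace form of the quantum torus *)

(** A system of representatives of [Z^N] modulo [l Z^N]. *)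
Definition residue_box (l N : nat) (bx : 'I_(l ^ N) -> 'rV[int]_N) :=
  (forall g : 'rV[int]_N, exists f h, g = bx f + h *+ l) /\
  (forall f f' h, bx f = bx f' + h *+ l -> f = f').

Lemma residue_box_exists l N : (0 < l)%N ->
  exists2 bx, @residue_box l N bx & forall f i, 0 <= bx f 0 i <= l%:Z.
Proof.
move=> l0; have cardE : #|{ffun 'I_N -> 'I_l}| = (l ^ N)%N by rewrite card_ffun !card_ord.
pose bx (f : 'I_(l ^ N)) : 'rV[int]_N :=
  \row_i (enum_val (cast_ord (esym cardE) f) i : nat)%:Z.
have lz : l%:Z != 0 by case: (l) l0.
have addE (f h : 'rV[int]_N) i : (f + h *+ l) 0 i = f 0 i + h 0 i * l%:Z.
  by rewrite mxE -scaler_nat mxE natz mulrC.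
exists bx; last by move=> f i; rewrite mxE lez_nat ltnW ?andbT.
split=> [g|f f' h].
  have lt_mod (i : 'I_N) : (absz (modz (g 0%R i) l%:Z) < l)%N.
    by have := ltz_pmod (g 0 i) (_ : 0 < l%:Z); rewrite ltz_nat => /(_ l0); have := modz_ge0 (g 0 i) lz; lia.
  pose u : {ffun 'I_N -> 'I_l} := [ffun i => Ordinal (lt_mod i)].
  exists (cast_ord cardE (enum_rank u)), (\row_i divz (g 0 i) l%:Z).
  apply/rowP => i; rewrite addE !mxE cast_ordK enum_rankK ffunE /=.
  by rewrite gez0_abs ?modz_ge0 // addrC -divz_eq.
move=> /rowP e; apply: (can_inj (cast_ordK (esym cardE))); apply: enum_val_inj; apply/ffunP => i.
apply: val_inj => /=; have := e i; rewrite addE !mxE.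
move: (enum_val (cast_ord _ f)) (enum_val (cast_ord _ f')) => a b ab.
have := congr1 (fun z => z %% l%:Z)%Z ab.
by rewrite addrC modzMDl !modz_small ?ltz_nat ?ltn_ord // => -[].
Qed.

Section BigTens.
Variables (V : nmodType) (m n : nat).

Lemma big_tens (G : 'I_(m * n) -> V) :
  \sum_b G b = \sum_(f < m) \sum_(i < n) G (mxtens_index (f, i)).
Proof.
rewrite pair_bigA /= (reindex (@mxtens_index m n)) /=; last first.
  by exists (@mxtens_unindex m n) => b _; rewrite ?mxtens_indexK ?mxtens_unindexK.
by apply: eq_bigr => -[].
Qed.

End BigTens.

Lemma det_castmx_sq (K : fieldType) m n (e e' : m = n) (A : 'M[K]_m) :
  \det (castmx (e, e') A) = \det A.
Proof. by case: n / e e' => e'; rewrite (eq_axiomK e') castmx_id. Qed.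

Lemma det_tens1 (K : fieldType) m n (A : 'M[K]_n) : \det (tensmx (1%:M : 'M_m) A) = \det A ^+ m.
Proof.
elim: m => [|m IHm].
  by rewrite expr0; move: (tensmx _ _); rewrite mul0n => B; rewrite det_mx00.
have -> : (1%:M : 'M[K]_m.+1) = block_mx (1%:M : 'M_1) 0 0 (1%:M : 'M_m).
  exact: (@scalar_mx_block K 1 m 1).
rewrite (@tens_block_mx _ m m n n) det_castmx_sq !tens0mx det_ublock IHm.
by rewrite tens_scalar1mx det_castmx_sq exprS.
Qed.

Section Coordinates.
Variables (F : unitRingType) (divF : division_ring F) (q : F) (l : nat).
Hypotheses (F0 : char0 F) (qc : central q) (qP : l.-primitive_root q) (oddl : odd l).
Notation Z := (center divF).
Let qz : Z := cen divF q.
Notation Zq := (cyclo_ring qz).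
Variables (N : nat) (M : 'rV[int]_N -> F) (L : 'M[int]_N).
Hypothesis Mfr : is_frame q l M L.
Variables (k0 : subringClosed Z) (r : nat) (e : 'I_r -> Z).
Hypothesis kZ : forall c, c \in k0 -> c \in Zq.
Hypothesis eb : scalar_basis k0 Zq e.
Notation Y := (frameY divF l M).
Notation lau := (laurent k0 Y).

Section Box.
Variable bx : 'I_(l ^ N) -> 'rV[int]_N.
Hypothesis bxP : residue_box bx.

(** A basis of the quantum torus over the Laurent ring of [l]-th powers. Pairs are indexed as in a
    Kronecker product, so that the Gram matrix is a [tensmx]. *)
Definition tbasis (b : 'I_(l ^ N * r)) : F :=
  val (e (mxtens_unindex b).2) * M (bx (mxtens_unindex b).1).

Lemma tbasisE f i : tbasis (mxtens_index (f, i)) = val (e i) * M (bx f).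
Proof. by rewrite /tbasis mxtens_indexK. Qed.

Let e_in i : e i \in Zq. Proof. by case: eb. Qed.

Lemma mono_coord z f h : z \in Zq -> exists c : 'I_(l ^ N * r) -> Z,
  [/\ forall b, c b \in lau, forall b, (mxtens_unindex b).1 != f -> c b = 0
    & val z * M (bx f + h *+ l) = \sum_b val (c b) * tbasis b].
Proof.
move=> zZ; pose z' := z * qz ^ (- bform L (bx f) (h *+ l)).
have z'Z : z' \in Zq by rewrite sringM // (zqz divF qc qP).
have [_ span _] := eb; have [u uk z'E] := span z' z'Z.
pose c (b : 'I_(l ^ N * r)) :=
  if (mxtens_unindex b).1 == f then u (mxtens_unindex b).2 * mon Y h else 0.
have cE g i : c (mxtens_index (g, i)) = if g == f then u i * mon Y h else 0.
  by rewrite /c mxtens_indexK.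
exists c; split=> [b|b|].
- rewrite /c; case: ifP => _; last exact: sring0.
  by rewrite sringM ?laurent_mon ?laurent_coef.
- by rewrite /c => /negPf->.
rewrite big_tens (bigD1 f) //= [X in _ = _ + X]big1 ?addr0 => [|g gf]; last first.
  by rewrite big1 // => i _; rewrite cE (negPf gf) cval0 mul0r.
have -> : val z * M (bx f + h *+ l) = val z' * M (bx f) * M (h *+ l).
  have {1}-> : z = z' * qz ^ bform L (bx f) (h *+ l).
    by rewrite /z' -[RHS]mulrA -expfzDr ?(qz_neq0 divF qc qP) // addNr expr0z mulr1.
  by rewrite cvalM -!mulrA -(frame_mul divF qc qP Mfr).
rewrite z'E cval_sum !mulr_suml; apply: eq_bigr => i _.
rewrite cE eqxx tbasisE !cvalM (frame_mon divF qc qP oddl Mfr).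
have hc := frame_central divF qc qP oddl Mfr h.
by by rewrite -[LHS]hc !mulrA; congr (_ * _ * _); exact: hc.
Qed.

Lemma torus_coord x : x \in torus divF q M -> exists2 c : 'I_(l ^ N * r) -> Z,
  forall b, c b \in lau & x = \sum_b val (c b) * tbasis b.
Proof.
case/(torusP qc qP Mfr) => s ks ->; elim: s ks => [|p s IHs] ks.
  exists (fun=> 0) => [b|]; first exact: sring0.
  by rewrite big_nil big1 // => b _; rewrite cval0 mul0r.
have [|c cL cE] := IHs; first by move=> u us; apply: ks; rewrite inE us orbT.
have [f [h pE]] := (bxP.1) p.2.
have [c' [c'L _ c'E]] := @mono_coord p.1 f h (ks p (mem_head _ _)).
exists (fun b => c' b + c b) => [b|]; first by rewrite sringD.
rewrite big_cons cE pE c'E -big_split; apply: eq_bigr => b _.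
by rewrite -[LHS]mulrDl; congr (_ * _); rewrite -cvalD.
Qed.

(** Expanding the coefficients produces distinct exponents [bx f + h *+ l] for distinct pairs
    [(f, h)]; at each of them a relation among the [e i] over [k0] remains. *)
Lemma tbasis_indep (c : 'I_(l ^ N * r) -> Z) : (forall b, c b \in lau) ->
  \sum_b val (c b) * tbasis b = 0 -> forall b, c b = 0.
Proof.
move=> cL c0; have ind := frame_indepY qc qP oddl Mfr kZ.
have /fin_all_exists2[s sk sE] b := laurentP ind (cL b).
pose T := (Z * 'rV[int]_N)%type.
pose t := [seq (p.1 * e (mxtens_unindex b).2, bx (mxtens_unindex b).1 + p.2 *+ l)
            | b <- index_enum 'I_(l ^ N * r), p : T <- s b].
have l0 : (0 < l)%N := prim_order_gt0 qP.
have bx_inj f f0 (g h : 'rV[int]_N) :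
    (bx f + g *+ l == bx f0 + h *+ l) = (f == f0) && (g == h).
  apply/eqP/andP => [E|[/eqP-> /eqP->//]].
  have ff : f = f0.
    apply: (bxP.2 _ _ (h - g)); rewrite mulrnBl addrA -E addrK //.
  split; first exact/eqP.
  move: E; rewrite ff => /addrI/rowP E; apply/eqP/rowP => i; have := E i.
  by rewrite -!scaler_nat !mxE; apply: mulfI; rewrite pnatr_eq0 -lt0n.
have tk : coef_in Zq t.
  move=> p /allpairsPdep[b [u [_ us ->]]] /=; rewrite sringM //.
  exact/kZ/(sk b).
have term b (p : T) : val (p.1 * e (mxtens_unindex b).2) *
    M (bx (mxtens_unindex b).1 + p.2 *+ l) = val p.1 * val (mon Y p.2) * tbasis b.
  rewrite (frame_mon divF qc qP oddl Mfr) /tbasis cvalM -!mulrA; congr (_ * _).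
  rewrite [RHS]mulrA (frame_central divF qc qP oddl Mfr) -mulrA; congr (_ * _).
  rewrite addrC (frame_mul divF qc qP Mfr) (qz_eqmod (b := 0) _ qc qP).
    by rewrite expr0z cval1 mul1r.
  by rewrite bformMnl eqmod_mull.
have t0 : \sum_(p <- t) val p.1 * M p.2 = 0.
  rewrite -[RHS]c0 big_allpairs_dep; apply: eq_bigr => b _.
  rewrite sE /msum cval_sum mulr_suml; apply: eq_bigr => p _.
  by rewrite cvalM -term.
move=> b0; rewrite -(mxtens_unindexK b0); case: (mxtens_unindex b0) => f0 i0 {b0}.
suff zero h0 : \sum_(p <- s (mxtens_index (f0, i0)) | p.2 == h0) p.1 = 0.
  by rewrite sE; apply: msum_eq0.
have := frame_indep qc Mfr tk t0 (bx f0 + h0 *+ l).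
rewrite big_mkcond big_allpairs_dep big_tens (bigD1 f0) // [X in _ + X = _]big1 ?addr0 => [|g gf]; last first.
  rewrite big1 // => j _; rewrite big1 // => p _.
  by rewrite mxtens_indexK /= bx_inj (negPf gf).
have [_ _ eind] := eb.
move=> z0; apply: (eind (fun i => \sum_(p <- s (mxtens_index (f0, i)) | p.2 == h0) p.1) _ _ i0) => [j|].
  by rewrite big_seq_cond rpred_sum // => p /andP[/sk].
rewrite -[RHS]z0; apply: eq_bigr => j _; rewrite mulr_suml [LHS]big_mkcond.
by apply: eq_bigr => p _; rewrite mxtens_indexK /= bx_inj eqxx.
Qed.

End Box.
End Coordinates.

(** * Coordinates and traces with central coefficients *)

Section Combinations.
Variables (F : unitRingType) (divF : division_ring F).
Notation Z := (center divF).
Variable R : subringClosed Z.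

(** Column [j] of [A] holds coordinates of [x j]. The entries lie in the field [Z], so base change
    and inversion are ordinary linear algebra although [F] is noncommutative. *)
Definition lcomb n p (y : 'I_n -> F) (A : 'M[Z]_(n, p)) (x : 'I_p -> F) :=
  forall j, x j = \sum_i val (A i j) * y i.

Definition lindep n (y : 'I_n -> F) := forall c : 'I_n -> Z,
  (forall i, c i \in R) -> \sum_i val (c i) * y i = 0 -> forall i, c i = 0.

Lemma lcomb_trans n p s (y : 'I_n -> F) (A : 'M_(n, p)) x (B : 'M_(p, s)) w :
  lcomb y A x -> lcomb x B w -> lcomb y (A *m B) w.
Proof.
move=> xA wB j; rewrite wB.
under eq_bigr => i _ do rewrite xA mulr_sumr.
rewrite exchange_big; apply: eq_bigr => i _.
rewrite mxE cval_sum mulr_suml; apply: eq_bigr => k _.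
by rewrite mulrA -cvalM mulrC.
Qed.

Lemma lcomb_mull n p (y : 'I_n -> F) (A : 'M_(n, p)) x z :
  lcomb y A x -> lcomb (fun i => z * y i) A (fun j => z * x j).
Proof.
move=> xA j; rewrite xA mulr_sumr; apply: eq_bigr => i _.
by rewrite !mulrA cvalC.
Qed.

Lemma lcombZ n p (y : 'I_n -> F) (A : 'M_(n, p)) x z :
  lcomb y A x -> lcomb y (z *: A) (fun j => val z * x j).
Proof.
move=> xA j; rewrite xA mulr_sumr; apply: eq_bigr => i _.
by rewrite mxE cvalM mulrA.
Qed.

Lemma lcomb_sum n p s (y : 'I_n -> F) (A : 'I_s -> 'M_(n, p)) x :
  (forall i, lcomb y (A i) (x i)) -> lcomb y (\sum_i A i) (fun j => \sum_i x i j).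
Proof.
move=> xA j; under eq_bigr do rewrite xA.
rewrite exchange_big; apply: eq_bigr => k _.
by rewrite summxE cval_sum mulr_suml.
Qed.

Lemma lcomb1 n (y : 'I_n -> F) : lcomb y 1%:M y.
Proof.
move=> j; rewrite (bigD1 j) //= big1 ?addr0 => [|i ij].
  by rewrite mxE eqxx cval1 mul1r.
by rewrite mxE (negPf ij) cval0 mul0r.
Qed.

(** Independence over [R] suffices for matrices with entries outside [R] as soon as they have a
    common denominator [a]. *)
Lemma lcomb_uniq n p (y : 'I_n -> F) (A B : 'M_(n, p)) x a : lindep y -> a != 0 ->
  a *: A \is a mxOver R -> a *: B \is a mxOver R -> lcomb y A x -> lcomb y B x -> A = B.
Proof.
move=> yind a0 /mxOverP AR /mxOverP BR xA xB; apply/matrixP => i j.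
apply: (mulfI a0); apply/eqP; rewrite -subr_eq0; apply/eqP.
apply: (yind (fun i => a * A i j - a * B i j)) => [{}i|].
  by have := BR i j; have := AR i j; rewrite !mxE => Aa Bb; rewrite rpredB.
under eq_bigr => k _ do rewrite cvalD cvalN !cvalM mulrBl -!mulrA -mulrBr.
by rewrite -mulr_sumr sumrB -xA -xB subrr mulr0.
Qed.

Lemma mxOver_mul m n p (A : 'M[Z]_(m, n)) (B : 'M_(n, p)) :
  A \is a mxOver R -> B \is a mxOver R -> A *m B \is a mxOver R.
Proof.
move=> /mxOverP AR /mxOverP BR; apply/mxOverP => i j.
by rewrite mxE rpred_sum // => k _; rewrite rpredM.
Qed.

Lemma det_mxOver n (A : 'M[Z]_n) : A \is a mxOver R -> \det A \in R.
Proof.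
move=> /mxOverP AR; apply: rpred_sum => s _.
by rewrite rpredM ?rpredX ?rpredN ?rpred1 // rpred_prod.
Qed.

Lemma adj_mxOver n (A : 'M[Z]_n) : A \is a mxOver R -> \adj A \is a mxOver R.
Proof.
move=> /mxOverP AR; apply/mxOverP => i j.
rewrite mxE /cofactor rpredM ?rpredX ?rpredN ?rpred1 // det_mxOver //.
by apply/mxOverP => a b; rewrite !mxE.
Qed.

(* [Q] need not have entries in [R]: the change of basis takes place over the field [Z]. *)
Lemma lcomb_trace n m (y : 'I_n -> F) (w : 'I_m -> F) x (X : 'M[Z]_n) (W : 'M_m)
    (P : 'M_(n, m)) (Q : 'M_(m, n)) :
  lindep y -> X \is a mxOver R -> W \is a mxOver R -> P \is a mxOver R -> P *m Q = 1%:M -> Q *m P = 1%:M ->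
  lcomb y X (fun i => x * y i) -> lcomb w W (fun i => x * w i) -> lcomb y P w ->
  \tr X = \tr W.
Proof.
move=> yind XR WR PR PQ QP yX wW yP.
have XP : X *m P = P *m W.
  apply: (lcomb_uniq (a := 1) yind (oner_neq0 _)); rewrite ?scale1r; try exact: mxOver_mul.
    exact: lcomb_trans yX (lcomb_mull x yP).
  exact: lcomb_trans yP wW.
rewrite -[X]mulmx1 -PQ mulmxA XP -mulmxA mxtrace_mulC -mulmxA.
by rewrite QP mulmx1.
Qed.

End Combinations.

Section Gram.
Variables (F : unitRingType) (divF : division_ring F) (q : F) (l : nat).
Hypotheses (F0 : char0 F) (qc : central q) (qP : l.-primitive_root q) (oddl : odd l).
Notation Z := (center divF).
Let qz : Z := cen divF q.
Notation Zq := (cyclo_ring qz).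
Variables (N : nat) (M : 'rV[int]_N -> F) (L : 'M[int]_N).
Hypothesis Mfr : is_frame q l M L.
Variables (k0 : subringClosed Z) (r : nat) (e : 'I_r -> Z) (G0 : 'M[Z]_r).
Hypothesis kZ : forall c, c \in k0 -> c \in Zq.
Hypothesis eb : scalar_basis k0 Zq e.
Hypothesis eG : trace_form k0 e G0.
Notation Y := (frameY divF l M).
Notation lau := (laurent k0 Y).
Variable bx : 'I_(l ^ N) -> 'rV[int]_N.
Hypothesis bxP : residue_box bx.
Let one : 'rV[int]_N := const_mx 1.
Notation tb := (tbasis M e bx).

(* The negated box, shifted by [l] so that its exponents are nonnegative when those of [bx] are at
   most [l]. *)
Definition dual_box f : 'rV[int]_N := one *+ l - bx f.
Notation tb' := (tbasis M e dual_box).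

(** [mon Y one] is the product of corresponding elements of the box and its dual, the same for all
    of them, and [l ^ N] is the trace of the identity on the box. *)
Definition gram : 'M[Z]_(l ^ N * r) := ((l ^ N)%:R * mon Y one) *: tensmx 1%:M G0.

Lemma trace_tens1 (m n : nat) (A : 'M[Z]_n) : \tr (tensmx (1%:M : 'M_m) A) = m%:R * \tr A.
Proof.
rewrite /mxtrace big_tens mulr_natl -[in RHS](card_ord m) -sumr_const.
by apply: eq_bigr => f _; apply: eq_bigr => i _; rewrite tensmxE mxE eqxx mul1r.
Qed.

Lemma cval_shuffle (u v w : Z) x y z :
  val u * x * (val v * y) * (val w * z) = val (u * v * w) * (x * y * z).
Proof.
rewrite !cvalM !mulrA -(mulrA _ x) -(cvalC v x) !mulrA; congr (_ * z).
by rewrite -(mulrA _ y) -(cvalC w y) !mulrA -(mulrA _ x) -(cvalC w x) !mulrA.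
Qed.

(** For corresponding box elements the monomials multiply to a central element, and the trace of
    [Z[q]] remains. Otherwise multiplication moves every residue class, so the diagonal vanishes. *)
Lemma tbasis_trace b b' : exists W : 'M[Z]_(l ^ N * r),
  [/\ W \is a mxOver lau, lcomb tb W (fun c => tb b * tb' b' * tb c) & \tr W = gram b b'].
Proof.
case: (mxtens_indexP b) => f i; case: (mxtens_indexP b') => f' i' {b b'}.
rewrite /gram mxE tensmxE mxE !tbasisE.
have e_in j : e j \in Zq by case: eb.
have [<-|ff'] := eqVneq f f'.
  have [m [mk mE ->]] := eG i i'.
  exists (mon Y one *: tensmx 1%:M m); split; last by rewrite mul1r mxtraceZ trace_tens1 mulrA [mon _ _ * _]mulrC.
    apply/mxOverP => a c; case: (mxtens_indexP a) => a1 a2; case: (mxtens_indexP c) => c1 c2.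
    rewrite mxE tensmxE mxE sringM ?laurent_mon ?laurent_coef // rpredM //.
    exact: rpred_nat.
  move=> c; case: (mxtens_indexP c) => g j; rewrite tbasisE big_tens (bigD1 g) //=.
  rewrite [X in _ = _ + X]big1 ?addr0 => [|g' gg']; last first.
    by rewrite big1 // => a _; rewrite mxE tensmxE mxE (negPf gg') mul0r mulr0 cval0 mul0r.
  have EM : M (bx f) * M (dual_box f) = val (mon Y one).
    rewrite (frame_mul divF qc qP Mfr) addrC subrK (frame_mon divF qc qP oddl Mfr).
    rewrite (qz_eqmod (b := 0) _ qc qP) ?expr0z ?cval1 ?mul1r //.
    rewrite bformDr bformNr bformMnr addrC -(addr0 0) eqmodD //; last exact: eqmod_mull.
    have [skewL _ _ _ _] := Mfr.
    have := bform_diag skewL oddl (bx f) => /eqmod_intP[a ->].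
    rewrite add0r -mulNr; exact: eqmod_mull.
  rewrite cval_shuffle EM mulrA -(cvalC (mon Y one)) mE cval_sum mulr_sumr mulr_suml; apply: eq_bigr => a _.
  by rewrite mxE tensmxE mxE eqxx mul1r tbasisE !cvalM !mulrA.
have ex_col g j : exists c : 'I_(l ^ N * r) -> Z, [/\ forall b, c b \in lau,
    c (mxtens_index (g, j)) = 0 &
    val (e i) * M (bx f) * (val (e i') * M (dual_box f')) * tb (mxtens_index (g, j)) =
      \sum_b val (c b) * tb b].
  have [g' [h hE]] := bxP.1 (bx f + dual_box f' + bx g).
  pose z := e i * e i' * e j * qz ^ bform L (bx f) (dual_box f') *
    qz ^ bform L (bx f + dual_box f') (bx g).
  have zZ : z \in Zq by rewrite !sringM // (zqz divF qc qP).
  have [c [cL c0 cE]] := mono_coord qc qP oddl Mfr eb bx g' h zZ.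
  exists c; split=> //.
    apply: c0; rewrite mxtens_indexK /=; apply: contraNneq ff' => gg; apply/eqP.
    apply: (bxP.2 _ _ (h - one)); rewrite mulrnBl.
    have <- : bx f + dual_box f' = h *+ l by apply: (addIr (bx g)); rewrite hE gg addrC.
    suff -> : bx f + dual_box f' - one *+ l = bx f - bx f' by rewrite addrC subrK.
    by rewrite /dual_box addrA addrAC addrK.
  rewrite -cE -hE tbasisE cval_shuffle /z -[RHS]mulrA cvalM -[RHS]mulrA; congr (_ * _).
  by rewrite (frame_mul divF qc qP Mfr) -mulrA (frame_mul divF qc qP Mfr) mulrA -cvalM.
have /fin_all_exists[W WE] c : exists w : 'I_(l ^ N * r) -> Z, [/\ forall b, w b \in lau,
    w c = 0 & val (e i) * M (bx f) * (val (e i') * M (dual_box f')) * tb c =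
      \sum_b val (w b) * tb b].
  by case: (mxtens_indexP c) => g j; exact: ex_col.
exists (\matrix_(a, c) W c a); split.
- by apply/mxOverP => a c; rewrite mxE; have [] := WE c.
- move=> c; have [_ _ ->] := WE c; apply: eq_bigr => a _; by rewrite mxE.
rewrite mul0r mulr0; apply: big1 => c _; rewrite mxE; by have [] := WE c.
Qed.

End Gram.

(** * Comparison with the torus of a seed *)

Lemma common_multiple (K : fieldType) (I : finType) (Q : K -> Prop) (P : I -> K -> Prop) :
  Q 1 -> (forall a b, Q a -> Q b -> Q (a * b)) ->
  (forall i a b, Q a -> P i b -> P i (a * b)) ->
  (forall i, exists2 a, Q a & P i a) -> exists2 a, Q a & forall i, P i a.
Proof.
move=> Q1 QM PM /fin_all_exists2[a Qa Pa]; exists (\prod_i a i) => [|i].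
  by elim/big_ind: _.
by rewrite (bigD1 i) //= mulrC; apply: PM => //; elim/big_ind: _.
Qed.

Section Comparison.
Variables (F : unitRingType) (divF : division_ring F) (q : F) (l : nat).
Hypotheses (F0 : char0 F) (qc : central q) (qP : l.-primitive_root q) (oddl : odd l).
Notation Z := (center divF).
Let qz : Z := cen divF q.
Notation Zq := (cyclo_ring qz).
Variables (N : nat) (M : 'rV[int]_N -> F) (L : 'M[int]_N).
Hypothesis Mfr : is_frame q l M L.
Variables (k0 : subringClosed Z) (r : nat) (e : 'I_r -> Z) (G0 : 'M[Z]_r).
Hypothesis kZ : forall c, c \in k0 -> c \in Zq.
Hypothesis eb : scalar_basis k0 Zq e.
Hypothesis eG : trace_form k0 e G0.
Hypothesis G0nat : exists2 c, c \in k0 & exists n : nat, c * \det G0 = n.+1%:R.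
Notation Y := (frameY divF l M).
Notation lau := (laurent k0 Y).
Variables (C : subringClosed Z) (A : F -> Prop).
Hypothesis kC : forall z, z \in k0 -> z \in C.
Hypothesis YC : forall i, Y i \in C.
Hypothesis CL : forall z, z \in C -> z \in lau.
Hypothesis Areg : forall x, A x -> exists2 a, reg k0 Y a & val a * x \in torus divF q M.

Let ind : indep k0 Y. Proof. exact: (frame_indepY qc qP oddl Mfr kZ). Qed.
Let Y0 := indep_neq0 ind.

Lemma lau_loc u : u \in lau -> exists2 a, (a != 0) /\ a \in C & a * u \in C.
Proof.
apply: (@sring_loc _ _ C (fun a => a != 0 /\ a \in C)).
- by rewrite oner_neq0 rpred1.
- by move=> a b [a0 aC] [b0 bC]; rewrite mulf_neq0 ?rpredM.
- by move=> a [].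
- by move=> a x _; rewrite mulrC.
move=> x [/kC xC|[i [->|->]]].
- by exists 1; rewrite ?mul1r ?oner_neq0 ?rpred1.
- by exists 1; rewrite ?mul1r ?oner_neq0 ?rpred1.
- by exists (Y i); rewrite ?mulfV ?rpred1.
Qed.

Lemma lindep_lau n (y : 'I_n -> F) : lindep C y -> lindep lau y.
Proof.
move=> yind c cL cy.
have [] := @common_multiple Z 'I_n (fun a => a != 0 /\ a \in C) (fun i a => a * c i \in C).
- by rewrite oner_neq0 rpred1.
- by move=> a b [a0 aC] [b0 bC]; rewrite mulf_neq0 ?rpredM.
- by move=> i a b [a0 aC] bC; rewrite -mulrA rpredM.
- by move=> i; apply: lau_loc.
move=> a [a0 _] aC i.
have E : \sum_i val (a * c i) * y i = 0.
  by under eq_bigr do rewrite cvalM -mulrA; rewrite -mulr_sumr cy mulr0.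
by have /eqP := yind (fun i => a * c i) aC E i; rewrite mulf_eq0 (negPf a0) => /eqP.
Qed.

(** Both multiples are Laurent and [a * (n * Q) = n * (a * Q)]; regularity of [a] modulo [n] shows
    that [n * Q] is [n] times a Laurent matrix. *)
Lemma reg_descend n p a (c : nat) (Q : 'M[Z]_(n, p)) : reg k0 Y a ->
  a *: Q \is a mxOver lau -> c.+1%:R *: Q \is a mxOver lau -> Q \is a mxOver lau.
Proof.
move=> [_ ar] /mxOverP aQ /mxOverP cQ; apply/mxOverP => i j.
have [|u uL] := ar c _ _ (cQ i j) (aQ i j); first by rewrite !mxE mulrCA.
by rewrite mxE => /(mulfI (center_char0 divF F0 c))->.
Qed.

Section Box.
Variable bx : 'I_(l ^ N) -> 'rV[int]_N.
Hypothesis bxP : residue_box bx.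
Notation tb := (tbasis M e bx).

Lemma tbasis_lindep : lindep lau tb.
Proof. by move=> c cL c0; exact: (tbasis_indep qc qP oddl Mfr kZ eb bxP cL c0). Qed.

Lemma tbasis_comb n (y : 'I_n -> F) : (forall i, A (y i)) ->
  exists a Q, [/\ reg k0 Y a, a *: Q \is a mxOver lau & lcomb tb Q y].
Proof.
move=> yA.
have /fin_all_exists[c cP] i : exists c : 'I_(l ^ N * r) -> Z,
    lcomb tb (\col_b c b) (fun=> y i) /\
    exists2 a, reg k0 Y a & forall b, a * c b \in lau.
  have [a ar aT] := Areg (yA i); have [[a0 _] _] := ar.
  have [c cL cE] := torus_coord qc qP oddl Mfr eb bxP aT.
  pose c' b := a^-1 * c b; exists c'; split=> [o|]; last first.
    by exists a => // b; rewrite /c' mulVKf.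
  apply: (mulrI (cval_unit a0)); rewrite cE mulr_sumr; apply: eq_bigr => b _.
  by rewrite mxE mulrA -cvalM /c' mulVKf.
have [] := @common_multiple Z 'I_n (reg k0 Y) (fun i a => forall b, a * c i b \in lau).
- exact: reg1.
- exact: regM.
- by move=> i a b [[_ aL] _] bc b'; rewrite -mulrA sringM.
- by move=> i; have [] := cP i.
move=> a ar aL; exists a, (\matrix_(b < l ^ N * r, i < n) c i b); split=> //.
  by apply/mxOverP => b i; rewrite !mxE.
move=> i; have [cE _] := cP i; rewrite (cE ord0); apply: eq_bigr => b _.
by rewrite !mxE.
Qed.

(** Elements of [A] lie in the torus up to regular denominators, so the inverse matrix [Q] exists
    over the field [Z]; two-sided invertibility forces equal sizes. *)
Lemma change_of_basis n (y : 'I_n -> F) (P : 'M[Z]_(n, l ^ N * r)) :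
  (forall i, A (y i)) -> lindep C y -> P \is a mxOver C -> lcomb y P tb ->
  n = (l ^ N * r)%N /\ exists a Q,
    [/\ reg k0 Y a, a *: Q \is a mxOver lau, lcomb tb Q y, P *m Q = 1%:M & Q *m P = 1%:M].
Proof.
move=> yA /lindep_lau yind PC yP; have [a [Q [ar aQ tQ]]] := tbasis_comb yA.
have PL : P \is a mxOver lau by apply/mxOverP => i j; apply/CL/(mxOverP PC).
have [[a0 aL] _] := ar.
have a1 k : a *: 1%:M \is a @mxOver k k _ lau.
  by apply/mxOverP => i j; rewrite !mxE rpredM // rpred_nat.
have PQ : P *m Q = 1%:M.
  apply: (lcomb_uniq yind a0 _ (a1 n) (lcomb_trans yP tQ) (lcomb1 divF _)).
  by rewrite scalemxAr mxOver_mul.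
have QP : Q *m P = 1%:M.
  apply: (lcomb_uniq tbasis_lindep a0 _ (a1 _) (lcomb_trans tQ yP) (lcomb1 divF _)).
  by rewrite scalemxAl mxOver_mul.
split; last by exists a, Q.
by apply/eqP; rewrite eqn_leq (mulmx1_min PQ) (mulmx1_min QP).
Qed.

End Box.

Lemma dual_residue_box (bx : 'I_(l ^ N) -> 'rV[int]_N) : residue_box bx -> residue_box (dual_box bx).
Proof.
case=> [span inj]; rewrite /dual_box; split=> [g|f f' h e'].
  have [f [h gE]] := span (- g); exists f, (- h - const_mx 1).
  by rewrite mulrnBl mulNrn addrC addrA subrK -opprD addrC -gE opprK.
apply/esym/(inj _ _ h).
have := congr1 (fun v => const_mx 1 *+ l - v) e'.
by rewrite subKr opprD addrA subKr => ->; rewrite subrK.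
Qed.

Lemma gram_over (bx : 'I_(l ^ N) -> 'rV[int]_N) : residue_box bx -> gram l M G0 \is a mxOver lau.
Proof.
move=> bxP; apply/mxOverP => b b'.
by have [W [/mxOverP WL _ <-]] := tbasis_trace qc qP oddl Mfr eb eG bxP b b'; rewrite rpred_sum.
Qed.

Lemma det_gram : \det (gram l M G0) =
  ((l ^ N)%:R ^+ (l ^ N * r) * \det G0 ^+ (l ^ N)) * mon Y (const_mx 1 *+ (l ^ N * r)).
Proof. by rewrite detZ det_tens1 exprMn monMn // -!mulrA; congr (_ * _); rewrite mulrC. Qed.

Lemma det_gram_nat : exists a (c : nat), a \in lau /\ a * \det (gram l M G0) = c.+1%:R.
Proof.
have [c ck [n nE]] := G0nat; have l0 : (0 < l)%N := prim_order_gt0 qP.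
set h : 'rV[int]_N := const_mx 1 *+ (l ^ N * r).
have pos : (0 < (l ^ N) ^ (l ^ N * r) * n.+1 ^ (l ^ N))%N by rewrite muln_gt0 !expn_gt0 l0.
exists (c ^+ (l ^ N) * mon Y (- h)), ((l ^ N) ^ (l ^ N * r) * n.+1 ^ (l ^ N)).-1.
split; first by rewrite sringM ?laurent_mon // laurent_coef // rpredX.
rewrite prednK // det_gram -/h natrM !natrX -nE exprMn monN //.
by field; rewrite mon_neq0.
Qed.

Lemma disc_seed (bx : 'I_(l ^ N) -> 'rV[int]_N) (y : 'I_(l ^ N * r) -> F) (P P' : 'M[Z]_(l ^ N * r))
    (X : 'I_(l ^ N * r) -> 'I_(l ^ N * r) -> 'M[Z]_(l ^ N * r)) :
  residue_box bx -> (forall i, A (y i)) -> lindep C y ->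
  P \is a mxOver C -> P' \is a mxOver C ->
  lcomb y P (tbasis M e bx) -> lcomb y P' (tbasis M e (dual_box bx)) ->
  (forall i j, X i j \is a mxOver C) ->
  (forall i j, lcomb y (X i j) (fun b => y i * y j * y b)) ->
  exists c f, [/\ c \in k0, c^-1 \in k0, c != 0 &
    \det (\matrix_(i, j) \tr (X i j)) =
      (c * mon Y f) * ((l ^ N)%:R ^+ (l ^ N * r) * \det G0 ^+ (l ^ N))].
Proof.
set bx' := dual_box _; set m := (l ^ N * r)%N; set T := \matrix_(i, j) _.
move=> bxP yA yind PC PC' yP yP' XC yX.
have [_ [a [Q [ar aQ tQ PQ QP]]]] := change_of_basis bxP yA yind PC yP.
have [_ [a' [Q' [ar' aQ' tQ' PQ' QP']]]] := change_of_basis (dual_residue_box bxP) yA yind PC' yP'.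
have over n p (B : 'M[Z]_(n, p)) : B \is a mxOver C -> B \is a mxOver lau.
  by move=> /mxOverP BC; apply/mxOverP => i j; apply/CL/BC.
have PL := over _ _ _ PC; have PL' := over _ _ _ PC'; have XL i j := over _ _ _ (XC i j).
have tr_over n p (B : 'M[Z]_(n, p)) : B \is a mxOver lau -> B^T \is a mxOver lau.
  by move=> /mxOverP BC; apply/mxOverP => i j; rewrite mxE.
have TL : T \is a mxOver lau.
  by apply/mxOverP => i j; rewrite mxE rpred_sum // => b _; apply: (mxOverP (XL i j)).
set G := gram l M G0; have GL : G \is a mxOver lau := gram_over bxP.
(* The trace of multiplication by a product of dual basis elements, computed once in the basis of
   [A] and once in the torus basis. *)
have GE : P^T *m T *m P' = G.
  apply/matrixP => b b'; have [W [WL tW <-]] := tbasis_trace qc qP oddl Mfr eb eG bxP b b'.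
  pose V := \sum_i \sum_j (P i b * P' j b') *: X i j.
  have yV : lcomb y V (fun k => tbasis M e bx b * tbasis M e bx' b' * y k).
    move=> k; rewrite yP yP' big_distrlr mulr_suml.
    have sV : lcomb y V (fun k => \sum_i \sum_j val (P i b * P' j b') * (y i * y j * y k)).
      by apply: lcomb_sum => i; apply: lcomb_sum => j; apply: lcombZ.
    rewrite -[RHS]sV; apply: eq_bigr => i _; rewrite mulr_suml; apply: eq_bigr => j _.
    by have := cval_shuffle (P i b) (P' j b') 1 (y i) (y j) (y k); rewrite cval1 mul1r mulr1.
  rewrite -(lcomb_trace (lindep_lau yind) _ WL PL PQ QP yV tW yP); last first.
    apply/mxOverP => s t; rewrite summxE rpred_sum // => i _; rewrite summxE rpred_sum // => j _.
    by rewrite mxE !rpredM ?(mxOverP PL) ?(mxOverP PL') ?(mxOverP (XL i j)).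
  have -> : \tr V = \sum_i \sum_j P i b * P' j b' * \tr (X i j).
    rewrite raddf_sum; apply: eq_bigr => i _; rewrite raddf_sum; apply: eq_bigr => j _.
    exact: mxtraceZ.
  rewrite exchange_big mxE; apply: eq_bigr => j _; rewrite mxE mulr_suml.
  by apply: eq_bigr => i _; rewrite !mxE mulrAC.
have QG : Q^T *m G = T *m P' by rewrite -GE !mulmxA -trmx_mul PQ trmx1 mul1mx.
have GQ : G *m Q' = P^T *m T by rewrite -GE -mulmxA PQ' mulmx1.
have [g [c [gL gE]]] := det_gram_nat; rewrite -/G in gE.
have adjL := adj_mxOver GL.
(* [Q^T G = T P'] is Laurent, hence by Cramer's rule so is [\det G *: Q], and [g * \det G] is a
   positive integer; [reg_descend] removes it. *)
have QL : Q \is a mxOver lau.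
  apply: (reg_descend (c := c) ar aQ); rewrite -[Q]trmxK -linearZ; apply: tr_over.
  rewrite -gE -scalerA -[\det G *: _]mul_mx_scalar -mul_mx_adj mulmxA QG.
  apply/mxOverP => i j; rewrite mxE rpredM //; apply/mxOverP: i j.
  by rewrite !mxOver_mul.
have QL' : Q' \is a mxOver lau.
  apply: (reg_descend (c := c) ar' aQ').
  rewrite -gE -scalerA -[\det G *: _]mul_scalar_mx -mul_adj_mx -mulmxA GQ.
  apply/mxOverP => i j; rewrite mxE rpredM //; apply/mxOverP: i j.
  by rewrite !mxOver_mul ?tr_over.
have TE : T = Q^T *m G *m Q' by rewrite QG -mulmxA PQ' mulmx1.
pose u := \det Q * \det Q'; pose v := \det P * \det P'.
have uv : u * v = 1.
  by rewrite mulrACA -det_mulmx QP -det_mulmx QP' !det1 mulr1.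
have u0 : u != 0 by apply: contra_eq_neq uv => ->; rewrite mul0r eq_sym oner_neq0.
have uV : u^-1 = v by rewrite -[RHS](mulKf u0) uv mulr1.
have [||z [f [ck cVk c0 uE]]] := laurent_unitV ind _ u0.
- by rewrite rpredM ?det_mxOver.
- by rewrite uV rpredM ?det_mxOver.
exists z, (f + const_mx 1 *+ m); split=> //.
rewrite TE !det_mulmx det_tr det_gram monD // [z * (_ * _)]mulrA -uE /u.
by rewrite -/m; ring.
Qed.

End Comparison.

(** * Bases over a subring of the center *)

Section Bases.
Variables (F : unitRingType) (divF : division_ring F).
Notation Z := (center divF).
Variables (C : subringClosed Z) (C' A : F -> Prop).
Hypothesis C'P : forall x, C' x <-> exists2 z, z \in C & x = val z.

Lemma basis_lindep B n (y : 'I_n -> F) :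
  is_basis C' A B -> injective y -> (forall i, B (y i)) -> lindep C y.
Proof.
case=> _ _ Bind yinj By c cC c0 i.
pose s := [seq (val (c j), y j) | j <- enum 'I_n].
have := Bind s; rewrite -map_comp map_inj_uniq // enum_uniq => /(_ isT) {}Bind.
have /Bind {}Bind p : p \in s -> C' p.1 /\ B p.2.
  by case/mapP => j _ -> /=; split=> //; apply/C'P; exists (c j).
have s0 : \sum_(p <- s) p.1 * p.2 = 0.
  by rewrite -[RHS]c0 big_map big_enum.
have iS : (val (c i), y i) \in s by apply/mapP; exists i; rewrite ?mem_enum.
by apply: val_inj; have := Bind s0 _ iS; rewrite cval0.
Qed.

Lemma span_comb n (y : 'I_n -> F) (s : seq (F * F)) :
  (forall p, p \in s -> C' p.1 /\ exists i, p.2 = y i) ->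
  exists2 c : 'I_n -> Z, forall i, c i \in C & \sum_(p <- s) p.1 * p.2 = \sum_i val (c i) * y i.
Proof.
elim: s => [_|p s IHs ps].
  exists (fun=> 0) => [i|]; first exact: rpred0.
  by rewrite big_nil big1 // => i _; rewrite cval0 mul0r.
have [|c cC cE] := IHs; first by move=> p' p's; apply: ps; rewrite inE p's orbT.
have [/C'P[z zC pz] [i pi]] := ps p (mem_head _ _).
exists (fun j => (if j == i then z else 0) + c j) => [j|].
  by rewrite rpredD //; case: ifP => // _; rewrite rpred0.
rewrite big_cons cE pz pi.
under [RHS]eq_bigr do rewrite cvalD mulrDl.
have zE : \sum_j val (if j == i then z else 0) * y j = val z * y i.
  by rewrite (bigD1 i) //= eqxx big1 ?addr0 // => j /negPf->; exact: mul0r.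
by rewrite big_split zE.
Qed.

Lemma lcomb_exists n m (y : 'I_n -> F) (x : 'I_m -> F) :
  (forall j, exists2 c : 'I_n -> Z, forall i, c i \in C & x j = \sum_i val (c i) * y i) ->
  exists2 P : 'M_(n, m), P \is a mxOver C & lcomb y P x.
Proof.
move=> /fin_all_exists2[c cC cE]; exists (\matrix_(i, j) c j i).
  by apply/mxOverP => i j; rewrite mxE.
by move=> j; rewrite cE; apply: eq_bigr => i _; rewrite mxE.
Qed.

Lemma fbasis_comb n m (y : 'I_n -> F) (x : 'I_m -> F) :
  is_fbasis C' A y -> (forall j, A (x j)) -> exists2 P : 'M_(n, m), P \is a mxOver C & lcomb y P x.
Proof.
case=> yinj [_ span _] xA; apply: lcomb_exists => j.
by have [s [sP ->]] := span _ (xA j); exact: span_comb.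
Qed.

(* By counting, the finitely many basis elements that occur in the [w b] already form a basis. *)
Lemma finite_basis m (w : 'I_m -> F) : is_free C' A -> (forall b, A (w b)) ->
  (forall n (y : 'I_n -> F) (P : 'M_(n, m)), (forall i, A (y i)) -> lindep C y ->
     P \is a mxOver C -> lcomb y P w -> n = m) ->
  exists y : 'I_m -> F, is_fbasis C' A y.
Proof.
move=> [B Bb] wA rank; have [BA span _] := Bb.
have /fin_all_exists[s sP] b := span _ (wA b).
pose U := undup (flatten [seq map snd (s b) | b <- enum 'I_m]).
have UB x : x \in U -> B x.
  rewrite mem_undup => /flatten_mapP[b _ /mapP[p ps ->]].
  by have [sb _] := sP b; case: (sb p ps).
have size_eq V : uniq V -> (forall x, x \in V -> B x) -> {subset U <= V} -> size V = m.
  move=> uV VB UV; pose y (i : 'I_(size V)) := nth 0 V i.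
  have yV i : y i \in V by rewrite mem_nth.
  have yinj : injective y.
    by move=> i j /eqP; rewrite nth_uniq // => /eqP/val_inj.
  have [|P PC yP] := @lcomb_exists _ _ y w.
    move=> b; have [sb ->] := sP b; apply: span_comb => p ps.
    have [pC pB] := sb p ps; split=> //.
    have pV : p.2 \in V.
      apply: UV; rewrite mem_undup; apply/flatten_mapP; exists b; first by rewrite mem_enum.
      by apply/mapP; exists p.
    have iV : (index p.2 V < size V)%N by rewrite index_mem.
    by exists (Ordinal iV); rewrite /y nth_index.
  apply: (rank _ y P) => // [i|]; first exact/BA/VB.
  by apply: (basis_lindep Bb yinj) => i; exact: VB.
have sU : size U = m by apply: size_eq; rewrite ?undup_uniq.
have BU x : B x -> x \in U.
  move=> Bx; apply/negPn/negP => xU; have := size_eq (x :: U).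
  rewrite /= xU undup_uniq sU => sE.
  suff /eqP : m.+1 = m by rewrite eqn_leq ltnn.
  apply: sE => // [z|z zU]; last by rewrite inE zU orbT.
  by rewrite inE => /orP[/eqP->//|/UB].
exists (fun i : 'I_m => nth 0 U i); split.
  by move=> i j /eqP; rewrite nth_uniq ?undup_uniq ?sU // => /eqP/val_inj.
suff -> : (fun x => exists i : 'I_m, x = nth 0 U i) = B by [].
apply/funext => x; apply/propext; split=> [[i ->]|/BU xU].
  by apply: UB; rewrite mem_nth ?sU.
have iU : (index x U < m)%N by rewrite -sU index_mem.
by exists (Ordinal iU); rewrite nth_index.
Qed.

End Bases.

(** * The discriminant over a nerve *)

Section Nerve.
Variables (F : unitRingType) (divF : division_ring F) (q : F) (l : nat).
Hypotheses (F0 : char0 F) (qc : central q) (qP : l.-primitive_root q) (oddl : odd l).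
Notation Z := (center divF).
Let qz : Z := cen divF q.
Notation Zq := (cyclo_ring qz).
Variables (N : nat) (ex inv : {set 'I_N}) (d : 'I_N -> nat).
Hypothesis co : forall i, i \in ex -> coprime l (d i).
Hypothesis l1 : (1 < l)%N.
Hypothesis exinv : [disjoint ex & inv].
Variables (k0 : subringClosed Z) (r : nat) (e : 'I_r -> Z) (G0 : 'M[Z]_r).
Hypothesis kZ : forall c, c \in k0 -> c \in Zq.
Hypothesis eb : scalar_basis k0 Zq e.
Hypothesis eG : trace_form k0 e G0.
Hypothesis G0nat : exists2 c, c \in k0 & exists n : nat, c * \det G0 = n.+1%:R.
Variables (M : 'rV[int]_N -> F) (Theta : seed F N -> Prop).
Hypothesis Tok : forall S, Theta S -> seed_ok q l ex d S.
Hypothesis Tfrozen : forall S i, Theta S -> i \notin ex -> S.1 (ev i) = M (ev i).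
Hypothesis Tinh : exists S, Theta S.
Hypothesis Tconn : forall S S', Theta S -> Theta S' -> path_in q l ex Theta S S'.
Hypothesis Tedge : forall k, k \in ex ->
  exists S S', [/\ Theta S, Theta S' & mutation q l ex k S S'].
Notation seedY S := (frameY divF l S.1).
Notation A := (A_eps q inv Theta).

(** The base ring seen inside the center; adjoining [k0 = Z[q]] or [k0 = Z] yields [C_eps] or
    [C_Z]. *)
Definition central_gens (z : Z) := z \in k0 \/ gensC l inv Theta (val z).
Notation C := (sring central_gens).

Variable C' : F -> Prop.
Hypothesis C'P : forall x, C' x <-> exists2 z, z \in C & x = val z.

Let inv_ex i : i \in inv -> i \notin ex.
Proof. by move=> iv; apply: contraL iv => /(disjointFr exinv)->. Qed.

Let seedY_val S i : Theta S -> val (seedY S i) = S.1 (ev i) ^+ l.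
Proof. by move=> /Tok[L [Mfr _]]; exact: (frameYE divF qc qP oddl Mfr). Qed.

Let Tind S : Theta S -> indep k0 (seedY S).
Proof. by move=> /Tok Sok; exact: (seed_indep qc qP oddl Sok kZ). Qed.

Lemma central_gensP z : central_gens z -> z \in k0 \/
  exists S, Theta S /\ ((exists j, z = seedY S j) \/ exists2 i, i \in inv & z = (seedY S i)^-1).
Proof.
case=> [zk|[S [TS [[j zE]|[i [iv zE]]]]]]; [by left|right; exists S; split=> //..].
  by left; exists j; apply: val_inj; rewrite zE seedY_val.
have Y0 := indep_neq0 (Tind TS); right; exists i => //; apply: val_inj.
by rewrite zE cvalV // seedY_val.
Qed.

Lemma frozen_seedY S S' i : Theta S -> Theta S' -> i \notin ex -> seedY S i = seedY S' i.
Proof.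
by move=> TS TS' ie; apply: val_inj; rewrite !seedY_val // !Tfrozen.
Qed.

Lemma central_coef z : z \in k0 -> z \in C.
Proof. by move=> zk; apply: sring_gen; left. Qed.

Lemma central_var S i : Theta S -> seedY S i \in C.
Proof.
by move=> TS; apply: sring_gen; right; exists S; split=> //; left; exists i; exact: seedY_val.
Qed.

Lemma central_varV S i : Theta S -> i \in inv -> (seedY S i)^-1 \in C.
Proof.
move=> TS iv; apply: sring_gen; right; exists S; split=> //; right; exists i; split=> //.
by rewrite cvalV ?seedY_val // (indep_neq0 (Tind TS)).
Qed.

(** Variables of other seeds are Laurent by invariance of upper bounds along a path, and the
    inverted variables are frozen, hence belong to every seed. *)
Lemma central_laurent S z : Theta S -> z \in C -> z \in laurent k0 (seedY S).
Proof.
move=> TS; apply: sring_sub => {}z /central_gensP[zk|[S' [TS' [[j ->]|[i iv ->]]]]].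
- exact: laurent_coef.
- exact: (path_var qc qP oddl co l1 kZ Tok j TS TS' (Tconn TS TS')).
- by rewrite (frozen_seedY TS' TS (inv_ex iv)) laurent_varV.
Qed.

Lemma cluster_vset S x : Theta S -> A x -> vset (divF := divF) q l k0 S x.
Proof.
move=> TS /sringP; apply: (vset_closed qc qP oddl kZ (Tok TS)) => {}x; case=> [|->]; last first.
  have qT : val qz \in torus divF q S.1 by rewrite torus_scalar // sring_gen.
  by rewrite cenK // in qT; exact: vset_torus.
case=> S' [TS' xE]; apply: (path_vset qc qP oddl co l1 kZ Tok TS (Tconn TS TS')).
apply: vset_torus; case: xE => [[j ->]|[i [_ ->]]]; first exact: torus_mon.
by have [L [Mfr _]] := Tok TS'; rewrite -(frame_inv divF qc qP oddl Mfr) torus_mon.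
Qed.

Lemma cluster_mul x y : A x -> A y -> A (x * y). Proof. exact: sg_mul. Qed.

Lemma cluster_scalar z : z \in Zq -> A (val z).
Proof. by apply: subring_gen_val => {}z ->; apply: sg_base; right; rewrite cenK. Qed.

Lemma cluster_mon S (f : 'rV[int]_N) : Theta S -> (forall i, 0 <= f 0 i) -> A (S.1 f).
Proof.
move=> TS f0; have [L [Mfr _]] := Tok TS.
apply: (frame_sign_ind qc qP (P := A) Mfr) => [|n|j _|j].
- exact: cluster_mul.
- exact/cluster_scalar/(zqz divF qc qP).
- by apply: sg_base; left; exists S; split=> //; left; exists j.
- by rewrite ltNge f0.
Qed.

Lemma cluster_tbasis S bx b : Theta S -> (forall f i, 0 <= (bx f : 'rV[int]_N) 0 i) ->
  A (tbasis (l := l) S.1 e bx b).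
Proof.
move=> TS bx0; apply: cluster_mul; last exact: cluster_mon.
by apply: cluster_scalar; case: eb.
Qed.

(** Monomials with nonnegative exponents lie in [A], so both dual torus bases can be expressed in a
    basis of [A]. *)
Lemma nonneg_boxes : exists2 bx, @residue_box l N bx &
  forall f i, 0 <= bx f 0 i /\ 0 <= dual_box bx f 0 i.
Proof.
have [bx bxP bx0] := residue_box_exists N (prim_order_gt0 qP).
exists bx => // f i; have /andP[b0 bl] := bx0 f i; split=> //.
by rewrite /dual_box -scaler_nat !mxE mulr1 natz subr_ge0.
Qed.

Lemma basis_exists : is_free C' A ->
  exists y : 'I_(l ^ N * r) -> F, is_fbasis C' A y.
Proof.
have [S TS] := Tinh; have [bx bxP bx0] := nonneg_boxes; have [L [Mfr _]] := Tok TS.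
move=> Afree; apply: (finite_basis C'P (w := tbasis S.1 e bx) Afree) => [b|n y P yA yind PC yP].
  by apply: cluster_tbasis => // f i; case: (bx0 f i).
have [] := change_of_basis qc qP oddl Mfr kZ eb central_coef (fun i => central_var i TS)
  (fun z => central_laurent TS) (fun x => cluster_vset TS) bxP yA yind PC yP.
by [].
Qed.

Section Basis.
Variables (n : nat) (y : 'I_n -> F).
Hypothesis yb : is_fbasis C' A y.

Let yA i : A (y i). Proof. by case: yb => _ [yA _ _]; apply: yA; exists i. Qed.
Let yind : lindep C y.
Proof. by case: yb => yinj B; apply: (basis_lindep C'P B yinj) => i; exists i. Qed.

Lemma basis_rank : n = (l ^ N * r)%N.
Proof.
have [S TS] := Tinh; have [bx bxP bx0] := nonneg_boxes; have [L [Mfr _]] := Tok TS.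
have [|P PC yP] := fbasis_comb C'P (x := tbasis S.1 e bx) yb.
  by move=> b; apply: cluster_tbasis => // f i; case: (bx0 f i).
by have [] := change_of_basis qc qP oddl Mfr kZ eb central_coef (fun i => central_var i TS)
  (fun z => central_laurent TS) (fun x => cluster_vset TS) bxP yA yind PC yP.
Qed.

Let delta : Z := (l ^ N)%:R ^+ (l ^ N * r) * \det G0 ^+ (l ^ N).

Lemma basis_disc : exists D, [/\ D \in C, disc C' y (val D) & forall S, Theta S ->
  exists c f, [/\ c \in k0, c^-1 \in k0, c != 0 & D = c * mon (seedY S) f * delta]].
Proof.
(* The multiplication matrices are fixed before any seed is chosen, so that one and the same [D] is
   compared with all tori. *)
have [X XP] : exists X : 'I_n -> 'I_n -> 'M[Z]_n, forall i j,
    X i j \is a mxOver C /\ lcomb y (X i j) (fun b => y i * y j * y b).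
  have /fin_all_exists[X XP] (ij : 'I_n * 'I_n) : exists X : 'M[Z]_n,
      X \is a mxOver C /\ lcomb y X (fun b => y ij.1 * y ij.2 * y b).
    have [|X] := fbasis_comb C'P (x := fun b => y ij.1 * y ij.2 * y b) yb.
      by move=> b; do 2!apply: cluster_mul => //.
    by exists X.
  by exists (fun i j => X (i, j)) => i j; exact: XP (i, j).
pose T : 'M[Z]_n := \matrix_(i, j) \tr (X i j).
exists (\det T); split.
- apply: det_mxOver; apply/mxOverP => i j; rewrite mxE rpred_sum // => a _.
  by have [/mxOverP] := XP i j.
- exists (fun i j => val (T i j)); split; last first.
    transitivity (\det (map_mx val T)); first by rewrite (det_map_mx val T).
    by congr (\det _); apply/matrixP => i j; rewrite !mxE.
  move=> i j; exists (fun a b => val (X i j a b)); have [/mxOverP XC Xl] := XP i j; split=> //.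
  + by move=> a b; apply/C'P; exists (X i j a b).
  + by rewrite mxE /mxtrace cval_sum.
move=> S TS; have nE := basis_rank.
have [bx bxP bx0] := nonneg_boxes; have [L [Mfr _]] := Tok TS.
have [|P PC yP] := fbasis_comb C'P (x := tbasis S.1 e bx) yb.
  by move=> b; apply: cluster_tbasis => // f i; case: (bx0 f i).
have [|P' PC' yP'] := fbasis_comb C'P (x := tbasis S.1 e (dual_box bx)) yb.
  by move=> b; apply: cluster_tbasis => // f i; case: (bx0 f i).
(* The index types depend on [n], so all data are generalized before [n] is replaced by the rank. *)
clear yb; move: (y) yA yind X XP @T P PC yP P' PC' yP'; clear yA yind.
rewrite nE => w wA wind X XP T P PC wP P' PC' wP'.
exact: (disc_seed F0 qc qP oddl Mfr kZ eb eG G0nat central_coef (fun i => central_var i TS)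
  (fun z => central_laurent TS) (fun x => cluster_vset TS) bxP wA wind PC PC' wP wP'
  (fun i j => (XP i j).1) (fun i j => (XP i j).2)).
Qed.

Lemma delta_neq0 : delta != 0.
Proof.
have [c _ [n' nE]] := G0nat; have l0 := prim_order_gt0 qP.
have det0 : \det G0 != 0.
  by apply: contraNneq (center_char0 divF F0 n') => G00; rewrite -nE G00 mulr0.
rewrite mulf_neq0 ?expf_neq0 // -(prednK (_ : 0 < l ^ N)%N) ?expn_gt0 ?l0 //.
exact: center_char0.
Qed.

Let kunit c := [/\ c \in k0, c^-1 \in k0 & c != 0].

Lemma disc_exponent S0 : Theta S0 -> exists D, [/\ D \in C, disc C' y (val D) &
  exists c (f : 'rV[int]_N),
    [/\ kunit c, forall k, k \in ex -> f 0 k = 0 & D = c * mon (seedY S0) f * delta]].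
Proof.
move=> TS0; have [D [DC Dy DS]] := basis_disc; exists D; split=> //.
have [c [f [ck cV c0 DE]]] := DS _ TS0.
have step k S S' c1 : Theta S -> Theta S' -> adjacent divF q l ex k S S' -> kunit c1 ->
    D = c1 * mon (seedY S) f * delta ->
    f 0 k = 0 /\ exists2 c2, kunit c2 & D = c2 * mon (seedY S') f * delta.
  move=> TS TS' [kex YE _ _ _] [c1k c1V c10] D1; have [c2 [f2 [c2k c2V c20 D2]]] := DS _ TS'.
  have E : c1 * mon (seedY S) f = c2 * mon (mutY k (seedY S) S.2) f2.
    by apply: (mulIf delta_neq0); rewrite -YE -D1 -D2.
  have [ff fk] := edge_exponent (Tind TS) l1 (seed_ok_good co (Tok TS)) kex c1k c1V c10 c2k c2V c20 E.
  by split=> //; exists c2; rewrite ?ff.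
have all S : path_in q l ex Theta S0 S -> Theta S /\ exists2 c', kunit c' & D = c' * mon (seedY S) f * delta.
  elim=> [|{}S S' k _ [TS [c' ck' DE']] TS' SS']; first by split=> //; exists c.
  have [adj _] := step_adjacent divF qc qP oddl co l1 Tok TS TS' SS'.
  by split=> //; have [] := step _ _ _ _ TS TS' adj ck' DE'.
exists c, f; split=> // k kex; have [S [S' [TS TS' SS']]] := Tedge kex.
have [_ [c' ck' DE']] := all _ (Tconn TS0 TS).
have [adj _] := mutation_adjacent divF qc qP oddl co l1 (Tok TS) SS'.
by have [] := step _ _ _ _ TS TS' adj ck' DE'.
Qed.

Lemma path_admissible S0 S i : Theta S0 -> i \notin ex -> path_in q l ex Theta S0 S ->
  Theta S /\ admissible (seedY S0) i (seedY S).
Proof.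
move=> TS0 ie; elim=> [|{}S S' k _ [TS adm] TS' SS'].
  by split=> //; exact: admissible_refl.
have [[kex -> _ _ _] _] := step_adjacent divF qc qP oddl co l1 Tok TS TS' SS'.
split=> //; apply: (admissible_mut (center_char0 divF F0) (Tind TS0) ie) => //.
exact: indep_neq0 (Tind TS).
Qed.

(** Variables of all seeds are admissible at [i], and the inverted ones are frozen with index
    different from [i], so they do not involve [Y i]. *)
Lemma central_nonneg S0 i z : Theta S0 -> i \notin ex :|: inv -> z \in C ->
  exists2 v, possum0 (seedY S0) i v & v * z \in nonneg k0 (seedY S0) i.
Proof.
move=> TS0 ie; apply: (sring_nonneg (Tind TS0)) => {}z /central_gensP[zk|].
  exists 1; first exact: possum01.
  by rewrite mul1r; apply: sring_gen; exists z, 0; rewrite mxE mon0 mulr1.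
move: ie; rewrite inE negb_or => /andP[ie ii].
case=> S [TS [[j ->]|[j ji ->]]].
  by have [_ adm] := path_admissible TS0 ie (Tconn TS0 TS); exact: admissible_nonneg.
exists 1; first exact: possum01.
rewrite mul1r (frozen_seedY TS TS0 (inv_ex ji)); apply: sring_gen; exists 1, (- ev j).
have Y0 := indep_neq0 (Tind TS0).
split; rewrite ?rpred1 ?monN ?mon_ev ?mul1r // !mxE.
suff -> : (i == j) = false by rewrite andbF oppr0.
by apply: contraNF ii => /eqP->.
Qed.

Lemma nerve_disc : exists (a : 'I_N -> nat) D, disc C' y D /\
  eq_units C' D (val delta * \prod_(i in ~: (ex :|: inv)) M (ev i) ^+ (l * a i)).
Proof.
have [S TS] := Tinh; have Y0 := indep_neq0 (Tind TS).
have [D [DC Dy [c [f [[ck cV c0] fex DE]]]]] := disc_exponent TS.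
have fpos i : i \in ~: (ex :|: inv) -> 0 <= f 0 i.
  rewrite inE => ie; have [v v0 vD] := central_nonneg TS ie DC.
  apply: (nonneg_exponent (center_char0 divF F0) (Tind TS) v0 (c := c * delta)).
  - have G0k : G0 \is a mxOver k0.
      apply/mxOverP => a b; have [m [mk _ ->]] := eG a b.
      by rewrite rpred_sum // => b' _; exact: mk.
    by rewrite rpredM // rpredM ?rpredX ?rpred_nat ?det_mxOver.
  - by rewrite mulf_neq0 ?delta_neq0.
  - by rewrite mulrAC -DE.
exists (fun i => absz (f 0 i)), (val D); split=> //.
(* The invertible frozen variables are units of the base ring and are absorbed together with [c]. *)
pose u := c * \prod_(i in inv) seedY S i ^ f 0 i.
have powC i (n' : int) : i \in inv -> seedY S i ^ n' \in C.
  move=> iv; case: n' => n'; first by rewrite -exprnP rpredX // central_var.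
  by rewrite NegzE -exprnN -exprVn rpredX // central_varV.
have prodC (g : 'I_N -> int) : \prod_(i in inv) seedY S i ^ g i \in C.
  by apply: rpred_prod => i; exact: powC.
have uV : u^-1 = c^-1 * \prod_(i in inv) seedY S i ^ (- f 0 i).
  by rewrite invfM -prodfV; congr (_ * _); apply: eq_bigr => i _; rewrite invr_expz.
have u0 : u != 0.
  by rewrite mulf_neq0 //; apply/prodf_neq0 => i _; rewrite expfz_neq0.
exists (val u); split.
  split; first by apply/C'P; exists u => //; apply: rpredM; [exact: central_coef|exact: prodC].
  exists (val u^-1); split; last by rewrite -cvalM divff ?cval1.
  apply/C'P; exists u^-1 => //; rewrite uV; apply: rpredM; [exact: central_coef|exact: prodC].
have -> : \prod_(i in ~: (ex :|: inv)) M (ev i) ^+ (l * absz (f 0 i)) =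
    val (\prod_(i in ~: (ex :|: inv)) seedY S i ^ f 0 i).
  rewrite rmorph_prod; apply: eq_bigr => i ie.
  have ie' : i \notin ex by move: ie; rewrite !inE negb_or => /andP[].
  rewrite exprM -(Tfrozen TS) // -seedY_val // -[f 0 i]gez0_abs ?fpos //.
  by rewrite -exprnP rmorphXn.
rewrite -!cvalM; congr val; rewrite DE /u.
suff -> : mon (seedY S) f = (\prod_(i in inv) seedY S i ^ f 0 i) *
    \prod_(i in ~: (ex :|: inv)) seedY S i ^ f 0 i by ring.
rewrite /mon (bigID (mem inv)) /=; congr (_ * _).
rewrite big_mkcond [RHS]big_mkcond; apply: eq_bigr => i _; rewrite !inE negb_or.
case: (i \in inv) => //=; rewrite ?andbF ?andbT //; case: ifP => // /negbFE ie.
by rewrite fex.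
Qed.

End Basis.

Lemma nerve_free : is_free C' A ->
  (exists y : 'I_(l ^ N * r) -> F, is_fbasis C' A y) /\
  forall n (y : 'I_n -> F), is_fbasis C' A y -> n = (l ^ N * r)%N /\
    exists (a : 'I_N -> nat) D, disc C' y D /\ eq_units C' D
      (val ((l ^ N)%:R ^+ (l ^ N * r) * \det G0 ^+ (l ^ N) : Z) *
       \prod_(i in ~: (ex :|: inv)) M (ev i) ^+ (l * a i)).
Proof.
move=> Afree; split=> [|n y yb]; first exact: basis_exists.
by split; [exact: basis_rank yb|exact: nerve_disc].
Qed.

End Nerve.

(** * The two base rings *)

Section Cases.
Variables (F : unitRingType) (divF : division_ring F) (q : F) (l : nat).
Hypotheses (F0 : char0 F) (qc : central q) (qP : l.-primitive_root q) (oddl : odd l).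
Notation Z := (center divF).
Let qz : Z := cen divF q.
Notation Zq := (cyclo_ring qz).
Variables (N : nat) (ex inv : {set 'I_N}) (d : 'I_N -> nat).
Hypothesis co : forall i, i \in ex -> coprime l (d i).
Hypothesis l1 : (1 < l)%N.
Hypothesis exinv : [disjoint ex & inv].
Variables (M : 'rV[int]_N -> F) (Theta : seed F N -> Prop).
Hypothesis Tok : forall S, Theta S -> seed_ok q l ex d S.
Hypothesis Tfrozen : forall S i, Theta S -> i \notin ex -> S.1 (ev i) = M (ev i).
Hypothesis Tinh : exists S, Theta S.
Hypothesis Tconn : forall S S', Theta S -> Theta S' -> path_in q l ex Theta S S'.
Hypothesis Tedge : forall k, k \in ex ->
  exists S S', [/\ Theta S, Theta S' & mutation q l ex k S S'].
Notation A := (A_eps q inv Theta).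

Lemma gensC_central x : gensC l inv Theta x -> exists2 z : Z, x = val z & gensC l inv Theta (val z).
Proof.
move=> Gx; suff [z xE] : exists z : Z, x = val z by exists z; rewrite -?xE.
have [S [TS xE]] := Gx; have [L [Mfr _]] := Tok TS.
have Y0 := frameY_neq0 divF qc qP oddl Mfr.
have YE := frameYE divF qc qP oddl Mfr.
case: xE => [[j ->]|[i [_ ->]]]; first by exists (frameY divF l S.1 j).
by exists (frameY divF l S.1 i)^-1; rewrite cvalV ?YE.
Qed.

Lemma subring_gen_central (k0 : subringClosed Z) (G : F -> Prop) :
  (forall x, G x -> gensC l inv Theta x \/ exists2 z, z \in k0 & x = val z) ->
  (forall x, gensC l inv Theta x -> G x) ->
  (forall z, z \in k0 -> subring_gen G (val z)) ->
  forall x, subring_gen G x <->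
    exists2 z, z \in sring (central_gens l inv k0 Theta) & x = val z.
Proof.
move=> GC CG kG x; split.
  elim=> {x} [x /GC[/gensC_central[z -> zC]|[z zk ->]]||x _ [z zC ->]|
    x y _ [z zC ->] _ [w wC ->]|x y _ [z zC ->] _ [w wC ->]].
  - by exists z => //; apply: sring_gen; right.
  - by exists z => //; apply: sring_gen; left.
  - by exists 1; rewrite ?cval1 ?sring1.
  - by exists (- z); rewrite ?cvalN ?sringN.
  - by exists (z + w); rewrite ?cvalD ?sringD.
  - by exists (z * w); rewrite ?cvalM ?sringM.
by case=> z zC ->; apply: subring_gen_val zC => {x}z [/kG|/CG Gz] //; exact: sg_base.
Qed.

Lemma cyclotomic_case : is_free (C_eps q l inv Theta) A ->
  (exists y : 'I_(l ^ N) -> F, is_fbasis (C_eps q l inv Theta) A y) /\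
  forall n (y : 'I_n -> F), is_fbasis (C_eps q l inv Theta) A y -> n = (l ^ N)%N /\
    exists (a : 'I_N -> nat) D, disc (C_eps q l inv Theta) y D /\
      eq_units (C_eps q l inv Theta) D ((l ^ (N * l ^ N))%:R *
        \prod_(i in ~: (ex :|: inv)) M (ev i) ^+ (l * a i)).
Proof.
have CP : forall x, C_eps q l inv Theta x <->
    exists2 z, z \in sring (central_gens l inv Zq Theta) & x = val z.
  apply: subring_gen_central => [x [Gx|->]|x Gx|z zZ]; [by left| |by left|].
    by right; exists qz; rewrite ?cenK // sring_gen.
  by apply: subring_gen_val zZ => _ ->; apply: sg_base; right; rewrite cenK.
(* Over [Z[q]] itself the scalar basis is [1], with Gram matrix [1], so only the power of [l ^ N]
   remains. *)
pose e (i : 'I_1) : Z := 1.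
have eb : scalar_basis Zq Zq e.
  split=> [i|z zZ|c cZ c0 i]; first exact: sring1.
    by exists (fun=> z) => //; rewrite big_ord1 mulr1.
  by move: c0; rewrite big_ord1 mulr1 (ord1 i).
have eG : trace_form Zq e 1%:M.
  move=> i j; exists 1%:M; split=> [a b|b|]; first by rewrite mxE rpred_nat.
    by rewrite big_ord1 !ord1 mxE !mulr1.
  by rewrite mxtrace1 !ord1 mxE.
have G0nat : exists2 c, c \in Zq & exists n, c * \det (1%:M : 'M[Z]_1) = n.+1%:R.
  by exists 1; rewrite ?sring1 //; exists 0%N; rewrite det1 mulr1.
have := nerve_free F0 qc qP oddl co l1 exinv (fun c ck => ck) eb eG G0nat Tok Tfrozen Tinh
  Tconn Tedge CP.
by rewrite !muln1 det1 expr1n mulr1 -natrX -expnM rmorph_nat.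
Qed.

Lemma integral_case : is_free (C_Z l inv Theta) A ->
  (exists y : 'I_(l ^ N * totient l) -> F, is_fbasis (C_Z l inv Theta) A y) /\
  forall n (y : 'I_n -> F), is_fbasis (C_Z l inv Theta) A y -> n = (l ^ N * totient l)%N /\
    exists (c : 'I_N -> nat) D, disc (C_Z l inv Theta) y D /\
      eq_units (C_Z l inv Theta) D (((l ^ ((N + 1) * totient l))%:R /
          (\prod_(p <- primes l) p ^ (totient l %/ p.-1))%:R) ^+ (l ^ N) *
        \prod_(i in ~: (ex :|: inv)) M (ev i) ^+ (l * c i)).
Proof.
have CP : forall x, C_Z l inv Theta x <->
    exists2 z, z \in sring (central_gens l inv (int_ring Z) Theta) & x = val z.
  by apply: subring_gen_central => [x Gx|x Gx|z zZ] //; [left|exact: subring_gen_val zZ].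
have Z0 := center_char0 divF F0; have qzP : l.-primitive_root qz := qz_prim divF qc qP.
have kZ c : c \in int_ring Z -> c \in Zq by case/int_ringP => n ->; exact: sring_int.
have eb := cyclo_scalar_basis Z0 qzP; have eG := cyclo_trace_form qzP.
have [s] := cyclo_disc Z0 qzP; move: eG; set G0 := _ *m _ => eG.
set P := (\prod_(p <- _) _)%N => GE.
have l0 : (0 < l)%N by exact: ltnW.
have P0 : (0 < P)%N.
  rewrite /P big_seq prodn_cond_gt0 // => p; rewrite mem_primes => /and3P[pp _ _].
  by rewrite expn_gt0 prime_gt0.
have G0nat : exists2 c, c \in int_ring Z & exists n, c * \det G0 = n.+1%:R.
  exists ((-1) ^+ s * P%:R); first by rewrite rpredM ?rpredX ?rpredN ?rpred1 ?rpred_nat.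
  exists (l ^ totient l).-1; rewrite prednK ?expn_gt0 ?l0 //.
  by rewrite -mulrA [P%:R * _]mulrC GE mulrA -expr2 sqrr_sign mul1r.
move=> fr; have [yex ydisc] := nerve_free F0 qc qP oddl co l1 exinv kZ eb eG G0nat Tok Tfrozen
  Tinh Tconn Tedge CP fr.
split=> // n y yb; have [nE [c [D [Dy [u [[uC [v [vC uv]]] DE]]]]]] := ydisc n y yb.
(* The sign of the cyclotomic discriminant, raised to the power [l ^ N], is a unit and is
   absorbed. *)
split=> //; exists c, D; split=> //; pose sg : Z := ((-1) ^+ s) ^+ (l ^ N).
have sgC : C_Z l inv Theta (val sg).
  have sgZ : sg \in int_ring Z by rewrite rpredX ?rpredX ?rpredN ?rpred1.
  exact: subring_gen_val sgZ.
have sg2 : sg * sg = 1 by rewrite -exprMn -expr2 sqrr_sign expr1n.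
exists (u * val sg); split.
  split; first exact: sg_mul.
  exists (val sg * v); split; first exact: sg_mul.
  by rewrite mulrA -(mulrA u) -cvalM sg2 cval1 mulr1.
have Pz : P%:R != 0 :> Z by rewrite -(prednK P0); exact: Z0.
rewrite DE; set pi := \prod_(i in _) _; set x := (_ / _) ^+ _.
suff -> : val ((l ^ N)%:R ^+ (l ^ N * totient l) * \det G0 ^+ (l ^ N) : Z) = val sg * x.
  by rewrite -[_ * x * pi]mulrA !mulrA.
rewrite /x.
have -> : (l ^ ((N + 1) * totient l))%:R / P%:R =
    val ((l ^ ((N + 1) * totient l))%:R / P%:R : Z) :> F.
  by rewrite cvalM cvalV // !rmorph_nat.
rewrite -cvalX -cvalM -exprMn; congr val.
(* Inside the power [l ^ N], the factor [l ^ N] contributes the exponent [N * totient l] and the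
   cyclotomic discriminant one more [totient l]. *)
rewrite mulnC exprM -exprMn; congr (_ ^+ _); apply: (mulIf Pz).
rewrite -mulrA GE mulrCA -!mulrA mulVf // mulr1 -natrX -natrM -expnM -expnD.
by rewrite mulnDl mul1n.
Qed.

End Cases.

(** * The commutative case [l = 1] *)

Lemma det_mx11_nc (R : pzRingType) (A : 'M[R]_1) : \det A = A 0 0.
Proof.
rewrite /determinant (big_pred1 1%g) => [|s].
  by rewrite odd_perm1 expr0 mul1r big_ord1 perm1.
by symmetry; apply/eqP/permP => i; rewrite !ord1.
Qed.

Section CommutativeBase.
Variables (F : unitRingType) (G : F -> Prop).
Hypothesis mulC : forall x y : F, x * y = y * x.
Notation A := (subring_gen G).

Let A0 : A 0. Proof. by rewrite -(addrN 1); apply: sg_add; [|apply: sg_opp]; exact: sg_one. Qed.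

Let A_sum (s : seq (F * F)) : (forall p, p \in s -> A p.1) -> A (\sum_(p <- s) p.1).
Proof.
move=> sA; rewrite big_seq; elim/big_ind: _ => //; exact: sg_add.
Qed.

Lemma self_basis : is_fbasis A A (fun _ : 'I_1 => 1).
Proof.
split; first by move=> i j _; rewrite !ord1.
split=> [y [_ ->]|a Aa|s us sA s0 p ps]; first exact: sg_one.
  exists [:: (a, 1)]; split; last by rewrite big_seq1 mulr1.
  by move=> p; rewrite inE => /eqP->; split=> //; exists ord0.
have s1 p' : p' \in s -> p'.2 = 1 by case/sA => _ [].
have : s = [:: p].
  have size1 : (size s <= 1)%N.
    rewrite -(size_map snd); apply: (uniq_leq_size (s2 := [:: 1]) us) => _ /mapP[p' p's ->].
    by rewrite s1 // inE.
  by case: (s) ps size1 => [|p' [|//]] //; rewrite inE => /eqP->.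
by move=> sE; move: s0; rewrite sE big_seq1 s1 // mulr1.
Qed.

(** Two distinct basis elements would satisfy the relation [y * y' - y' * y = 0] with coefficients
    in [A], so there is one element; as [1] is a multiple of it, it is a unit, and the discriminant
    is its square. *)
Lemma self_basis_disc n (y : 'I_n -> F) : is_fbasis A A y ->
  n = 1%N /\ exists D, disc A y D /\ unit_of A D.
Proof.
case=> yinj [yA span yind].
have Ay i : A (y i) by apply: yA; exists i.
have [s [sP s1]] := span 1 (@sg_one _ _).
have [i0 y0] : exists i0, y i0 != 0.
  apply/existsP; apply: contraT; rewrite negb_exists => /forallP y0.
  have : (1 : F) == 0.
    rewrite s1 big_seq big1 // => p /sP[_ [i ->]].
    by have := y0 i; rewrite negbK => /eqP->; rewrite mulr0.
  by rewrite oner_eq0.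
have all_i0 i : i = i0.
  apply/eqP/negPn/negP => ii0.
  have e0 : y i0 = 0.
    apply: (yind [:: (y i0, y i); (- y i, y i0)] _ _ _ (y i0, y i)); last exact: mem_head.
    - by rewrite /= inE andbT; apply: contraNN ii0 => /eqP/yinj->.
    - move=> p; rewrite !inE => /orP[]/eqP-> /=; split=> //; last by exists i0.
        by exists i.
      exact: sg_opp.
    - by rewrite big_cons big_seq1 /= mulNr (mulC (y i)) subrr.
  by move/eqP: y0; rewrite e0.
have n1 : n = 1%N.
  have := card_ord n; rewrite (eq_card (B := pred1 i0)) ?card1 // => i.
  by rewrite !inE (all_i0 i) eqxx.
split=> //; subst n.
exists (y i0 * y i0); split.
  exists (fun i j => y i * y j); split; last by rewrite det_mx11_nc mxE !(all_i0 0).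
  move=> i j; exists (fun _ _ => y i * y j); split=> [_ _|k|].
  - exact: sg_mul.
  - by rewrite big_ord1; congr (_ * y _); rewrite (all_i0 k); apply/esym/all_i0.
  - by rewrite big_ord1.
pose c := \sum_(p <- s) p.1.
have cA : A c by apply: A_sum => p /sP[].
have c1 : y i0 * c = 1.
  rewrite mulC s1 /c mulr_suml !big_seq; apply: eq_bigr => p /sP[_ [i ->]].
  by rewrite (all_i0 i).
split; first exact: sg_mul.
exists (c * c); split; first exact: sg_mul.
by rewrite -mulrA (mulrA (y i0) c) c1 mul1r.
Qed.

End CommutativeBase.

Section TrivialRoot.
Variables (F : unitRingType) (q : F) (l N : nat) (ex inv : {set 'I_N}).
Variables (M : 'rV[int]_N -> F) (Theta : seed F N -> Prop).
Hypotheses (divF : division_ring F) (F0 : char0 F) (qc : central q) (qP : l.-primitive_root q).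

(** For [l = 1] the frame elements are their own central [l]-th powers, and [F] consists of
    fractions of their combinations. *)
Lemma commutative_of_trivial_root L : l = 1%N -> is_frame q l M L -> forall x y : F, x * y = y * x.
Proof.
move=> l1 Mfr x; have oddl : odd l by rewrite l1.
have Mc f : central (M f) by have := frame_central divF qc qP oddl Mfr f; rewrite l1.
have imc a : in_image q M a -> central a.
  case=> s [sq ->] z; rewrite mulr_sumr mulr_suml !big_seq; apply: eq_bigr => p /sq.
  by move=> /(in_ZqP divF qc)[w _ ->]; rewrite -mulrA Mc mulrA cvalC -mulrA.
have [_ _ _ _ frac] := Mfr; have [a [b [/imc ac /imc bc b0 ->]]] := frac x.
apply/centerP; rewrite rpredM ?rpredV //; exact/centerP.
Qed.

Lemma trivial_root_algebras : l = 1%N ->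
  C_eps q l inv Theta = A_eps q inv Theta /\ C_Z l inv Theta = A_eps q inv Theta.
Proof.
move=> l1; have q1 : q = 1 by have := prim_expr_order qP; rewrite l1 expr1.
have gE : gensC l inv Theta = gensA inv Theta by rewrite l1.
split; apply/funext => x; apply/propext; first by rewrite /C_eps gE.
rewrite /C_Z /A_eps /subalg_gen gE; split; elim=> {x} [x Gx||x _|x y _ + _|x y _ + _].
all: try by [exact: sg_one|exact: sg_opp|exact: sg_add|exact: sg_mul].
  by apply: sg_base; left.
by case: Gx => [Gx|->]; [exact: sg_base|rewrite q1; exact: sg_one].
Qed.

End TrivialRoot.

Theorem theorem6p6 (F : unitRingType) (q : F) (l N : nat)
    (ex inv : {set 'I_N}) (M : 'rV[int]_N -> F) (B : 'M[int]_N)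
    (Theta : seed F N -> Prop) :
  division_ring F -> char0 F -> central q -> l.-primitive_root q ->
  [disjoint ex & inv] ->
  quantum_seed q l ex (M, B) -> coprime_seed q l ex (M, B) ->
  nerve q l ex (M, B) Theta ->
  (is_free (C_eps q l inv Theta) (A_eps q inv Theta) ->
     (exists y : 'I_(l ^ N) -> F, is_fbasis (C_eps q l inv Theta) (A_eps q inv Theta) y) /\
     forall (n : nat) (y : 'I_n -> F),
       is_fbasis (C_eps q l inv Theta) (A_eps q inv Theta) y ->
       n = (l ^ N)%N /\
       exists (a : 'I_N -> nat) (D : F),
         disc (C_eps q l inv Theta) y D /\
         eq_units (C_eps q l inv Theta) D
           ((l ^ (N * l ^ N))%:R *
            \prod_(i in ~: (ex :|: inv)) M (ev i) ^+ (l * a i))) /\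
  (is_free (C_Z l inv Theta) (A_eps q inv Theta) ->
     (exists y : 'I_(l ^ N * totient l) -> F, is_fbasis (C_Z l inv Theta) (A_eps q inv Theta) y) /\
     forall (n : nat) (y : 'I_n -> F),
       is_fbasis (C_Z l inv Theta) (A_eps q inv Theta) y ->
       n = (l ^ N * totient l)%N /\
       exists (c : 'I_N -> nat) (D : F),
         disc (C_Z l inv Theta) y D /\
         eq_units (C_Z l inv Theta) D
           (((l ^ ((N + 1) * totient l))%:R /
             (\prod_(p <- primes l) p ^ (totient l %/ p.-1))%:R) ^+ (l ^ N) *
            \prod_(i in ~: (ex :|: inv)) M (ev i) ^+ (l * c i))).
Proof.
move=> divF F0 qc qP exinv _ [L [d [Mfr cp oddl co]]] [Tmut Tinh Tconn Tedge].
have [l1|l1] := leqP l 1; last first.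
  have Sok : seed_ok q l ex d (M, B) by exists L.
  have Tok S : Theta S -> seed_ok q l ex d S.
    by move=> /Tmut; exact: (mut_equiv_ok divF qc qP oddl co Sok).
  have Tfrozen S i : Theta S -> i \notin ex -> S.1 (ev i) = M (ev i).
    by move=> /Tmut SM ie; exact: (mut_equiv_frozen ie SM).
  split; first exact: (cyclotomic_case divF F0 qc qP oddl co l1 exinv Tok Tfrozen Tinh Tconn Tedge).
  exact: (integral_case divF F0 qc qP oddl co l1 exinv Tok Tfrozen Tinh Tconn Tedge).
have {}l1 : l = 1%N by apply/eqP; rewrite eqn_leq l1 (prim_order_gt0 qP).
have mulC := commutative_of_trivial_root divF qc qP l1 Mfr.
have [-> ->] := trivial_root_algebras inv Theta qP l1.
have one (D : F) : unit_of (A_eps q inv Theta) D -> eq_units (A_eps q inv Theta) D 1.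
  by move=> Du; exists D; rewrite mulr1.
subst l; have prod1 : \prod_(i in ~: (ex :|: inv)) M (ev i) ^+ (1 * 0) = 1 by rewrite big1.
split=> _; split=> [|n y /(self_basis_disc mulC)[n1 [D [Dy /one D1]]]].
- rewrite exp1n; eexists; exact: self_basis.
- split; first by rewrite n1 exp1n.
  by exists (fun=> 0%N), D; rewrite exp1n mul1r prod1.
- rewrite exp1n; eexists; exact: self_basis.
split; first by rewrite n1 exp1n.
by exists (fun=> 0%N), D; rewrite !exp1n big_nil divr1 expr1 mul1r prod1.
Qed.
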